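(* Let $f_1$ and $f_2$ be completely multiplicative functions with $|f_1(n)|\le 1$ and $|f_2(n)|\le1$ for all $n$. Suppose that $\eta>0$ and $x_1$, $x_2$ are real numbers such that, for $j=1,2$, $$ \Big| \sum_{n\leq x_j} f_j(n)\Big| \geq \eta x_j . $$ Then, with $\xi = c \eta^6$ for a suitable absolute constant $c>0$, there exists $x\geq (\min (x_1,x_2) )^{\xi}$ such that $$ \Big| \sum_{n\leq x} f_1(n) f_2(n) \Big| \geq \xi x. $$ *)

(* Defs.v *)
From Stdlib Require Import Reals ZArith.
From Coquelicot Require Import Coquelicot.
Open Scope R_scope.

(* Completely multiplicative arithmetic function with complex values
   (values at 0 are irrelevant). *)
Definition completely_multiplicative (f : nat -> C) : Prop :=
  f 1%nat = 1%C /\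
  forall m n : nat, (1 <= m)%nat -> (1 <= n)%nat -> f (m * n)%nat = Cmult (f m) (f n).

Fixpoint csum (f : nat -> C) (N : nat) : C :=
  match N with
  | O => 0%C
  | S k => Cplus (csum f k) (f (S k))
  end.

(* floor of a real number, truncated to nat (0 for negative reals) *)
Definition nfloor (x : R) : nat := Z.to_nat (Int_part x).

Definition psum (f : nat -> C) (x : R) : C := csum f (nfloor x).

(* Main.v *)
(* The proof uses Halasz's method with the weight Lambda_2 = Lambda log + Lambda * Lambda.

   (1) For completely multiplicative f one has f log^2 = (f Lambda_2) * f.  Since the
   summatory function of Lambda_2 is 2 x log x + O(x), a value |S(N)| >= eta N of the
   summatory function S of f forces the sum of |S(m)| / m^2 over m <= N to be at least
   eta (log N) / 8.  Hence, for some V <= L = log N, the range e^(V/2) < m <= e^V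
   contributes at least h V, where h is a constant times eta (L / V)^(1/2).

   (2) Let F be the Dirichlet series of f and G that of f Lambda_2, so that F'' = F G.
   Correlate F''(1 + 1/V + it) with a trigonometric polynomial B(t) built from the phases
   of S(m), averaging over a finite arithmetic progression of t with Fejer weights.
   The correlation is large by (1), while the mean squares of G and B are under control
   because Lambda_2 is well distributed in short intervals.  By Cauchy-Schwarz there is t
   with |t| << h^(-2) << eta^(-2) and |F(1 + 1/V + it)| >> h V.

   (3) Comparing Euler factors, |F(s)| / zeta(Re s) increases with Re s, and
   zeta(u)^3 |F_12(u + i(t1 + t2))| >= |F_1(u + i t1)|^2 |F_2(u + i t2)|^2 for u > 1,
   where F_12 is the series of f1 f2.  With (2) for f1 and f2 and V the smallest of
   V_1, V_2 and L = log min(x1, x2), this gives |F_12(1 + 1/V + i(t1 + t2))| >> eta^4 L.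

   (4) If the partial sums of f1 f2 were below xi x for every x >= min(x1, x2)^xi, partial
   summation would bound the same value by O((1 + |t1 + t2|) xi L) = O(xi eta^(-2) L),
   a contradiction for xi = c eta^6 with c small. *)

(* The scale [V_j] at which [f_j] is seen to be large is not under control, and a bound [eta V_j]
   there would leave a final value proportional to the smallest scale. The factor [(L / V)^(1/2)] in
   [h] repairs this: [|F_j / zeta|^2] is at least a constant times [eta^2 L_j / V_j], which survives
   the passage to a common smaller [V], and [V (L_1 / V_1) (L_2 / V_2)] is of order at least [L]
   because [V] is one of [V_1], [V_2], [L]. The exponent 6 is 4 from the two squares plus 2 from the
   range of [t].

   For [Lambda] an elementary error [O(x)] is as large as the main term; for [Lambda_2] it is
   smaller by a logarithm. The same estimate gives (1) and, by Abel summation, the bound in short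
   intervals that (2) needs, so neither a sieve nor the prime number theorem enters.

   Averaging over finitely many [t] replaces integrals and Plancherel by exact finite identities.
   The price is a periodic kernel: all logarithms in play must stay within a small part of one
   period. *)
From Stdlib Require Import Reals Lra Lia Classical.
From Coquelicot Require Import Coquelicot.
From HB Require Import structures.
From mathcomp Require Import all_boot.
From mathcomp Require Import zify_ssreflect.
Require Import Defs.
Set Implicit Arguments.
Unset Strict Implicit.
Unset Printing Implicit Defensive.
Delimit Scope R_scope with R.
Open Scope R_scope.
Arguments INR : simpl never.

(** * Finite sums and logarithms *)

HB.instance Definition _ := Monoid.isComLaw.Build R 0 Rplus
  (fun x y z => esym (Rplus_assoc x y z)) Rplus_comm Rplus_0_l.
HB.instance Definition _ := Monoid.isComLaw.Build C (RtoC 0) Cplus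
  Cplus_assoc Cplus_comm Cplus_0_l.

Notation "\rsum_ ( i <- r | P ) F" := (\big[Rplus/0%R]_(i <- r | P%B) F%R)
  (at level 34, F at level 41, i, r at level 50).
Notation "\rsum_ ( m <= i < n ) F" := (\big[Rplus/0%R]_(m <= i < n) F%R)
  (at level 34, F at level 41, i, m, n at level 50).
Notation "\rsum_ ( m <= i < n | P ) F" := (\big[Rplus/0%R]_(m <= i < n | P%B) F%R)
  (at level 34, F at level 41, i, m, n at level 50).
Notation "\csum_ ( i <- r | P ) F" := (\big[Cplus/RtoC 0]_(i <- r | P%B) F%C)
  (at level 34, F at level 41, i, r at level 50).
Notation "\csum_ ( m <= i < n ) F" := (\big[Cplus/RtoC 0]_(m <= i < n) F%C)
  (at level 34, F at level 41, i, m, n at level 50).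
Notation "\csum_ ( m <= i < n | P ) F" := (\big[Cplus/RtoC 0]_(m <= i < n | P%B) F%C)
  (at level 34, F at level 41, i, m, n at level 50).

Definition rleb (x y : R) : bool := if Rle_dec x y then true else false.

Lemma rlebP x y : reflect (x <= y) (rleb x y).
Proof. by rewrite /rleb; case: Rle_dec => H; constructor. Qed.

Lemma INR_leq m n : (m <= n)%N -> INR m <= INR n.
Proof. by move=> H; apply: le_INR; lia. Qed.

Lemma leq_of_INR m n : INR m <= INR n -> (m <= n)%N.
Proof. by move=> /INR_le H; lia. Qed.

Lemma INR_lt0 n : (0 < n)%N -> 0 < INR n.
Proof. by move=> H; apply: lt_0_INR; lia. Qed.

Lemma INR_ge1 n : (0 < n)%N -> 1 <= INR n.
Proof. by move=> H; apply: (@INR_leq 1). Qed.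

Lemma INR0 : INR 0 = 0.
Proof. by []. Qed.

Lemma INR1 : INR 1 = 1.
Proof. by []. Qed.

Lemma INRD m n : INR (m + n)%N = INR m + INR n.
Proof. exact: plus_INR. Qed.

Lemma INRM m n : INR (m * n)%N = INR m * INR n.
Proof. exact: mult_INR. Qed.

Lemma rsum_le m n (P : pred nat) (F G : nat -> R) :
  (forall i, (m <= i < n)%N -> P i -> F i <= G i) ->
  \rsum_(m <= i < n | P i) F i <= \rsum_(m <= i < n | P i) G i.
Proof.
move=> H; rewrite big_nat_cond [X in _ <= X]big_nat_cond.
apply: (big_ind2 Rle) => [||i /andP[Hi Pi]]; [lra|move=> *; lra|exact: H].
Qed.

Lemma rsum_ge0 I (r : seq I) (P : pred I) (F : I -> R) :
  (forall i, P i -> 0 <= F i) -> 0 <= \rsum_(i <- r | P i) F i.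
Proof. by move=> H; apply: (big_ind (Rle 0)) => // [|x y]; lra. Qed.

Lemma rsum_mull I (r : seq I) (P : pred I) (F : I -> R) (c : R) :
  c * \rsum_(i <- r | P i) F i = \rsum_(i <- r | P i) (c * F i).
Proof. exact: (big_morph (Rmult c) (fun x y => Rmult_plus_distr_l c x y) (Rmult_0_r c)). Qed.

Lemma rsum_mulr I (r : seq I) (P : pred I) (F : I -> R) (c : R) :
  (\rsum_(i <- r | P i) F i) * c = \rsum_(i <- r | P i) (F i * c).
Proof. by rewrite Rmult_comm rsum_mull; apply: eq_bigr => i _; rewrite Rmult_comm. Qed.

Lemma rsumD I (r : seq I) (P : pred I) (F G : I -> R) :
  \rsum_(i <- r | P i) (F i + G i) =
  \rsum_(i <- r | P i) F i + \rsum_(i <- r | P i) G i.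
Proof. exact: big_split. Qed.

Lemma rsumB I (r : seq I) (P : pred I) (F G : I -> R) :
  \rsum_(i <- r | P i) (F i - G i) =
  \rsum_(i <- r | P i) F i - \rsum_(i <- r | P i) G i.
Proof.
rewrite (_ : _ - _ = \rsum_(i <- r | P i) F i + (-1) * \rsum_(i <- r | P i) G i); last ring.
by rewrite rsum_mull -rsumD; apply: eq_bigr => i _; ring.
Qed.

Lemma rsum_abs I (r : seq I) (P : pred I) (F : I -> R) :
  Rabs (\rsum_(i <- r | P i) F i) <= \rsum_(i <- r | P i) Rabs (F i).
Proof.
apply: (big_ind2 (fun x y => Rabs x <= y)) => [|x1 x2 y1 y2 H1 H2|i _]; first by rewrite Rabs_R0; lra.
- by have := Rabs_triang x1 y1; lra.
- lra.
Qed.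

Lemma rsum_const m n c : \rsum_(m <= i < n) c = INR (n - m)%N * c.
Proof.
rewrite big_const_nat; elim: (n - m)%N => [|k IH]; first by rewrite INR0 /=; ring.
by rewrite iterS IH S_INR; ring.
Qed.

Lemma rsum_recr m n (F : nat -> R) : (m <= n)%N ->
  \rsum_(m <= i < n.+1) F i = \rsum_(m <= i < n) F i + F n.
Proof. exact: big_nat_recr. Qed.

Lemma rsum_subrange m n (P : pred nat) (F : nat -> R) m' n' :
  (forall i, 0 <= F i) ->
  (forall i, (m <= i < n)%N -> P i -> (m' <= i < n')%N) ->
  \rsum_(m <= i < n | P i) F i <= \rsum_(m' <= i < n') F i.
Proof.
move=> F0 H; pose N := maxn n n'.
have E a b Q : (b <= N)%N -> \rsum_(a <= i < b | Q i) F i =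
   \rsum_(0 <= i < N | (a <= i < b)%N && Q i) F i.
  move=> Hb; rewrite (@big_nat_widen _ _ _ _ _ N) // (@big_nat_widenl _ _ _ a 0) //.
  by apply: eq_bigl => i; lia.
rewrite (E m n) ?(E m' n') ?leq_maxl ?leq_maxr // big_mkcond [X in _ <= X]big_mkcond.
apply: rsum_le => i _ _; have := F0 i.
case: ifP => [/andP[H1 H2]|_]; case: ifP => [_|H3] *; try lra.
by move: H3; rewrite (H _ H1 H2).
Qed.

Lemma csum_mull I (r : seq I) (P : pred I) (F : I -> C) (c : C) :
  (c * \csum_(i <- r | P i) F i)%C = \csum_(i <- r | P i) (c * F i).
Proof. exact: (big_morph (Cmult c) (fun x y => Cmult_plus_distr_l c x y) (Cmult_0_r c)). Qed.

Lemma csum_mulr I (r : seq I) (P : pred I) (F : I -> C) (c : C) :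
  ((\csum_(i <- r | P i) F i) * c)%C = \csum_(i <- r | P i) (F i * c).
Proof. by rewrite Cmult_comm csum_mull; apply: eq_bigr => i _; rewrite Cmult_comm. Qed.

Lemma csumD I (r : seq I) (P : pred I) (F G : I -> C) :
  \csum_(i <- r | P i) (F i + G i) =
  (\csum_(i <- r | P i) F i + \csum_(i <- r | P i) G i)%C.
Proof. exact: big_split. Qed.

Lemma csumB I (r : seq I) (P : pred I) (F G : I -> C) :
  \csum_(i <- r | P i) (F i - G i) =
  (\csum_(i <- r | P i) F i - \csum_(i <- r | P i) G i)%C.
Proof.
rewrite (_ : (_ - _)%C = (\csum_(i <- r | P i) F i + (-(1)) * \csum_(i <- r | P i) G i)%C); last ring.
by rewrite csum_mull -csumD; apply: eq_bigr => i _; ring.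
Qed.

Lemma Cmod_csum I (r : seq I) (P : pred I) (F : I -> C) :
  Cmod (\csum_(i <- r | P i) F i) <= \rsum_(i <- r | P i) Cmod (F i).
Proof.
apply: (big_ind2 (fun x y => Cmod x <= y)) => [|x1 x2 y1 y2 H1 H2|i _]; first by rewrite Cmod_0; lra.
- by have := Cmod_triangle x1 y1; lra.
- lra.
Qed.

Lemma RtoC_rsum I (r : seq I) (P : pred I) (F : I -> R) :
  RtoC (\rsum_(i <- r | P i) F i) = \csum_(i <- r | P i) RtoC (F i).
Proof. exact: (big_morph RtoC RtoC_plus). Qed.

Lemma conj_csum I (r : seq I) (P : pred I) (F : I -> C) :
  Cconj (\csum_(i <- r | P i) F i) = \csum_(i <- r | P i) Cconj (F i).
Proof. by apply: (big_morph Cconj Cplus_conj); rewrite /Cconj /= Ropp_0. Qed.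

Lemma csumE f N : csum f N = \csum_(1 <= i < N.+1) f i.
Proof. by elim: N => [|N IH]; rewrite ?big_nil // big_nat_recr //= IH. Qed.

Lemma csum_bound f N : (forall n, Cmod (f n) <= 1) -> Cmod (csum f N) <= INR N.
Proof.
move=> H; elim: N => [|N IH]; first by rewrite /= Cmod_0 INR0; lra.
by rewrite S_INR /=; have := Cmod_triangle (csum f N) (f N.+1); have := H N.+1; lra.
Qed.

Lemma nfloor_spec x : 0 <= x -> INR (nfloor x) <= x < INR (nfloor x) + 1.
Proof.
move=> Hx; have [H1 H2] := base_Int_part x.
have H3 : (0 <= Int_part x)%Z by apply: le_IZR; apply: Rnot_lt_le => H; 
  have : (Int_part x <= -1)%Z by [have := lt_IZR _ _ H; lia]; move/IZR_le; lra.
by rewrite /nfloor INR_IZR_INZ Znat.Z2Nat.id //; lra.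
Qed.

Lemma nfloor_unique n x : INR n <= x < INR n + 1 -> nfloor x = n.
Proof.
move=> H; have Hn := pos_INR n; have [|H1 H2] := @nfloor_spec x; first lra.
have A : (n < (nfloor x).+1)%N by apply/ltP; apply: INR_lt; rewrite S_INR; lra.
have B : (nfloor x < n.+1)%N by apply/ltP; apply: INR_lt; rewrite S_INR; lra.
lia.
Qed.

Lemma ln_le_sub1 x : 0 < x -> ln x <= x - 1.
Proof. by move=> Hx; have := exp_ineq1_le (ln x); rewrite exp_ln //; lra. Qed.

Lemma ln_ge_1sub x : 0 < x -> 1 - / x <= ln x.
Proof.
move=> Hx; have Hi := Rinv_0_lt_compat _ Hx.
by have := ln_le_sub1 Hi; rewrite ln_Rinv //; lra.
Qed.

Lemma ln_mono x y : 0 < x -> x <= y -> ln x <= ln y.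
Proof. by move=> Hx [H|->]; [left; apply: ln_increasing|right]. Qed.

Lemma ln_ge0 x : 1 <= x -> 0 <= ln x.
Proof. by move=> H; rewrite -ln_1; apply: ln_mono; lra. Qed.

Lemma lnM x y : 0 < x -> 0 < y -> ln (x * y) = ln x + ln y.
Proof. exact: ln_mult. Qed.

Lemma lnV x y : 0 < x -> 0 < y -> ln (x / y) = ln x - ln y.
Proof.
move=> Hx Hy; rewrite /Rdiv lnM ?ln_Rinv //; exact: Rinv_0_lt_compat.
Qed.

Lemma exp_mono x y : x <= y -> exp x <= exp y.
Proof. by move=> [H|->]; [left; apply: exp_increasing|right]. Qed.

Lemma ln_INR_ge0 n : (0 < n)%N -> 0 <= ln (INR n).
Proof. by move=> H; apply/ln_ge0/INR_ge1. Qed.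

Lemma ln_INRM m n : (0 < m)%N -> (0 < n)%N -> ln (INR (m * n)%N) = ln (INR m) + ln (INR n).
Proof. by move=> Hm Hn; rewrite INRM lnM //; apply: INR_lt0. Qed.

Lemma ln_step n : (0 < n)%N -> / INR n.+1 <= ln (INR n.+1) - ln (INR n) <= / INR n.
Proof.
move=> Hn; have H := INR_lt0 Hn; have H' : 0 < INR n.+1 by apply: INR_lt0.
rewrite -lnV //; split.
- have := @ln_ge_1sub (INR n.+1 / INR n); rewrite S_INR in H' *.
  move=> /(_ ltac:(apply: Rdiv_lt_0_compat; lra)).
  rewrite (_ : 1 - _ = / (INR n + 1)) //; by field; lra.
- have := @ln_le_sub1 (INR n.+1 / INR n); rewrite S_INR in H' *.
  move=> /(_ ltac:(apply: Rdiv_lt_0_compat; lra)).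
  rewrite (_ : _ / _ - 1 = / (INR n)) //; by field; lra.
Qed.

Lemma harmonic_block a b : (0 < a <= b)%N ->
  \rsum_(a.+1 <= m < b.+1) / INR m <= ln (INR b) - ln (INR a).
Proof.
move=> /andP[Ha]; elim: b => [|b IH] Hab; first lia.
case: (ltnP b a) => H.
  have -> : a = b.+1 by lia.
  by rewrite big_geq //; lra.
rewrite big_nat_recr /=; last lia.
have Hb : (0 < b)%N by lia.
by have := IH H; have := ln_step Hb; lra.
Qed.

Lemma harmonic_le n : (0 < n)%N -> \rsum_(1 <= m < n.+1) / INR m <= 1 + ln (INR n).
Proof.
move=> Hn; rewrite big_ltn //.
have := @harmonic_block 1 n; rewrite INR1 ln_1 Rinv_1 => /(_ Hn); lra.
Qed.

(** Stirling's bound [n! >= (n / e)^n]: passing from [n] to [n + 1] adds at most [1 / n] to each of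
    [n] terms, so the total grows by at most 1. *)
Lemma sum_ln_quot_le n : \rsum_(1 <= m < n.+1) (ln (INR n) - ln (INR m)) <= INR n.
Proof.
elim: n => [|n IH]; first by rewrite big_nil ?INR0; lra.
rewrite big_nat_recr //= Rminus_diag.
case: n IH => [|n] IH; first by rewrite big_nil INR1; lra.
have -> : \rsum_(1 <= m < n.+2) (ln (INR n.+2) - ln (INR m)) =
   \rsum_(1 <= m < n.+2) (ln (INR n.+1) - ln (INR m)) +
   \rsum_(1 <= m < n.+2) (ln (INR n.+2) - ln (INR n.+1)).
  by rewrite -rsumD; apply: eq_bigr => i _; ring.
rewrite rsum_const subn1 [n.+2.-1]/=.
have [_ H] := @ln_step n.+1 isT.
have H1 := @INR_lt0 n.+1 isT.
have : INR n.+1 * (ln (INR n.+2) - ln (INR n.+1)) <= 1.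
  rewrite -(Rinv_r (INR n.+1)); last lra.
  by apply: Rmult_le_compat_l; lra.
have := S_INR n.+1. lra.
Qed.

(** * Selberg's weight *)

Lemma big_multiples (T : Type) (idx : T) (op : Monoid.com_law idx) d N (G : nat -> T) :
  (0 < d)%N ->
  \big[op/idx]_(1 <= n < N.+1 | d %| n) G n = \big[op/idx]_(1 <= e < (N %/ d).+1) G (d * e)%N.
Proof.
move=> Hd; elim: N => [|N IH]; first by rewrite div0n !big_geq.
rewrite big_mkcond big_nat_recr // -big_mkcond IH divnS //.
case: ifP => H; rewrite ?Monoid.mulm1 ?add0n // add1n [in RHS]big_nat_recr //=.
by rewrite (_ : d * _ = N.+1)%N // mulnC -[RHS](divnK H) divnS // H.
Qed.

(** The substitution [n = d e]. An arbitrary commutative monoid is allowed because convolutions are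
    summed both in [R] and in [C]. *)
Lemma big_divisors (T : Type) (idx : T) (op : Monoid.com_law idx) N (F : nat -> nat -> T) :
  \big[op/idx]_(1 <= n < N.+1) \big[op/idx]_(1 <= d < n.+1 | d %| n) F d (n %/ d)%N =
  \big[op/idx]_(1 <= d < N.+1) \big[op/idx]_(1 <= e < (N %/ d).+1) F d e.
Proof.
transitivity (\big[op/idx]_(1 <= n < N.+1)
    \big[op/idx]_(1 <= d < N.+1 | d %| n) F d (n %/ d)%N).
  apply: eq_big_nat => n Hn; rewrite (@big_nat_widen _ _ _ _ n.+1 N.+1); last lia.
  apply: congr_big => // d; case E: (d %| n) => //=.
  by apply/idP/idP => //; have := dvdn_leq _ E; lia.
rewrite (@exchange_big_dep_nat _ _ op _ _ _ _ xpredT (fun n d => d %| n) xpredT) //=; apply: eq_big_nat => d /andP[Hd _].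
rewrite (@big_multiples _ _ op d N (fun n => F d (n %/ d)%N)) //.
by apply: eq_bigr => e _; rewrite mulKn.
Qed.

Lemma big_hyperbola (T : Type) (idx : T) (op : Monoid.com_law idx) N (F : nat -> nat -> T) :
  \big[op/idx]_(1 <= d < N.+1) \big[op/idx]_(1 <= e < (N %/ d).+1) F d e =
  \big[op/idx]_(1 <= e < N.+1) \big[op/idx]_(1 <= d < (N %/ e).+1) F d e.
Proof.
have E (H : nat -> nat -> T) :
  \big[op/idx]_(1 <= d < N.+1) \big[op/idx]_(1 <= e < (N %/ d).+1) H d e =
  \big[op/idx]_(1 <= d < N.+1) \big[op/idx]_(1 <= e < N.+1 | (d * e <= N)%N) H d e.
  apply: eq_big_nat => d /andP[Hd _].
  rewrite (@big_nat_widen _ _ _ _ (N %/ d).+1 N.+1); last by rewrite ltnS leq_div.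
  by apply: eq_bigl => e /=; rewrite ltnS leq_divRL // mulnC.
rewrite E (E (fun e d => F d e)) (@exchange_big_dep_nat _ _ op _ _ _ _ xpredT (fun d e => d * e <= N)%N xpredT) //=.
by apply: eq_bigr => e _; apply: eq_bigl => d; rewrite mulnC.
Qed.

(** * Moebius and von Mangoldt functions *)

Definition mobius n : R :=
  if all (fun p => logn p n == 1%N) (primes n) then (-1) ^ size (primes n) else 0.

Lemma mobius_bound n : Rabs (mobius n) <= 1.
Proof.
rewrite /mobius; case: ifP => _; last by rewrite Rabs_R0; lra.
by rewrite pow_1_abs; lra.
Qed.

Lemma mobius_mulp p d : prime p -> (0 < d)%N -> ~~ (p %| d) ->
  mobius (p * d) = - mobius d.
Proof.
move=> Hp Hd Hpd; have Hp0 := prime_gt0 Hp.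
have E : primes (p * d) =i p :: primes d.
  by move=> q; rewrite primesM // primes_prime // !inE.
have Npd : p \notin primes d by rewrite mem_primes Hp Hd.
have Es : size (primes (p * d)) = (size (primes d)).+1.
  have U : uniq (p :: primes d) by rewrite /= Npd primes_uniq.
  exact: (perm_size (uniq_perm (primes_uniq _) U E)).
rewrite /mobius Es (eq_all_r E) /= lognM // logn_prime // eqxx.
have -> : logn p d = 0%N by apply/eqP; rewrite -leqn0 leqNgt logn_gt0.
rewrite /=.
have -> : all (fun q => logn q (p * d) == 1%N) (primes d) =
          all (fun q => logn q d == 1%N) (primes d).
  apply: eq_in_all => q Hq; rewrite lognM // logn_prime //.
  by case: (q =P p) => // E1; rewrite -E1 Hq in Npd.
by case: ifP => _ /=; ring.
Qed.

Lemma mobius_square p d : prime p -> (0 < d)%N -> p %| d -> mobius (p * d) = 0.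
Proof.
move=> Hp Hd Hpd; have Hp0 := prime_gt0 Hp.
rewrite /mobius; case: ifP => // /allP /(_ p).
rewrite primesM // primes_prime // !inE eqxx => /(_ isT).
rewrite lognM // logn_prime // eqxx.
have : (0 < logn p d)%N by rewrite logn_gt0 mem_primes Hp Hd.
by case: (logn p d).
Qed.

(** Let [p] be the least prime factor of [n = p m]. A divisor [p e] contributes [- mobius e] if [p]
    does not divide [e] and 0 otherwise, while the divisors prime to [p] are those of [m] prime to
    [p]; the two parts cancel. *)
Lemma mobius_sum n : (0 < n)%N ->
  \rsum_(1 <= d < n.+1 | d %| n) mobius d = if n == 1%N then 1 else 0.
Proof.
case: n => [//|[|n]] _.
  by rewrite big_mkcond big_nat1 /mobius.
set N := n.+2; have HN : (1 < N)%N by [].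
have Hp := pdiv_prime HN; set p := pdiv N in Hp.
have Hp0 := prime_gt0 Hp.
have [m Em] : exists m, N = (p * m)%N.
  by exists (N %/ p)%N; rewrite mulnC divnK // pdiv_dvd.
have Hm : (0 < m)%N by case: m Em => //; rewrite muln0.
rewrite (bigID (fun d => p %| d)) /=.
have -> : \rsum_(1 <= d < N.+1 | (d %| N) && (p %| d)) mobius d =
   \rsum_(1 <= e < m.+1) (if (e %| m) && ~~ (p %| e) then - mobius e else 0).
  transitivity (\rsum_(1 <= d < N.+1 | p %| d) (if d %| N then mobius d else 0)).
    rewrite big_mkcond [RHS]big_mkcond; apply: eq_bigr => d _.
    by case: (d %| N); case: (p %| d).
  rewrite big_multiples //; have -> : (N %/ p = m)%N by rewrite Em mulKn.
  apply: eq_big_nat => e /andP[He _]; rewrite Em dvdn_pmul2l //.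
  case: (e %| m) => //=; case E: (p %| e) => /=.
    by rewrite mobius_square.
  by rewrite mobius_mulp // E.
have -> : \rsum_(1 <= d < N.+1 | (d %| N) && ~~ (p %| d)) mobius d =
   \rsum_(1 <= e < m.+1) (if (e %| m) && ~~ (p %| e) then mobius e else 0).
  rewrite -big_mkcond (@big_nat_widen _ _ _ _ m.+1 N.+1); last first.
    by rewrite ltnS Em leq_pmull.
  apply: eq_bigl => d; case E: (p %| d); rewrite /= ?andbF // !andbT.
  rewrite Em Gauss_dvdr; last by rewrite coprime_sym prime_coprime // E.
  by case E2: (d %| m) => //=; rewrite ltnS dvdn_leq.
rewrite -rsumD big1 // => e _; case: ifP => _; ring.
Qed.

Definition mangoldt n : R := if size (primes n) == 1%N then ln (INR (pdiv n)) else 0.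

Lemma mangoldt_ge0 n : 0 <= mangoldt n.
Proof.
by rewrite /mangoldt; case: ifP => _; [apply: ln_INR_ge0; exact: pdiv_gt0|lra].
Qed.

(** Strong induction through [n = p m] with [p] prime: among the divisors of [n] that do not divide
    [m], only the full power [p ^ a] has nonzero weight, and it adds the missing [ln p]. *)
Lemma mangoldt_sum n : (0 < n)%N -> \rsum_(1 <= d < n.+1 | d %| n) mangoldt d = ln (INR n).
Proof.
have [k] := ubnP n; elim: k n => // k IH n Hk Hn.
case: (ltngtP n 1) => H1; [lia| |by rewrite H1 big_mkcond big_nat1 /mangoldt INR1 ln_1].
have Hp := pdiv_prime H1; set p := pdiv n in Hp.
have Hp0 := prime_gt0 Hp; have Hp1 := prime_gt1 Hp.
have [m Em] : exists m, n = (p * m)%N.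
  by exists (n %/ p)%N; rewrite mulnC divnK // pdiv_dvd.
have Hm : (0 < m)%N by case: m Em Hn => // ->; rewrite muln0.
have Hmn : (m < n)%N by rewrite Em; nia.
set a := logn p n.
have Ea : a = (logn p m).+1 by rewrite /a Em lognM // logn_prime // eqxx.
rewrite (bigID (fun d => d %| m)) /=.
have -> : \rsum_(1 <= d < n.+1 | (d %| n) && (d %| m)) mangoldt d = ln (INR m).
  rewrite -(IH m) //; last lia.
  rewrite (@big_nat_widen _ _ _ _ m.+1 n.+1); last lia.
  apply: eq_bigl => d; case E: (d %| m); rewrite /= ?andbF //.
  by rewrite Em dvdn_mull // ltnS dvdn_leq.
have Hpa : (p ^ a %| n)%N by rewrite pfactor_dvdn.
have Epa : primes (p ^ a)%N = [:: p] by rewrite Ea primesX // primes_prime.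
have Hpm : ~~ (p ^ a %| m)%N by rewrite pfactor_dvdn // Ea ltnn.
rewrite big_mkcond (@bigD1_seq _ _ _ _ _ (p ^ a)%N) ?iota_uniq //=; last first.
  by rewrite mem_index_iota expn_gt0 Hp0 /= ltnS dvdn_leq.
rewrite Hpa Hpm big1 => [|d Hda].
  rewrite Rplus_0_r /mangoldt Epa /= Ea pdiv_pfactor // Em ln_INRM //; ring.
case: ifP => // /andP[Hdn Hdm].
rewrite /mangoldt; case: eqP => // Hs.
have Hd : (0 < d)%N by apply: dvdn_gt0 Hdn.
have [q Eq] : exists q, primes d = [:: q].
  by case: (primes d) Hs => [|q [|? ?]] // _; exists q.
have Hq : prime q.
  have : q \in primes d by rewrite Eq inE.
  by rewrite mem_primes => /andP[].
have Ed : d = (q ^ logn q d)%N.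
  have := prod_prime_decomp Hd; rewrite prime_decompE Eq /= big_cons big_nil /= muln1 //.
case: (eqVneq q p) => Eqp.
  rewrite Eqp in Ed; move: Hdn Hdm Hda; rewrite Ed !pfactor_dvdn // -/a Ea => H2 H3.
  by rewrite (_ : logn p d = (logn p m).+1) ?eqxx //; lia.
have Hc : coprime d p.
  by rewrite Ed coprimeXl // prime_coprime // dvdn_prime2 //.
by move: Hdm; rewrite -(Gauss_dvdr m Hc) -Em Hdn.
Qed.

(* Selberg's [Lambda_2 = Lambda log + Lambda * Lambda]. *)
Definition lam n : R :=
  mangoldt n * ln (INR n) + \rsum_(1 <= d < n.+1 | d %| n) (mangoldt d * mangoldt (n %/ d)).

Lemma lam_ge0 n : 0 <= lam n.
Proof.
case: n => [|n].
  by rewrite /lam big_geq // /mangoldt /=; lra.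
apply: Rplus_le_le_0_compat.
  by apply: Rmult_le_pos; [exact: mangoldt_ge0|exact: ln_INR_ge0].
by apply: rsum_ge0 => d _; apply: Rmult_le_pos; apply: mangoldt_ge0.
Qed.

(** Since [mangoldt] convolved with 1 is [ln], the two parts of [lam] combine to the divisor sum of
    [mangoldt d] times [ln d + ln (n / d) = ln n]. *)
Lemma lam_sum n : (0 < n)%N -> \rsum_(1 <= d < n.+1 | d %| n) lam d = ln (INR n) ^ 2.
Proof.
move=> Hn; rewrite /lam rsumD.
(* The condition [d %| n] moves into the summand, because [big_divisors] has its outer sum over all
   [d <= n]. *)
pose g e k := if e * k %| n then mangoldt e * mangoldt k else 0.
have -> : \rsum_(1 <= d < n.+1 | d %| n)
   \rsum_(1 <= e < d.+1 | e %| d) (mangoldt e * mangoldt (d %/ e)) =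
   \rsum_(1 <= d < n.+1) \rsum_(1 <= e < d.+1 | e %| d) g e (d %/ e)%N.
  rewrite big_mkcond; apply: eq_bigr => d _; case: ifP => H.
    by apply: eq_bigr => e He; rewrite /g mulnC divnK // H.
  by rewrite big1 // => e He; rewrite /g mulnC divnK // H.
rewrite big_divisors.
have -> : \rsum_(1 <= e < n.+1) \rsum_(1 <= k < (n %/ e).+1) g e k =
   \rsum_(1 <= e < n.+1 | e %| n) (mangoldt e * (ln (INR n) - ln (INR e))).
  rewrite [RHS]big_mkcond; apply: eq_big_nat => e /andP[He Hen]; case: ifP => H; last first.
    rewrite big1 // => k _; rewrite /g; case: ifP => // H2.
    by move: H; rewrite (dvdn_trans _ H2) // dvdn_mulr.
  have Hne : (0 < n %/ e)%N by rewrite divn_gt0.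
  have -> : ln (INR n) - ln (INR e) = ln (INR (n %/ e)).
    by rewrite -{1}(divnK H) ln_INRM //; ring.
  rewrite -mangoldt_sum // rsum_mull [RHS]big_mkcond; apply: eq_bigr => k _.
  by rewrite /g -{1}(divnK H) [(n %/ e * e)%N]mulnC dvdn_pmul2l.
rewrite -rsumD (eq_bigr (fun d => ln (INR n) * mangoldt d)) => [|d _]; last ring.
by rewrite -rsum_mull mangoldt_sum //; ring.
Qed.

(** * Selberg's asymptotic formula *)

Lemma ln_sqrt_half x : 0 < x -> ln (sqrt x) = ln x / 2.
Proof.
move=> Hx; have Hs := sqrt_lt_R0 _ Hx.
by rewrite -{2}(sqrt_sqrt x) ?lnM //; lra.
Qed.

Lemma ln_le_2sqrt x : 0 < x -> ln x <= 2 * sqrt x.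
Proof.
move=> Hx; have Hs := sqrt_lt_R0 _ Hx; have := ln_le_sub1 Hs.
by rewrite ln_sqrt_half //; lra.
Qed.

Lemma ln2_le_16sqrt x : 1 <= x -> ln x ^ 2 <= 16 * sqrt x.
Proof.
move=> Hx; have Hs : 0 < sqrt x by apply: sqrt_lt_R0; lra.
have := ln_le_2sqrt Hs; rewrite ln_sqrt_half; last lra.
have := ln_ge0 Hx; have := sqrt_lt_R0 _ Hs; have := sqrt_sqrt (sqrt x) ltac:(lra).
move=> H1 H2 H3 H4; rewrite -H1; nra.
Qed.

Lemma cauchy_tail (s b : nat -> R) :
  (forall n m, (1 <= n <= m)%N -> Rabs (s m - s n) <= b n) ->
  (forall eps, 0 < eps -> exists N, (1 <= N)%N /\ b N < eps) ->
  exists l, forall n, (1 <= n)%N -> Rabs (s n - l) <= b n.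
Proof.
move=> H Hb.
have [l Hl] : ex_finite_lim_seq s.
  apply/ex_lim_seq_cauchy_corr => eps.
  have [N [HN1 HN]] := Hb (eps / 2) ltac:(have := cond_pos eps; lra).
  exists N => n m Hn Hm.
  have A := H N n ltac:(lia); have B := H N m ltac:(lia).
  rewrite (_ : s n - s m = (s n - s N) - (s m - s N)); last ring.
  have := Rabs_triang (s n - s N) (- (s m - s N)); rewrite Rabs_Ropp.
  move: A B; rewrite /Rminus; lra.
exists l => n Hn; apply: Rnot_lt_le => Hlt.
have /is_lim_seq_spec Hl' := Hl.
have [N HN] := Hl' (mkposreal _ (ltac:(lra) : 0 < Rabs (s n - l) - b n)).
have /= A := HN (maxn n N) ltac:(lia).
have B := H n (maxn n N) ltac:(lia).
have := Rabs_triang (s n - s (maxn n N)) (s (maxn n N) - l).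
rewrite (_ : _ + _ = s n - l); last ring.
by rewrite (Rabs_minus_sym (s n) (s (maxn n N))); lra.
Qed.

(** Yields Euler's and Stieltjes' constants together with a rate: terms dominated by the decrements
    of [b] have a tail from [n] on of at most [b n]. *)
Lemma telescoping_limit (e b : nat -> R) :
  (forall n, (1 <= n)%N -> Rabs (e n) <= b n - b n.+1) ->
  (forall n, (1 <= n)%N -> 0 <= b n) ->
  (forall eps, 0 < eps -> exists N, (1 <= N)%N /\ b N < eps) ->
  exists l, forall n, (1 <= n)%N -> Rabs (\rsum_(1 <= i < n) e i - l) <= b n.
Proof.
move=> He Hb0 Hb; apply: cauchy_tail => // n m /andP[Hn].
elim: m => [|m IH] Hm; first lia.
case: (ltngtP n m.+1) Hm => // [Hm _|-> _]; last first.
  by rewrite Rminus_diag Rabs_R0; exact: Hb0.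
have {}IH : Rabs (\rsum_(1 <= i < m) e i - \rsum_(1 <= i < n) e i) <= b n - b m.
  have K p : Rabs (\rsum_(1 <= i < (n + p)%N) e i - \rsum_(1 <= i < n) e i) <= b n - b (n + p)%N.
    elim: p => [|p IHp]; first by rewrite addn0 !Rminus_diag Rabs_R0; lra.
    rewrite addnS big_nat_recr /=; last lia.
    have := Rabs_triang (\rsum_(1 <= i < (n + p)%N) e i - \rsum_(1 <= i < n) e i) (e (n + p)%N).
    rewrite (_ : _ - _ + _ = \rsum_(1 <= i < (n + p)%N) e i + e (n + p)%N - \rsum_(1 <= i < n) e i); last ring.
    by have := He (n + p)%N ltac:(lia); lra.
  by have := K (m - n)%N; rewrite subnKC //; lia.
have Hm1 : (1 <= m)%N by lia.
rewrite big_nat_recr //=.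
have := Rabs_triang (\rsum_(1 <= i < m) e i - \rsum_(1 <= i < n) e i) (e m).
rewrite (_ : _ - _ + _ = \rsum_(1 <= i < m) e i + e m - \rsum_(1 <= i < n) e i); last ring.
have := He m Hm1; have := Hb0 m.+1 isT; lra.
Qed.

Lemma exists_INR_gt x : exists N, (1 <= N)%N /\ x < INR N.
Proof.
exists (nfloor (Rmax x 0)).+1; split => //.
have := @nfloor_spec (Rmax x 0) (Rmax_r _ _); rewrite S_INR.
have := Rmax_l x 0; lra.
Qed.

Lemma euler_gamma : exists g, forall n, (1 <= n)%N ->
  Rabs (\rsum_(1 <= i < n.+1) / INR i - (ln (INR n) + g)) <= 2 / INR n.
Proof.
have [||| g Hg] := @telescoping_limit (fun i => / INR i - (ln (INR i.+1) - ln (INR i))) (fun i => / INR i).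
- by move=> n Hn /=; have := ln_step Hn => ?; rewrite Rabs_pos_eq; lra.
- by move=> n /INR_lt0 Hn; left; apply: Rinv_0_lt_compat.
- move=> eps He; have [N [H1 H2]] := exists_INR_gt (/ eps); exists N; split => //.
  rewrite -(Rinv_inv eps); apply: Rinv_lt_contravar => //.
  by apply: Rmult_lt_0_compat; [exact: Rinv_0_lt_compat|exact: INR_lt0].
exists g => n Hn; have := Hg n Hn; rewrite rsumB.
have -> : \rsum_(1 <= i < n) (ln (INR i.+1) - ln (INR i)) = ln (INR n).
  elim: n Hn => // n IH _; case: n IH => [|n] IH.
    by rewrite big_geq // INR1 ln_1.
  by rewrite big_nat_recr //= IH //; ring.
rewrite big_nat_recr //= => H.
have Hi : 0 < / INR n by apply/Rinv_0_lt_compat/INR_lt0.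
have := Rabs_triang (\rsum_(1 <= i < n) / INR i - ln (INR n) - g) (/ INR n).
rewrite (Rabs_pos_eq (/ _)); last lra.
rewrite (_ : _ - _ - _ + _ = \rsum_(1 <= i < n) / INR i + / INR n - (ln (INR n) + g)); last ring.
rewrite /Rdiv; lra.
Qed.

(** The true error has order [ln n / n]. The cruder [1 / sqrt n] telescopes easily and suffices,
    because the errors [sqrt (N / d)] still add up to [O(N)] over [d <= N]. *)
Lemma stieltjes_gamma1 : exists g, forall n, (1 <= n)%N ->
  Rabs (\rsum_(1 <= i < n.+1) (ln (INR i) / INR i) - (ln (INR n) ^ 2 / 2 + g)) <= 8 / sqrt (INR n).
Proof.
have [||| g Hg] := @telescoping_limit
   (fun i => ln (INR i) / INR i - (ln (INR i.+1) ^ 2 / 2 - ln (INR i) ^ 2 / 2)) (fun i => 6 / sqrt (INR i)).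
- move=> n Hn; have [D1 D2] := ln_step Hn; have Hl := ln_INR_ge0 Hn.
  have HN := INR_ge1 Hn; have HS := S_INR n.
  have L := @ln_le_2sqrt (INR n) ltac:(lra).
  set d := ln (INR n.+1) - ln (INR n) in D1 D2.
  have -> : ln (INR n.+1) = ln (INR n) + d by rewrite /d; ring.
  set l := ln (INR n) in Hl L *.
  set r := sqrt (INR n) in L *; set r' := sqrt (INR n.+1).
  have Hr : 1 <= r by rewrite -sqrt_1; apply: sqrt_le_1_alt.
  have Er : INR n = r * r by rewrite /r sqrt_sqrt //; lra.
  have Er' : INR n.+1 = r' * r' by rewrite /r' sqrt_sqrt //; lra.
  have Hr' : r < r' by apply: sqrt_lt_1_alt; lra.
  have -> : l / INR n - ((l + d) ^ 2 / 2 - l ^ 2 / 2) = l * (/ INR n - d) - d ^ 2 / 2 by field; lra.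
  have E1 : 0 <= l * (/ INR n - d) <= 2 * r * (/ INR n - / INR n.+1).
    split; first by apply: Rmult_le_pos; lra.
    by apply: Rmult_le_compat; lra.
  have Hd : 0 <= d by have := Rinv_0_lt_compat _ (ltac:(lra) : 0 < INR n.+1); lra.
  have E2 : 0 <= d ^ 2 / 2 <= (/ INR n) ^ 2 / 2 by nra.
  have E3 : 6 / r - 6 / r' = 6 / (r * r' * (r' + r)).
    have : r' * r' = r * r + 1 by lra.
    move=> H; have -> : 6 / r - 6 / r' = 6 * (r' - r) / (r * r') by field; lra.
    have -> : r' - r = / (r' + r).
      by apply: (Rmult_eq_reg_r (r' + r)); [rewrite Rinv_l; lra|lra].
    by field; lra.
  rewrite E3; apply: Rle_trans (_ : 2 * r * (/ INR n - / INR n.+1) + (/ INR n) ^ 2 / 2 <= _).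
    by apply: Rabs_le; lra.
  have E4 : 2 * r * (/ INR n - / INR n.+1) = 2 / (r * (r' * r')).
    rewrite HS in Er' *; rewrite -Er' Er; field; nra.
  have E5 : (/ INR n) ^ 2 / 2 <= 1 / (r * (r' * r')).
    rewrite Er.
    have -> : (/ (r * r)) ^ 2 / 2 = / (2 * (r * r * (r * r))) by field; lra.
    rewrite /Rdiv Rmult_1_l; apply: Rinv_le_contravar; first by nra.
    have : r' * r' <= 2 * (r * r) by lra.
    have : 1 * r <= r * r by apply: Rmult_le_compat_r; lra.
    nra.
  have E6 : 3 / (r * (r' * r')) <= 6 / (r * r' * (r' + r)).
    rewrite (_ : 3 / _ = 6 / (2 * (r * (r' * r')))); last by field; lra.
    apply: Rmult_le_compat_l; first lra.
    apply: Rinv_le_contravar; first by apply: Rmult_lt_0_compat; nra.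
    have : 0 <= r * r' * (r' - r) by apply: Rmult_le_pos; [apply: Rmult_le_pos|]; lra.
    lra.
  by rewrite E4; move: E5 E6; rewrite /Rdiv; lra.
- move=> n /INR_lt0 Hn; left; apply: Rdiv_lt_0_compat; first lra; exact: sqrt_lt_R0.
- move=> eps He; have [N [H1 H2]] := exists_INR_gt ((6 / eps) ^ 2); exists N; split => //.
  have H0 : 0 < 6 / eps by apply: Rdiv_lt_0_compat; lra.
  have H3 : 6 / eps < sqrt (INR N).
    rewrite -(sqrt_pow2 (6 / eps)); last lra.
    by apply: sqrt_lt_1_alt; split => //; exact: pow2_ge_0.
  apply: (Rmult_lt_reg_r (sqrt (INR N))); first lra.
  rewrite /Rdiv Rmult_assoc Rinv_l; last lra.
  have := Rmult_lt_compat_r _ _ _ He H3.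
  rewrite (_ : 6 / eps * eps = 6); last by field; lra.
  lra.
exists g => n Hn; have := Hg n Hn; rewrite rsumB.
have -> : \rsum_(1 <= i < n) (ln (INR i.+1) ^ 2 / 2 - ln (INR i) ^ 2 / 2) = ln (INR n) ^ 2 / 2.
  elim: n Hn => // n IH _; case: n IH => [|n] IH.
    by rewrite big_geq // INR1 ln_1; lra.
  by rewrite big_nat_recr //= IH //; lra.
rewrite big_nat_recr //= => H.
have HN := INR_ge1 Hn.
have Hs : 0 < sqrt (INR n) by apply: sqrt_lt_R0; lra.
have Hi : 0 <= ln (INR n) / INR n <= 2 / sqrt (INR n).
  split.
    by apply: Rmult_le_pos; [exact: ln_INR_ge0|left; apply: Rinv_0_lt_compat; lra].
  have E : / INR n = / sqrt (INR n) * / sqrt (INR n).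
    by rewrite -{1}(sqrt_sqrt (INR n)) ?Rinv_mult //; lra.
  have -> : 2 / sqrt (INR n) = 2 * sqrt (INR n) * / INR n by rewrite E; field; lra.
  apply: Rmult_le_compat_r; first by left; apply: Rinv_0_lt_compat; lra.
  by apply: ln_le_2sqrt; lra.
have := Rabs_triang (\rsum_(1 <= i < n) (ln (INR i) / INR i) - ln (INR n) * (ln (INR n) * 1) / 2 - g) (ln (INR n) / INR n).
rewrite (Rabs_pos_eq (_ / INR n)); last lra.
rewrite (_ : _ - _ - _ + _ = \rsum_(1 <= i < n) (ln (INR i) / INR i) + ln (INR n) / INR n -
   (ln (INR n) * (ln (INR n) * 1) / 2 + g)); last ring.
move: H Hi; rewrite /Rdiv; lra.
Qed.

Definition ln2_prim (x : R) : R := x * ln x ^ 2 - 2 * x * ln x + 2 * x.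

Lemma ln2_prim_mvt x y : 0 < x -> x <= y -> 
  exists c, x <= c <= y /\ ln2_prim y - ln2_prim x = ln c ^ 2 * (y - x).
Proof.
move=> Hx [Hxy|->]; last by exists y; split; [lra|ring].
have [c [Hc1 Hc2]] := MVT_cor2 ln2_prim (fun c => ln c ^ 2) x y Hxy
  ltac:(move=> c Hc; apply/is_derive_Reals; rewrite /ln2_prim; auto_derive; [lra|rewrite (S_INR 1) INR1; field; lra]).
by exists c; split; [lra|].
Qed.

Lemma sum_ln2 N : (0 < N)%N ->
  Rabs (\rsum_(1 <= n < N.+1) (ln (INR n) ^ 2) - ln2_prim (INR N)) <= 2 + ln (INR N) ^ 2.
Proof.
(* The [-2] is [- ln2_prim 1]; each further term is compared with the increment of [ln2_prim] over a
   unit interval, [ln ^ 2] being monotone. *)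
move=> HN; have : -2 <= \rsum_(1 <= n < N.+1) (ln (INR n) ^ 2) - ln2_prim (INR N) <= -2 + ln (INR N) ^ 2.
  elim: N HN => // N IH _; case: N IH => [|N] IH.
    by rewrite big_nat1 INR1 /ln2_prim ln_1; lra.
  have {}IH := IH isT; rewrite big_nat_recr //=.
  have H1 := @INR_ge1 N.+1 isT; have HS := S_INR N.+1.
  have [c [Hc1 Hc2]] := @ln2_prim_mvt (INR N.+1) (INR N.+2) ltac:(lra) ltac:(lra).
  have A1 := ln_mono (ltac:(lra) : 0 < INR N.+1) Hc1.1.
  have A2 := ln_mono (ltac:(lra) : 0 < c) Hc1.2.
  have A0 := ln_ge0 H1.
  have -> : ln2_prim (INR N.+2) = ln2_prim (INR N.+1) + ln c ^ 2 by move: Hc2; rewrite HS; lra.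
  have : ln (INR N.+1) ^ 2 <= ln c ^ 2 by apply: pow_incr; lra.
  have : ln c ^ 2 <= ln (INR N.+2) ^ 2 by apply: pow_incr; lra.
  by move: IH => /=; lra.
move=> H; apply: Rabs_le; have := pow2_ge_0 (ln (INR N)); lra.
Qed.

(* [b] and [c] (built from Euler's constant and the first Stieltjes constant) make
   [2 y ln y + b y + c] the smooth model of [lamS y], with an error whose Moebius
   inversion costs only [O(N)]. *)
Lemma model_error : exists b c K, 0 < K /\ forall z, 1 <= z ->
  Rabs (\rsum_(1 <= n < (nfloor z).+1) (ln (INR n) ^ 2) -
        \rsum_(1 <= e < (nfloor z).+1) (2 * (z / INR e) * ln (z / INR e) + b * (z / INR e) + c))
  <= K * sqrt z.
Proof.
have [g Hg] := euler_gamma; have [g1 Hg1] := stieltjes_gamma1.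
(* With [l = ln z], the model summed over [e <= z] is [z l^2 + (2 g + b) z l + (b g + c - 2 g1) z]
   up to small errors. Matching the coefficients [-2] and [2] of [ln2_prim z] determines [b] and
   [c]. *)
have [b Eb] : exists b, b = - 2 - 2 * g by eexists.
have [c Ec] : exists c, c = 2 + 2 * g1 - b * g by eexists.
exists b, c, (98 + 6 * Rabs b + Rabs c); split.
  by have := Rabs_pos b; have := Rabs_pos c; lra.
move=> z Hz; have [HM1 HM2] := @nfloor_spec z ltac:(lra); set M := nfloor z in HM1 HM2 *.
have HM : (0 < M)%N.
  by case E: M => [|//]; rewrite E INR0 in HM2; lra.
have HMr := INR_ge1 HM; set m := INR M in HM1 HM2 HMr *.
set s := sqrt z; have Hs : 1 <= s by rewrite -sqrt_1; apply: sqrt_le_1_alt.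
have Es : z = s * s by rewrite /s sqrt_sqrt //; lra.
set l := ln z; have Hl : 0 <= l by apply: ln_ge0.
have Hls : l <= 2 * s by apply: ln_le_2sqrt; lra.
have Hl2 : l ^ 2 <= 16 * s by apply: ln2_le_16sqrt; lra.
have Hlm : 0 <= ln m <= l by split; [apply: ln_ge0|apply: ln_mono]; lra.
have Hm2 : z <= 2 * m by lra.
have Him : / m <= 2 / z.
  apply: (Rmult_le_reg_r (m * z)); first by apply: Rmult_lt_0_compat; lra.
  rewrite (_ : / m * (m * z) = z); last by field; lra.
  by rewrite (_ : 2 / z * (m * z) = 2 * m); [lra|field; lra].
have Him0 : 0 < / m by apply: Rinv_0_lt_compat; lra.
have Hdl : l - ln m <= / m.
  rewrite /l -lnV; try lra.
  apply: Rle_trans (ln_le_sub1 _) _; first by apply: Rdiv_lt_0_compat; lra.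
  rewrite (_ : z / m - 1 = (z - m) * / m); last by field; lra.
  by rewrite -{2}(Rmult_1_l (/ m)); apply: Rmult_le_compat_r; lra.
pose e1 := \rsum_(1 <= i < M.+1) / INR i - (l + g).
pose e2 := \rsum_(1 <= i < M.+1) (ln (INR i) / INR i) - (l ^ 2 / 2 + g1).
have He1 : Rabs e1 <= 6 / z.
  have := Hg M HM; rewrite -/m.
  have -> : e1 = (\rsum_(1 <= i < M.+1) / INR i - (ln m + g)) - (l - ln m) by rewrite /e1; ring.
  have := Rabs_triang (\rsum_(1 <= i < M.+1) / INR i - (ln m + g)) (- (l - ln m)).
  rewrite Rabs_Ropp (Rabs_pos_eq (l - _)); last lra.
  by rewrite /Rdiv /Rminus in Him *; lra.
have Hsm : / sqrt m <= 2 / s.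
  have Hsm0 : 1 <= sqrt m by rewrite -sqrt_1; apply: sqrt_le_1_alt.
  have : s <= 2 * sqrt m.
    rewrite -(sqrt_pow2 2) -?sqrt_mult; try lra.
    by apply: sqrt_le_1_alt; lra.
  move=> H; apply: (Rmult_le_reg_r (s * sqrt m)); first by apply: Rmult_lt_0_compat; lra.
  rewrite (_ : / sqrt m * (s * sqrt m) = s); last by field; lra.
  by rewrite (_ : 2 / s * (s * sqrt m) = 2 * sqrt m); [lra|field; lra].
have He2 : Rabs e2 <= 16 / s + 4 / s.
  have := Hg1 M HM; rewrite -/m.
  have -> : e2 = (\rsum_(1 <= i < M.+1) (ln (INR i) / INR i) - (ln m ^ 2 / 2 + g1)) - (l ^ 2 / 2 - ln m ^ 2 / 2).
    by rewrite /e2; ring.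
  have := Rabs_triang (\rsum_(1 <= i < M.+1) (ln (INR i) / INR i) - (ln m ^ 2 / 2 + g1)) (- (l ^ 2 / 2 - ln m ^ 2 / 2)).
  have H0 : 0 <= l ^ 2 / 2 - ln m ^ 2 / 2 <= 4 / s.
    have -> : l ^ 2 / 2 - ln m ^ 2 / 2 = (l - ln m) * ((l + ln m) / 2) by field.
    split; first by apply: Rmult_le_pos; lra.
    apply: Rle_trans (_ : (2 / z) * (2 * s) <= _); first by apply: Rmult_le_compat; lra.
    by rewrite Es; right; field; lra.
  rewrite Rabs_Ropp (Rabs_pos_eq (l ^ 2 / 2 - _)); last lra.
  by rewrite /Rdiv /Rminus in Hsm H0 *; lra.
have -> : \rsum_(1 <= e < M.+1) (2 * (z / INR e) * ln (z / INR e) + b * (z / INR e) + c) =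
   ln2_prim z + (2 * z * l * e1 - 2 * z * e2 + b * z * e1 + c * (m - z)).
  have -> : \rsum_(1 <= e < M.+1) (2 * (z / INR e) * ln (z / INR e) + b * (z / INR e) + c) =
     \rsum_(1 <= e < M.+1) ((2 * z * l + b * z) * / INR e + (- 2 * z) * (ln (INR e) / INR e) + c).
    apply: eq_big_nat => e /andP[He _]; have He' := INR_lt0 He.
    by rewrite lnV; try lra; rewrite -/l; field; lra.
  rewrite !rsumD -!rsum_mull rsum_const subn1 /= -/m.
  have -> : \rsum_(1 <= i < M.+1) / INR i = e1 + (l + g) by rewrite /e1; ring.
  have -> : \rsum_(1 <= i < M.+1) (ln (INR i) / INR i) = e2 + (l ^ 2 / 2 + g1) by rewrite /e2; ring.
  by rewrite /ln2_prim -/l Ec Eb; field.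
have [cc [Hcc Hcc2]] := @ln2_prim_mvt m z ltac:(lra) HM1.
have A1 : 0 <= ln2_prim z - ln2_prim m <= l ^ 2.
  rewrite Hcc2; have : 0 <= ln cc <= l by split; [apply: ln_ge0|apply: ln_mono]; lra.
  move=> Hc; have := pow2_ge_0 (ln cc).
  have : ln cc ^ 2 <= l ^ 2 by apply: pow_incr; lra.
  by move=> *; nra.
have A2 := sum_ln2 HM; rewrite -/m in A2.
have A3 : ln m ^ 2 <= l ^ 2 by apply: pow_incr; lra.
have B1 : Rabs (2 * z * l * e1) <= 12 * l.
  rewrite Rabs_mult (Rabs_pos_eq (2 * z * l)); last by apply: Rmult_le_pos; lra.
  apply: Rle_trans (Rmult_le_compat_l (2 * z * l) _ _ _ He1) _; first by apply: Rmult_le_pos; lra.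
  by right; field; lra.
have B2 : Rabs (2 * z * e2) <= 40 * s.
  rewrite Rabs_mult (Rabs_pos_eq (2 * z)); last by lra.
  apply: Rle_trans (Rmult_le_compat_l (2 * z) _ _ _ He2) _; first by lra.
  by rewrite Es; right; field; lra.
have B3 : Rabs (b * z * e1) <= 6 * Rabs b.
  rewrite !Rabs_mult (Rabs_pos_eq z); last by lra.
  apply: Rle_trans (Rmult_le_compat_l (Rabs b * z) _ _ _ He1) _.
    by apply: Rmult_le_pos; [exact: Rabs_pos|lra].
  by right; field; lra.
have B4 : Rabs (c * (m - z)) <= Rabs c.
  rewrite Rabs_mult -{2}(Rmult_1_r (Rabs c)); apply: Rmult_le_compat_l; first exact: Rabs_pos.
  by apply: Rabs_le; lra.
have Pb := Rabs_pos b; have Pc := Rabs_pos c.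
have Fb : Rabs b <= Rabs b * s by nra.
have Fc : Rabs c <= Rabs c * s by nra.
apply: Rabs_le; split;
  move: (proj1 (Rabs_le_between _ _) A2) (proj1 (Rabs_le_between _ _) B1) (proj1 (Rabs_le_between _ _) B2) (proj1 (Rabs_le_between _ _) B3) (proj1 (Rabs_le_between _ _) B4); lra.
Qed.

Lemma nfloor_div N d : (0 < d)%N -> nfloor (INR N / INR d) = (N %/ d)%N.
Proof.
move=> Hd; have Hd' := INR_lt0 Hd; apply: nfloor_unique.
have E : INR N = INR (N %/ d) * INR d + INR (N %% d).
  by rewrite -INRM -INRD -divn_eq.
have A : INR (N %% d) + 1 <= INR d by rewrite -S_INR; apply: INR_leq; rewrite ltn_pmod.
have B := pos_INR (N %% d).
have -> : INR N / INR d = INR (N %/ d) + INR (N %% d) * / INR d by rewrite E; field; lra.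
have Hi := Rinv_0_lt_compat _ Hd'.
split; first by nra.
apply: Rplus_lt_compat_l; apply: (Rmult_lt_reg_r (INR d)) => //.
by rewrite Rmult_assoc Rinv_l; lra.
Qed.

Lemma sum_inv_sqrt N : \rsum_(1 <= d < N.+1) / sqrt (INR d) <= 2 * sqrt (INR N).
Proof.
elim: N => [|N IH]; first by rewrite big_geq // INR0 sqrt_0; lra.
rewrite big_nat_recr //=.
have HN := pos_INR N; have HS := S_INR N.
set r := sqrt (INR N) in IH; set r' := sqrt (INR N.+1).
have Er : INR N = r * r by rewrite /r sqrt_sqrt.
have Er' : INR N.+1 = r' * r' by rewrite /r' sqrt_sqrt //; lra.
have Hr : 0 <= r by apply: sqrt_pos.
have Hr' : r < r' by apply: sqrt_lt_1_alt; lra.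
suff : / r' <= 2 * (r' - r) by lra.
apply: (Rmult_le_reg_r r'); first lra.
rewrite Rinv_l; last lra.
nra.
Qed.

Definition lamS N : R := \rsum_(1 <= d < N.+1) lam d.

Lemma sum_lamS N : \rsum_(1 <= e < N.+1) lamS (N %/ e) = \rsum_(1 <= n < N.+1) (ln (INR n) ^ 2).
Proof.
rewrite /lamS (@big_hyperbola _ _ _ N (fun e d => lam d)).
rewrite -(@big_divisors _ _ _ N (fun d e => lam d)).
by apply: eq_big_nat => n /andP[Hn _]; exact: lam_sum.
Qed.

(** Let [U k] be [lamS (N %/ k)] minus its model at [N / k]. By [model_error] the sums of [U (d e)]
    over [e] are [O(sqrt (N / d))], and Moebius inversion recovers [U 1] from them. The trivial
    bound [|mobius d| <= 1] suffices, since the sum of [sqrt (N / d)] is [O(N)]. *)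
Lemma lamS_asymp : exists K, 0 < K /\ forall N, (0 < N)%N ->
  Rabs (lamS N - 2 * INR N * ln (INR N)) <= K * INR N.
Proof.
have [b [c [K [HK HH]]]] := model_error.
exists (2 * K + Rabs b + Rabs c); split.
  by have := Rabs_pos b; have := Rabs_pos c; lra.
move=> N HN; have HNr := INR_ge1 HN.
pose B y := 2 * y * ln y + b * y + c.
pose U k := lamS (N %/ k) - B (INR N / INR k).
have E : U 1%N = \rsum_(1 <= d < N.+1) (mobius d * \rsum_(1 <= e < (N %/ d).+1) U (d * e)%N).
  transitivity (\rsum_(1 <= n < N.+1) \rsum_(1 <= d < n.+1 | d %| n) (mobius d * U n)).
    rewrite big_ltn // -rsum_mulr mobius_sum //= Rmult_1_l big1_seq ?Rplus_0_r // => n.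
    rewrite mem_index_iota => /andP[_ /andP[Hn _]].
    by rewrite -rsum_mulr mobius_sum; [case: eqP; [lia|move=> _; ring]|lia].
  under [RHS]eq_bigr => d _ do rewrite rsum_mull.
  rewrite -(@big_divisors _ _ _ N (fun d e => mobius d * U (d * e)%N)).
  apply: eq_bigr => n _; apply: eq_bigr => d Hd.
  by rewrite mulnC divnK.
have HU : Rabs (U 1%N) <= 2 * K * INR N.
  rewrite E; apply: Rle_trans (rsum_abs _ _ _) _.
  apply: Rle_trans (_ : \rsum_(1 <= d < N.+1) (K * sqrt (INR N) * / sqrt (INR d)) <= _); last first.
    rewrite -rsum_mull; have := sum_inv_sqrt N; have := sqrt_pos (INR N).
    rewrite -{4}(sqrt_sqrt (INR N)); last lra.
    move=> H1 H2; rewrite (_ : 2 * K * _ = K * sqrt (INR N) * (2 * sqrt (INR N))); last ring.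
    by apply: Rmult_le_compat_l => //; apply: Rmult_le_pos; lra.
  apply: rsum_le => d /andP[Hd HdN] _; have Hd' := INR_lt0 Hd.
  have Hdz : 1 <= INR N / INR d.
    apply: (Rmult_le_reg_r (INR d)) => //; rewrite /Rdiv Rmult_assoc Rinv_l; last lra.
    by rewrite Rmult_1_r Rmult_1_l; apply: INR_leq.
  rewrite Rabs_mult -[X in _ <= X]Rmult_1_l; apply: Rmult_le_compat; try exact: Rabs_pos.
    exact: mobius_bound.
  have := HH _ Hdz; rewrite nfloor_div // -sum_lamS -rsumB sqrt_div; try lra.
  rewrite /Rdiv Rmult_assoc; congr (Rabs _ <= _).
  apply: eq_big_nat => e /andP[He _]; have He' := INR_lt0 He.
  have Ed : INR N * / INR (d * e) = INR N * / INR d * / INR e by rewrite INRM Rinv_mult; ring.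
  by rewrite /U /B divnMA /Rdiv Ed; ring.
move: HU; rewrite /U /B divn1 INR1 Rdiv_1_r => HU.
have -> : lamS N - 2 * INR N * ln (INR N) =
  (lamS N - (2 * INR N * ln (INR N) + b * INR N + c)) + (b * INR N) + c by ring.
apply: Rle_trans (Rabs_triang _ _) _.
have := Rabs_triang (lamS N - (2 * INR N * ln (INR N) + b * INR N + c)) (b * INR N).
rewrite [Rabs (b * _)]Rabs_mult (Rabs_pos_eq (INR N)); last lra.
have := Rabs_pos c; nra.
Qed.

(** * From one large partial sum to a large logarithmic average *)

(** Convexity of [x ln x]: its graph lies above the tangent at [y]. *)
Lemma xlnx_tangent x y : 0 < x -> 0 < y -> y * ln y - x * ln x <= (y - x) * (1 + ln y).
Proof.
move=> Hx Hy; have H := ln_le_sub1 (Rdiv_lt_0_compat _ _ Hy Hx).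
rewrite lnV // in H.
have : x * (ln y - ln x) <= x * (y / x - 1) by apply: Rmult_le_compat_l; lra.
rewrite (_ : x * (y / x - 1) = y - x); last by field; lra.
lra.
Qed.

Lemma INR_div_ge1 N m : (0 < m <= N)%N -> 1 <= INR N / INR m.
Proof.
move=> /andP[Hm HmN]; have Hm' := INR_lt0 Hm; have := INR_leq HmN => H.
apply: (Rmult_le_reg_r (INR m)) => //; rewrite /Rdiv Rmult_assoc Rinv_l; lra.
Qed.

(** The floor moves the argument by less than 1, which changes [y ln y] by at most
    [1 + ln y <= y]. *)
Lemma lamS_div_asymp : exists K, 0 < K /\ forall N m, (0 < m <= N)%N ->
  Rabs (lamS (N %/ m) - 2 * (INR N / INR m) * ln (INR N / INR m)) <= K * (INR N / INR m).
Proof.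
have [K [HK H]] := lamS_asymp; exists (K + 2); split; first lra.
move=> N m HmN; have Hy := INR_div_ge1 HmN; case/andP: HmN => Hm HmN.
have HM : (0 < N %/ m)%N by rewrite divn_gt0.
have := @nfloor_spec (INR N / INR m) ltac:(lra); rewrite nfloor_div // => HF.
have HMr := INR_ge1 HM; have {}H := H _ HM.
move: HF HMr H; set M := INR (N %/ m); set y := INR N / INR m in Hy * => HF HMr H.
have T := @xlnx_tangent M y ltac:(lra) ltac:(lra).
have L1 := ln_le_sub1 (ltac:(lra) : 0 < y).
have L2 := ln_ge0 HMr; have L3 := ln_mono (ltac:(lra) : 0 < M) (ltac:(lra) : M <= y).
have T0 : 0 <= y * ln y - M * ln M by have := Rmult_le_compat M y (ln M) (ln y); lra.
have T1 : (y - M) * (1 + ln y) <= 1 * y by apply: Rmult_le_compat; lra.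
have T2 : K * M <= K * y by apply: Rmult_le_compat_l; lra.
apply: Rabs_le; move: (proj1 (Rabs_le_between _ _) H); lra.
Qed.

Lemma cmM g m n : completely_multiplicative g -> (0 < m)%N -> (0 < n)%N ->
  g (m * n)%N = (g m * g n)%C.
Proof. by move=> [_ H] Hm Hn; apply: H; apply/leP. Qed.

Lemma log2_convolution g N : completely_multiplicative g ->
  \csum_(1 <= n < N.+1) (RtoC (ln (INR n) ^ 2) * g n) =
  \csum_(1 <= d < N.+1) (RtoC (lam d) * g d * csum g (N %/ d)).
Proof.
move=> Hg.
under [RHS]eq_bigr => d _ do rewrite csumE csum_mull.
rewrite -(@big_divisors _ _ _ N (fun d e => RtoC (lam d) * g d * g e)%C).
apply: eq_big_nat => n /andP[Hn _]; rewrite -lam_sum // RtoC_rsum csum_mulr.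
rewrite [LHS]big_nat_cond [RHS]big_nat_cond.
apply: eq_bigr => d /andP[/andP[Hd _] Hdn].
by rewrite -{1}(divnK Hdn) mulnC cmM //; [ring|rewrite divn_gt0 // dvdn_leq].
Qed.

(** With [S] the summatory function, the logarithmic mean of [|S(m)| / m]: a sum of [|S(m)| / m]
    against the measure [1 / m]. *)
Definition mean_mass (f : nat -> C) (a b : nat) : R :=
  \rsum_(a.+1 <= m < b.+1) (Cmod (csum f m) * / INR m ^ 2).

Lemma abel_summation (s b : nat -> R) n : s 0%N = 0 ->
  \rsum_(1 <= m < n.+2) ((s m - s m.-1) * b m) =
  s n.+1 * b n.+1 + \rsum_(1 <= m < n.+1) (s m * (b m - b m.+1)).
Proof.
move=> Hs; elim: n => [|n IH]; first by rewrite big_nat1 big_geq //= Hs; ring.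
by rewrite big_nat_recr // IH [in RHS]big_nat_recr //=; ring.
Qed.

(* The differences [|S m| - |S (m-1)|] are bounded by 1, so replacing [lamS (N %/ m)]
   by its main term costs [sum O(N / m)], a factor [ln N] below the main term. *)
Lemma mean_lower_raw : exists K, 0 < K /\ forall f N eta,
  completely_multiplicative f -> (forall n, Cmod (f n) <= 1) -> (0 < N)%N ->
  eta * INR N <= Cmod (csum f N) ->
  eta * ln (INR N) ^ 2 <= 2 * (1 + ln (INR N)) * mean_mass f 0 N + K * (1 + ln (INR N)).
Proof.
have [K [HK H]] := lamS_div_asymp; exists (K + 2 + K); split; first lra.
move=> f N eta Hf Hf1 HN HS.
have HNr := INR_ge1 HN; have HL := ln_ge0 HNr; set L := ln (INR N) in HL *.
set s := fun m => Cmod (csum f m).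
have Hs0 : s 0%N = 0 by rewrite /s /= Cmod_0.
have Hds m : (0 < m)%N -> Rabs (s m - s m.-1) <= 1.
  case: m => // m _; rewrite /s /=; apply: Rabs_le.
  have := Cmod_triangle (csum f m) (f m.+1); have := Hf1 m.+1.
  have := Cmod_triangle (csum f m + f m.+1)%C (- f m.+1)%C.
  rewrite (_ : (_ + _ + - _)%C = csum f m); last ring.
  by rewrite Cmod_opp; lra.
(* Trading the constant [L ^ 2] for [ln n ^ 2] under the sum costs at most the sum of
   [2 L (L - ln n)], hence [2 L N]. *)
have A : s N * L ^ 2 <= \rsum_(1 <= d < N.+1) (lam d * s (N %/ d)%N) + 2 * L * INR N.
  have E : (csum f N * RtoC (L ^ 2))%C = (\csum_(1 <= n < N.+1) (RtoC (ln (INR n) ^ 2) * f n) +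
      \csum_(1 <= n < N.+1) (RtoC (L ^ 2 - ln (INR n) ^ 2) * f n))%C.
    rewrite -csumD csumE csum_mulr; apply: eq_bigr => n _.
    by rewrite RtoC_minus; ring.
  have : Cmod (csum f N * RtoC (L ^ 2)) = s N * L ^ 2.
    by rewrite Cmod_mult Cmod_R Rabs_pos_eq //; exact: pow2_ge_0.
  move=> <-; rewrite E; apply: Rle_trans (Cmod_triangle _ _) _.
  apply: Rplus_le_compat.
    rewrite log2_convolution //; apply: Rle_trans (Cmod_csum _ _ _) _.
    apply: rsum_le => d _ _; rewrite !Cmod_mult Cmod_R Rabs_pos_eq; last exact: lam_ge0.
    rewrite -/(s _) Rmult_assoc; apply: Rmult_le_compat_l; first exact: lam_ge0.
    by rewrite -{2}(Rmult_1_l (s _)); apply: Rmult_le_compat_r; [exact: Cmod_ge_0|].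
  apply: Rle_trans (Cmod_csum _ _ _) _.
  apply: Rle_trans (_ : \rsum_(1 <= n < N.+1) (2 * L * (L - ln (INR n))) <= _); last first.
    rewrite -rsum_mull; apply: Rmult_le_compat_l; first lra.
    exact: sum_ln_quot_le.
  apply: rsum_le => n /andP[Hn HnN] _.
  have Hl := ln_INR_ge0 Hn.
  have Hl2 : ln (INR n) <= L by apply: ln_mono; [exact: INR_lt0|exact: INR_leq].
  rewrite Cmod_mult Cmod_R Rabs_pos_eq; last by nra.
  apply: Rle_trans (_ : (L ^ 2 - ln (INR n) ^ 2) * 1 <= _).
    by apply: Rmult_le_compat_l => //; nra.
  nra.
pose b m := 2 * (INR N / INR m) * ln (INR N / INR m).
(* Writing [s (N %/ d)] as a telescoping sum and exchanging the order leaves [lam] only through its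
   summatory function. *)
have B : \rsum_(1 <= d < N.+1) (lam d * s (N %/ d)%N) =
   \rsum_(1 <= m < N.+1) ((s m - s m.-1) * lamS (N %/ m)).
  have T M : s M = \rsum_(1 <= m < M.+1) (s m - s m.-1).
    elim: M => [|M IH]; first by rewrite big_geq.
    by rewrite big_nat_recr //= -IH; ring.
  under eq_bigr => d _ do rewrite T rsum_mull.
  rewrite (@big_hyperbola _ _ _ N (fun d m => lam d * (s m - s m.-1))).
  by apply: eq_bigr => m _; rewrite /lamS rsum_mull; apply: eq_bigr => d _; ring.
have Cc : \rsum_(1 <= m < N.+1) ((s m - s m.-1) * lamS (N %/ m)) <=
   \rsum_(1 <= m < N.+1) ((s m - s m.-1) * b m) + K * INR N * (1 + L).
  apply: Rle_trans (_ : \rsum_(1 <= m < N.+1) ((s m - s m.-1) * b m + K * INR N * / INR m) <= _).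
    apply: rsum_le => m HmN _; case/andP: (HmN) => Hm _.
    have := H N m HmN; rewrite -/(b m) => HH.
    suff : (s m - s m.-1) * (lamS (N %/ m) - b m) <= K * (INR N / INR m) by rewrite /Rdiv; lra.
    apply: Rle_trans (Rle_abs _) _; rewrite Rabs_mult.
    rewrite -[X in _ <= X]Rmult_1_l; apply: Rmult_le_compat; try exact: Rabs_pos; by [|apply: Hds].
  rewrite rsumD -rsum_mull; apply: Rplus_le_compat_l.
  by apply: Rmult_le_compat_l; [apply: Rmult_le_pos; lra|exact: harmonic_le].
(* Summation by parts in the other direction: the boundary term vanishes as [b N] contains [ln 1],
   and by the tangent inequality [b m - b m.+1] is at most [2 (N / m^2) (1 + L)], which produces the
   weights of [mean_mass]. *)
have D : \rsum_(1 <= m < N.+1) ((s m - s m.-1) * b m) <= 2 * INR N * (1 + L) * mean_mass f 0 N.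
  rewrite /mean_mass rsum_mull.
  have [n En] : exists n, N = n.+1 by exists N.-1; lia.
  rewrite {1}En abel_summation // -En {1}/b Rdiv_diag ?ln_1; last lra.
  rewrite Rmult_0_r Rmult_0_r Rplus_0_l [X in _ <= X]big_nat_recr //=.
  rewrite -[X in X <= _]Rplus_0_r; apply: Rplus_le_compat.
    apply: rsum_le => m /andP[Hm Hmn] _.
    have Hm' := INR_ge1 Hm; have Hmr : INR m.+1 <= INR N by apply: INR_leq; lia.
    have HSm := S_INR m.
    have -> : 2 * INR N * (1 + L) * (Cmod (csum f m) * / (INR m * (INR m * 1))) =
       s m * (2 * (INR N / INR m ^ 2) * (1 + L)) by rewrite /s; field; lra.
    apply: Rmult_le_compat_l; first exact: Cmod_ge_0.
    have P1 : 0 < INR N / INR m by apply: Rdiv_lt_0_compat; lra.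
    have P2 : 0 < INR N / INR m.+1 by apply: Rdiv_lt_0_compat; lra.
    have T := xlnx_tangent P2 P1.
    have Hd : 0 <= INR N / INR m - INR N / INR m.+1 <= INR N / INR m ^ 2.
      have -> : INR N / INR m - INR N / INR m.+1 = INR N * / (INR m * INR m.+1).
        by rewrite HSm; field; lra.
      split; first by apply: Rmult_le_pos; [lra|left; apply: Rinv_0_lt_compat; nra].
      by apply: Rmult_le_compat_l; [lra|apply: Rinv_le_contravar; nra].
    have Hl : 0 <= 1 + ln (INR N / INR m) <= 1 + L.
      rewrite lnV; try lra; have := ln_ge0 Hm'.
      have : ln (INR m) <= L by apply: ln_mono; lra.
      by rewrite /L; lra.
    have T2 : (INR N / INR m - INR N / INR m.+1) * (1 + ln (INR N / INR m)) <=
      (INR N / INR m ^ 2) * (1 + L) by apply: Rmult_le_compat; lra.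
    rewrite /b; lra.
  apply: Rmult_le_pos; first by apply: Rmult_le_pos; lra.
  by apply: Rmult_le_pos; [exact: Cmod_ge_0|left; apply: Rinv_0_lt_compat; nra].
have F : eta * INR N * L ^ 2 <= 2 * INR N * (1 + L) * mean_mass f 0 N + K * INR N * (1 + L) + 2 * L * INR N.
  have : eta * INR N * L ^ 2 <= s N * L ^ 2 by apply: Rmult_le_compat_r; [exact: pow2_ge_0|].
  lra.
apply: (Rmult_le_reg_l (INR N)); first lra.
have : 0 <= INR N * K * (1 + L) by apply: Rmult_le_pos; [apply: Rmult_le_pos|]; lra.
have : 0 <= INR N * 1 by lra.
lra.
Qed.

Lemma mean_lower : exists K, 0 < K /\ forall f N eta,
  completely_multiplicative f -> (forall n, Cmod (f n) <= 1) -> (0 < N)%N -> eta <= 1 ->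
  eta * INR N <= Cmod (csum f N) -> K <= eta * ln (INR N) ->
  eta * ln (INR N) / 8 <= mean_mass f 0 N.
Proof.
have [K [HK H]] := mean_lower_raw; exists (4 * K + 1); split; first lra.
move=> f N eta Hf Hf1 HN He HS HL; have {}H := H f N eta Hf Hf1 HN HS.
have HL0 := ln_INR_ge0 HN; set L := ln (INR N) in HL HL0 H *.
have HL1 : 1 <= L by have : eta * L <= 1 * L by [apply: Rmult_le_compat_r|]; lra.
have HP : 0 <= mean_mass f 0 N.
  apply: rsum_ge0 => m _; apply: Rmult_le_pos; first exact: Cmod_ge_0.
  by rewrite -pow_inv; exact: pow2_ge_0.
apply: (Rmult_le_reg_l (8 * L)); first lra.
have : 2 * (1 + L) * mean_mass f 0 N <= 4 * L * mean_mass f 0 N.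
  by apply: Rmult_le_compat_r; lra.
have : K * (1 + L) <= 2 * K * L by nra.
have : (4 * K + 1) * L <= eta * L * L by apply: Rmult_le_compat_r; lra.
nra.
Qed.

Lemma exp_ge1 x : 0 <= x -> 1 <= exp x.
Proof. by move=> H; rewrite -exp_0; apply: exp_mono. Qed.

Lemma nfloor_exp_pos V : 0 <= V -> (0 < nfloor (exp V))%N.
Proof.
move=> HV; have H := exp_ge1 HV; have := @nfloor_spec (exp V) ltac:(lra).
by case: (nfloor _) => // ; rewrite INR0; lra.
Qed.

Lemma ln_nfloor_exp V : 0 <= V -> ln (INR (nfloor (exp V))) <= V.
Proof.
move=> HV; rewrite -{2}(ln_exp V); apply: ln_mono.
  by apply: INR_lt0; exact: nfloor_exp_pos.
by have := @nfloor_spec (exp V) ltac:(have := exp_pos V; lra); lra.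
Qed.

Lemma nfloor_mono x y : 0 <= x -> x <= y -> (nfloor x <= nfloor y)%N.
Proof.
move=> Hx Hxy; have := @nfloor_spec x Hx; have := @nfloor_spec y ltac:(lra).
move=> H1 H2; rewrite -ltnS; apply/ltP; apply: INR_lt; rewrite S_INR; lra.
Qed.

Lemma mean_mass_cat f a b : (a <= b)%N -> mean_mass f 0 b = mean_mass f 0 a + mean_mass f a b.
Proof. by move=> H; rewrite /mean_mass -big_cat_nat. Qed.

Lemma mean_mass_le f a b : (forall n, Cmod (f n) <= 1) ->
  mean_mass f a b <= \rsum_(a.+1 <= m < b.+1) / INR m.
Proof.
move=> Hf; apply: rsum_le => m /andP[Hm _] _.
have Hm' : 0 < INR m by apply: INR_lt0; lia.
have -> : / INR m = INR m * / INR m ^ 2 by field; lra.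
apply: Rmult_le_compat_r; last exact: csum_bound.
by rewrite -pow_inv; exact: pow2_ge_0.
Qed.

Lemma mean_mass_exp_le f V : (forall n, Cmod (f n) <= 1) -> 0 <= V ->
  mean_mass f 0 (nfloor (exp V)) <= 1 + V.
Proof.
move=> Hf HV; apply: Rle_trans (mean_mass_le _ _ Hf) _.
apply: Rle_trans (harmonic_le (nfloor_exp_pos HV)) _.
by have := ln_nfloor_exp HV; lra.
Qed.

Lemma exists_dyadic y : 0 < y <= 1 -> exists k, y / 2 <= (1 / 2) ^ k <= y.
Proof.
move=> Hy; have [k Hk] : exists k, (1 / 2) ^ k <= y.
  have [k Hk] := @pow_lt_1_zero (1 / 2) ltac:(rewrite Rabs_pos_eq; lra) y ltac:(lra).
  by exists k; have := Hk k ltac:(lia); have := Rle_abs ((1 / 2) ^ k); lra.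
elim: k Hk => [|k IH] Hk; first by exists 0%N => /=; rewrite /= in Hk; lra.
case: (Rle_dec ((1 / 2) ^ k) y) => H; first exact: IH.
by exists k.+1; rewrite /= in Hk *; lra.
Qed.

(* Otherwise the blocks [V = L / 2^j] would add up to at most a geometric series of
   ratio [sqrt (1/2)]. *)
Lemma dyadic_block f L eta : (forall n, Cmod (f n) <= 1) -> 0 < eta <= 1 ->
  32 < eta * L -> eta * L / 8 <= mean_mass f 0 (nfloor (exp L)) ->
  exists V, eta * L / 64 <= V <= L /\
    eta / 64 * sqrt (L * V) <= mean_mass f (nfloor (exp (V / 2))) (nfloor (exp V)).
Proof.
move=> Hf He HeL HM.
have HL : 32 < L by have : eta * L <= eta * L + (1 - eta) * L; nra.
(* Halving stops at [W k <= eta L / 32], where the trivial bound [1 + W k] is below [eta L / 16].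
   The blocks add at most another [eta L / 16], so the total misses [eta L / 8]. *)
have [k Hk] := @exists_dyadic (eta / 32) ltac:(lra).
set s := sqrt (1 / 2).
have Hs0 : 0 <= s by exact: sqrt_pos.
have Hs2 : s * s = 1 / 2 by apply: sqrt_sqrt; lra.
have Hs : s <= 3 / 4 by nra.
pose W j := L * (1 / 2) ^ j.
have HW0 j : 0 <= W j by apply: Rmult_le_pos; [lra|apply: pow_le; lra].
have HWsq j : sqrt (L * W j) = L * s ^ j.
  have -> : L * W j = (L * s ^ j) ^ 2.
    rewrite /W -Hs2 Rpow_mult_distr; ring.
  by apply: sqrt_pow2; apply: Rmult_le_pos; [lra|exact: pow_le].
have HWdec i j : (i <= j)%N -> W j <= W i.
  move=> Hij; apply: Rmult_le_compat_l; first lra.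
  rewrite -(subnKC Hij) pow_add -[X in _ <= X]Rmult_1_r.
  apply: Rmult_le_compat_l; first by apply: pow_le; lra.
  by have := @pow_incr (1 / 2) 1 (j - i) ltac:(lra); rewrite pow1; lra.
apply: NNPP => Hno.
have Hblock j : (j < k)%N ->
    mean_mass f (nfloor (exp (W j / 2))) (nfloor (exp (W j))) < eta / 64 * (L * s ^ j).
  move=> Hj; apply: Rnot_le_lt => Hle; apply: Hno; exists (W j).
  rewrite HWsq; split => //; split.
    apply: Rle_trans (_ : W k <= _); last by apply: HWdec; lia.
    have : L * (eta / 32 / 2) <= L * (1 / 2) ^ k by apply: Rmult_le_compat_l; lra.
    by rewrite /W; lra.
  by have := @HWdec 0%N j isT; rewrite {2}/W /= Rmult_1_r.
have Hind j : (j <= k)%N ->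
   mean_mass f 0 (nfloor (exp L)) <= mean_mass f 0 (nfloor (exp (W j))) + eta / 16 * L * (1 - s ^ j).
  elim: j => [|j IH] Hj; first by rewrite /W /= Rmult_1_r; lra.
  apply: Rle_trans (IH ltac:(lia)) _.
  have EW : W j.+1 = W j / 2 by rewrite /W /=; lra.
  rewrite EW (@mean_mass_cat f (nfloor (exp (W j / 2))) (nfloor (exp (W j)))); last first.
    by apply: nfloor_mono; [left; exact: exp_pos|apply: exp_mono; have := HW0 j; lra].
  have := Hblock j Hj => HB.
  have P : 0 <= s ^ j by exact: pow_le.
  (* Uses [1 - s >= 1 / 4]: a factor 4 turns the geometric term into a telescoping difference. *)
  have Q : eta / 64 * (L * s ^ j) <= eta / 16 * L * (s ^ j - s ^ j.+1).
    rewrite /=; have : 0 <= eta * L * s ^ j * (3 / 4 - s) by repeat apply: Rmult_le_pos; lra.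
    lra.
  lra.
have := Hind k (leqnn k); have := mean_mass_exp_le Hf (HW0 k).
have P : 0 <= eta * L * s ^ k by repeat apply: Rmult_le_pos; try lra; exact: pow_le.
have : W k <= L * (eta / 32) by apply: Rmult_le_compat_l; lra.
lra.
Qed.

(** * Dirichlet series and Euler products *)

(* Dirichlet series are taken at the real point [1 + a]; a shift by [i t] is moved into
   the coefficients (see [twist]). *)
Definition npow (a : R) (n : nat) : R := Rpower (INR n) (- (1 + a)).

Definition dser (g : nat -> C) (a : R) (X : nat) : C :=
  \csum_(1 <= n < X.+1) (g n * RtoC (npow a n)).

(* Meaningful only for convergent series: [real] sends infinite limits to 0. *)
Definition Dir (g : nat -> C) (a : R) : C :=
  (real (Lim_seq (fun X => Re (dser g a X))), real (Lim_seq (fun X => Im (dser g a X)))).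

Definition Cvg (s : nat -> C) (l : C) : Prop :=
  forall eps, 0 < eps -> exists N, forall n, (N <= n)%N -> Cmod (s n - l) < eps.

Lemma npow_gt0 a n : 0 < npow a n.
Proof. exact: exp_pos. Qed.

Lemma npow1 a : npow a 1 = 1.
Proof. by rewrite /npow /Rpower INR1 ln_1 Rmult_0_r exp_0. Qed.

Lemma npowM a m n : (0 < m)%N -> (0 < n)%N -> npow a (m * n) = npow a m * npow a n.
Proof. by move=> Hm Hn; rewrite /npow INRM Rpower_mult_distr //; apply: INR_lt0. Qed.

Lemma npowE a n : (0 < n)%N -> npow a n = Rpower (INR n) (- a) * / INR n.
Proof.
move=> Hn; rewrite /npow Ropp_plus_distr Rpower_plus Rmult_comm; congr (_ * _).
by rewrite Rpower_Ropp Rpower_1 //; exact: INR_lt0.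
Qed.

(** Discrete counterpart of the derivative [- a x^(- 1 - a)] of [x^(- a)]. *)
Lemma npow_step a n : 0 < a -> (0 < n)%N ->
  a * npow a n.+1 <= Rpower (INR n) (- a) - Rpower (INR n.+1) (- a) <= a * npow a n.
Proof.
move=> Ha Hn; have [H1 H2] := ln_step Hn; rewrite !npowE //.
set d := ln (INR n.+1) - ln (INR n) in H1 H2.
have P := exp_pos (- a * ln (INR n)); have P' := exp_pos (- a * ln (INR n.+1)).
have E : Rpower (INR n) (- a) = Rpower (INR n.+1) (- a) * exp (a * d).
  by rewrite /Rpower -exp_plus /d; congr exp; ring.
have E' : Rpower (INR n.+1) (- a) = Rpower (INR n) (- a) * exp (- (a * d)).
  by rewrite /Rpower -exp_plus /d; congr exp; ring.
have X1 := exp_ineq1_le (a * d); have X2 := exp_ineq1_le (- (a * d)).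
split.
- rewrite E; have : Rpower (INR n.+1) (- a) * (1 + a * / INR n.+1) <= Rpower (INR n.+1) (- a) * exp (a * d).
    apply: Rmult_le_compat_l; first exact: Rlt_le.
    by have : a * / INR n.+1 <= a * d by [apply: Rmult_le_compat_l; lra]; lra.
  lra.
- rewrite E'; have : Rpower (INR n) (- a) * (1 - a * / INR n) <= Rpower (INR n) (- a) * exp (- (a * d)).
    apply: Rmult_le_compat_l; first exact: Rlt_le.
    by have : a * d <= a * / INR n by [apply: Rmult_le_compat_l; lra]; lra.
  lra.
Qed.

Lemma npow_tail a Y X : 0 < a -> (0 < Y <= X)%N ->
  \rsum_(Y.+1 <= n < X.+1) npow a n <= / a * (Rpower (INR Y) (- a) - Rpower (INR X) (- a)).
Proof.
move=> Ha /andP[HY]; elim: X => [|X IH] HX; first lia.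
case: (ltnP X Y) => H.
  by rewrite (_ : Y = X.+1) ?big_geq //; [lra|lia].
rewrite big_nat_recr /=; last lia.
have [H1 _] := @npow_step a X Ha ltac:(lia); have Hi := Rinv_0_lt_compat _ Ha.
have : npow a X.+1 <= / a * (Rpower (INR X) (- a) - Rpower (INR X.+1) (- a)).
  by apply: (Rmult_le_reg_l a) => //; rewrite -Rmult_assoc Rinv_r; lra.
have := IH H; lra.
Qed.

Lemma Rpower_INR_small a eps : 0 < a -> 0 < eps -> exists N, (1 <= N)%N /\
  forall n, (N <= n)%N -> Rpower (INR n) (- a) < eps.
Proof.
move=> Ha He; have [N [HN1 HN]] := exists_INR_gt (exp (- ln eps / a)).
exists N; split => // n Hn; have Hn' : INR N <= INR n by apply: INR_leq.
have H : - ln eps / a < ln (INR n).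
  by rewrite -(ln_exp (- ln eps / a)); apply: ln_increasing; [exact: exp_pos|lra].
rewrite /Rpower -[X in _ < X](exp_ln eps) //; apply: exp_increasing.
have := Rmult_lt_compat_l a _ _ Ha H.
rewrite (_ : a * (- ln eps / a) = - ln eps); last by field; lra.
lra.
Qed.

Lemma dser_cauchy g a Y X : (forall n, Cmod (g n) <= 1) -> 0 < a -> (0 < Y <= X)%N ->
  Cmod (dser g a X - dser g a Y) <= / a * Rpower (INR Y) (- a).
Proof.
move=> Hg Ha HYX; case/andP: (HYX) => HY HX.
have -> : (dser g a X - dser g a Y)%C = \csum_(Y.+1 <= n < X.+1) (g n * RtoC (npow a n)).
  by rewrite /dser (@big_cat_nat _ _ _ Y.+1 1 X.+1) //=; ring.
apply: Rle_trans (Cmod_csum _ _ _) _.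
apply: Rle_trans (_ : \rsum_(Y.+1 <= n < X.+1) npow a n <= _).
  apply: rsum_le => n _ _; rewrite Cmod_mult Cmod_R Rabs_pos_eq; last by left; exact: npow_gt0.
  by rewrite -[X in _ <= X]Rmult_1_l; apply: Rmult_le_compat_r; [left; exact: npow_gt0|].
apply: Rle_trans (npow_tail Ha HYX) _.
apply: Rmult_le_compat_l; first by left; exact: Rinv_0_lt_compat.
by have := exp_pos (- a * ln (INR X)); rewrite /Rpower; lra.
Qed.

Lemma Cmod_le_abs z : Cmod z <= Rabs (Re z) + Rabs (Im z).
Proof.
have -> : z = (RtoC (Re z) + Ci * RtoC (Im z))%C.
  by case: z => x y; rewrite /RtoC /Ci /Cplus /Cmult /=; congr pair; ring.
apply: Rle_trans (Cmod_triangle _ _) _; rewrite Cmod_mult Cmod_Ci !Cmod_R Rmult_1_l.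
by rewrite /=; right; congr (Rabs _ + Rabs _); ring.
Qed.

Lemma Im_le_Cmod z : Rabs (Im z) <= Cmod z.
Proof. by apply: Rle_trans (Rmax_Cmod z); exact: Rmax_r. Qed.

Lemma Dir_tail g a Y : (forall n, Cmod (g n) <= 1) -> 0 < a -> (0 < Y)%N ->
  Cmod (dser g a Y - Dir g a) <= / a * Rpower (INR Y) (- a).
Proof.
move=> Hg Ha HY; set b := fun n => / a * Rpower (INR n) (- a).
have Hi := Rinv_0_lt_compat _ Ha.
have Hb eps : 0 < eps -> exists N, (1 <= N)%N /\ b N < eps.
  move=> He; have [N [H1 H2]] := @Rpower_INR_small a (a * eps) Ha ltac:(nra).
  exists N; split => //; have := Rmult_lt_compat_l _ _ _ Hi (H2 N (leqnn N)).
  by rewrite -Rmult_assoc Rinv_l /b; lra.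
have L (F : C -> R) : (forall z w, F (z - w)%C = F z - F w) -> (forall z, Rabs (F z) <= Cmod z) ->
   forall n, (0 < n)%N -> Rabs (F (dser g a n) - real (Lim_seq (fun X => F (dser g a X)))) <= b n.
  move=> HF1 HF2.
  have [l Hl] : exists l, forall n, (1 <= n)%N -> Rabs (F (dser g a n) - l) <= b n.
    apply: cauchy_tail => // n m Hnm; rewrite -HF1.
    by apply: Rle_trans (HF2 _) _; exact: dser_cauchy.
  have -> : Lim_seq (fun X => F (dser g a X)) = l; last exact: Hl.
  apply: is_lim_seq_unique; apply/is_lim_seq_spec => eps.
  have [N [H1 H2]] := @Rpower_INR_small a (a * eps) Ha ltac:(have := cond_pos eps; nra).
  exists N => n Hn; apply: Rle_lt_trans (Hl n ltac:(lia)) _.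
  have := Rmult_lt_compat_l _ _ _ Hi (H2 n ltac:(lia)).
  by rewrite -Rmult_assoc Rinv_l /b; lra.
have LR := L Re ltac:(by case=> ? ? [? ?]) re_le_Cmod.
have LI := L Im ltac:(by case=> ? ? [? ?]) Im_le_Cmod.
(* Limits of the real and imaginary parts bound the modulus only by [2 b]. That loss is taken at a
   far index [N], where it is negligible, and [dser_cauchy] covers the way from [Y] to there, so the
   constant 1 is kept. *)
apply: Rnot_lt_le => Hlt.
have [N [HN1 HN]] := Hb ((Cmod (dser g a Y - Dir g a) - b Y) / 4) ltac:(rewrite /b; lra).
set m := maxn Y N.
have A1 := @dser_cauchy g a Y m Hg Ha ltac:(lia).
have A2 := @dser_cauchy g a N m Hg Ha ltac:(lia).
have A3 : Cmod (dser g a N - Dir g a) <= 2 * b N.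
  apply: Rle_trans (Cmod_le_abs _) _; have L1 := LR N HN1; have L2 := LI N HN1.
  have -> : Re (dser g a N - Dir g a)%C = Re (dser g a N) - real (Lim_seq (fun X => Re (dser g a X))) by [].
  have -> : Im (dser g a N - Dir g a)%C = Im (dser g a N) - real (Lim_seq (fun X => Im (dser g a X))) by [].
  lra.
have : Cmod (dser g a Y - Dir g a) <= Cmod (dser g a Y - dser g a m) + Cmod (dser g a m - dser g a N) + Cmod (dser g a N - Dir g a).
  apply: Rle_trans (_ : _ <= Cmod (dser g a Y - dser g a m + (dser g a m - dser g a N)) + _) _; last first.
    by apply: Rplus_le_compat_r; exact: Cmod_triangle.
  by apply: Rle_trans (Cmod_triangle _ _); right; congr Cmod; ring.
rewrite -(Cmod_opp (dser g a Y - dser g a m)) (_ : (- (_ - _))%C = (dser g a m - dser g a Y)%C); last ring.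
rewrite -/(b Y) -/(b N) in A1 A2 Hlt; lra.
Qed.

Lemma Dir_cvg g a : (forall n, Cmod (g n) <= 1) -> 0 < a -> Cvg (dser g a) (Dir g a).
Proof.
move=> Hg Ha eps He; have Hi := Rinv_0_lt_compat _ Ha.
have [N [H1 H2]] := @Rpower_INR_small a (a * eps) Ha ltac:(nra).
exists N => n Hn; apply: Rle_lt_trans (@Dir_tail g a n Hg Ha ltac:(lia)) _.
by have := Rmult_lt_compat_l _ _ _ Hi (H2 n Hn); rewrite -Rmult_assoc Rinv_l; lra.
Qed.

Lemma Cvg_unique s l l' : Cvg s l -> Cvg s l' -> l = l'.
Proof.
move=> H H'; apply: NNPP => Hne.
have Hp : 0 < Cmod (l - l').
  by apply/Cmod_gt_0 => E; apply: Hne; rewrite -(Cplus_0_l l') -E; ring.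
have [N HN] := H (Cmod (l - l') / 2) ltac:(lra); have [N' HN'] := H' (Cmod (l - l') / 2) ltac:(lra).
have A := HN (maxn N N') ltac:(lia); have B := HN' (maxn N N') ltac:(lia).
have := Cmod_triangle (- (s (maxn N N') - l))%C (s (maxn N N') - l')%C.
rewrite Cmod_opp (_ : (- _ + _)%C = (l - l')%C); last ring.
lra.
Qed.

Lemma CvgB s l s' l' : Cvg s l -> Cvg s' l' -> Cvg (fun n => s n - s' n)%C (l - l')%C.
Proof.
move=> H H' eps He.
have [N HN] := H (eps / 2) ltac:(lra); have [N' HN'] := H' (eps / 2) ltac:(lra).
exists (maxn N N') => n Hn; have A := HN n ltac:(lia); have B := HN' n ltac:(lia).
have := Cmod_triangle (s n - l)%C (- (s' n - l'))%C.
by rewrite Cmod_opp (_ : (_ - _ + - _)%C = (s n - s' n - (l - l'))%C); [lra|ring].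
Qed.

Lemma CvgZ s l c : Cvg s l -> Cvg (fun n => c * s n)%C (c * l)%C.
Proof.
move=> H eps He; have Hc := Cmod_ge_0 c.
have [N HN] := H (eps / (Cmod c + 1)) ltac:(apply: Rdiv_lt_0_compat; lra).
exists N => n Hn; rewrite (_ : (_ - _)%C = (c * (s n - l))%C); last ring.
rewrite Cmod_mult; apply: Rle_lt_trans (_ : (Cmod c) * (eps / (Cmod c + 1)) < _).
  by apply: Rmult_le_compat_l => //; left; exact: HN.
have : 0 < eps / (Cmod c + 1) by apply: Rdiv_lt_0_compat; lra.
have : (Cmod c + 1) * (eps / (Cmod c + 1)) = eps by field; lra.
lra.
Qed.

Lemma Cvg_div s l q : (0 < q)%N -> Cvg s l -> Cvg (fun n => s (n %/ q)%N) l.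
Proof.
move=> Hq H eps He; have [N HN] := H eps He; exists (N * q)%N => n Hn.
by apply: HN; rewrite leq_divRL.
Qed.

Lemma Cvg_ext s s' l : (forall n, s n = s' n) -> Cvg s l -> Cvg s' l.
Proof. by move=> E H eps He; have [N HN] := H eps He; exists N => n Hn; rewrite -E; exact: HN. Qed.

Definition cst1 (n : nat) : C := RtoC 1.

Lemma Cmod_cst1 n : Cmod (cst1 n) <= 1.
Proof. by rewrite Cmod_1; lra. Qed.

Lemma Dir_upper g a : (forall n, Cmod (g n) <= 1) -> 0 < a -> Cmod (Dir g a) <= 1 + / a.
Proof.
move=> Hg Ha; have := @Dir_tail g a 1 Hg Ha isT.
rewrite /dser big_nat1 npow1 INR1 /Rpower ln_1 Rmult_0_r exp_0 Cmult_1_r => H.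
have := Cmod_triangle (g 1%N) (- (g 1%N - Dir g a))%C; rewrite Cmod_opp.
rewrite (_ : (_ + - _)%C = Dir g a); last ring.
by have := Hg 1%N; lra.
Qed.

Lemma zeta_lower a : 0 < a -> / a <= Cmod (Dir cst1 a).
Proof.
move=> Ha; have Hi := Rinv_0_lt_compat _ Ha; apply: Rnot_lt_le => Hlt.
have [N [HN1 HN]] := @Rpower_INR_small a (a * (/ a - Cmod (Dir cst1 a)) / 2) Ha
  ltac:(apply: Rdiv_lt_0_compat; [apply: Rmult_lt_0_compat|]; lra).
have A := @Dir_tail cst1 a N Cmod_cst1 Ha HN1.
have B X : (0 < X)%N -> / a * (1 - Rpower (INR X.+1) (- a)) <= \rsum_(1 <= n < X.+1) npow a n.
  elim: X => // X IH _; rewrite big_nat_recr //=.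
  have [_ S1] := @npow_step a X.+1 Ha isT.
  have S2 : / a * (Rpower (INR X.+1) (- a) - Rpower (INR X.+2) (- a)) <= npow a X.+1.
    by apply: (Rmult_le_reg_l a) => //; rewrite -Rmult_assoc Rinv_r; lra.
  case: X IH S1 S2 => [|X] IH S1 S2.
    move: S2; rewrite big_geq // INR1 {1}/Rpower ln_1 Rmult_0_r exp_0; lra.
  by have := IH isT; lra.
have E : Cmod (dser cst1 a N) = \rsum_(1 <= n < N.+1) npow a n.
  have -> : dser cst1 a N = RtoC (\rsum_(1 <= n < N.+1) npow a n).
    by rewrite RtoC_rsum; apply: eq_bigr => n _; rewrite Cmult_1_l.
  by rewrite Cmod_R Rabs_pos_eq //; apply: rsum_ge0 => n _; left; exact: npow_gt0.
have T := Cmod_triangle (dser cst1 a N - Dir cst1 a)%C (Dir cst1 a).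
rewrite (_ : (_ - _ + _)%C = dser cst1 a N) in T; last ring.
have H1 := HN N (leqnn N); have H2 := HN N.+1 (leqnSn N).
have := B N HN1; rewrite -E.
have M1 := Rmult_lt_compat_l _ _ _ Hi H1; have M2 := Rmult_lt_compat_l _ _ _ Hi H2.
rewrite (_ : / a * (a * (/ a - Cmod (Dir cst1 a)) / 2) = (/ a - Cmod (Dir cst1 a)) / 2) in M1 M2; last by field; lra.
lra.
Qed.

(* Sieving out one prime at a time yields the Euler product without unique factorization. *)
Definition rough P n : bool := all (fun r => (P < r)%N) (primes n).

Definition rpart (g : nat -> C) P n : C := if rough P n then g n else RtoC 0.

(** The reciprocal of the truncated Euler product, so that no factor has to be inverted. *)
Fixpoint eprod (g : nat -> C) (a : R) (P : nat) : C :=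
  match P with
  | 0%N => RtoC 1
  | k.+1 => ((if prime k.+1 then 1 - g k.+1 * RtoC (npow a k.+1) else 1) * eprod g a k)%C
  end.

Lemma rpart_bound g P n : (forall n, Cmod (g n) <= 1) -> Cmod (rpart g P n) <= 1.
Proof. by move=> H; rewrite /rpart; case: ifP => _ //; rewrite Cmod_0; lra. Qed.

Lemma rough_split P n : (0 < n)%N ->
  rough P n = rough P.+1 n || (prime P.+1 && (P.+1 %| n) && rough P n).
Proof.
move=> Hn; apply/idP/idP => [H|/orP[|/andP[]//]]; last first.
  by move=> /allP H; apply/allP => r Hr; have := H r Hr; lia.
rewrite H andbT; case E: (P.+1 \in primes n).
  by move: E; rewrite mem_primes Hn /= => ->; rewrite orbT.
apply/orP; left; apply/allP => r Hr; have := allP H r Hr.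
have [//|H1|E1] := ltngtP P.+1 r; [lia|by rewrite E1 Hr in E].
Qed.

Lemma rough_excl P n : (0 < n)%N -> prime P.+1 -> P.+1 %| n -> rough P.+1 n = false.
Proof.
move=> Hn Hp Hd; apply/negP => /allP /(_ P.+1).
by rewrite mem_primes Hp Hn Hd ltnn => /(_ isT).
Qed.

Lemma rough_mul P e : (0 < e)%N -> prime P.+1 -> rough P (P.+1 * e) = rough P e.
Proof.
move=> He Hp.
have E : primes (P.+1 * e) =i primes P.+1 ++ primes e.
  by move=> r; rewrite primesM // mem_cat.
by rewrite /rough (eq_all_r E) all_cat primes_prime //= ltnSn.
Qed.

(** The terms removed are those at [P.+1 * e] with [e] again free of primes up to [P]; complete
    multiplicativity takes the prime out of them. *)
Lemma rpart_sieve g a P X : completely_multiplicative g -> prime P.+1 ->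
  dser (rpart g P.+1) a X =
  (dser (rpart g P) a X - g P.+1 * RtoC (npow a P.+1) * dser (rpart g P) a (X %/ P.+1))%C.
Proof.
move=> Hg Hp; rewrite /dser csum_mull.
have -> : \csum_(1 <= e < (X %/ P.+1).+1) (g P.+1 * RtoC (npow a P.+1) * (rpart g P e * RtoC (npow a e))) =
   \csum_(1 <= n < X.+1 | P.+1 %| n) (rpart g P n * RtoC (npow a n)).
  rewrite big_multiples //; apply: eq_big_nat => e /andP[He _].
  rewrite /rpart rough_mul // npowM // RtoC_mult; case: ifP => _; last ring.
  by rewrite cmM //; ring.
rewrite [X in (_ - X)%C]big_mkcond -csumB; apply: eq_big_nat => n /andP[Hn _].
rewrite /rpart (rough_split P Hn) Hp /=.
case E: (P.+1 %| n) => /=; last by rewrite orbF; ring.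
by rewrite rough_excl //=; ring.
Qed.

Lemma Dir_rpart g a P : completely_multiplicative g -> (forall n, Cmod (g n) <= 1) -> 0 < a ->
  Dir (rpart g P) a = (eprod g a P * Dir g a)%C.
Proof.
move=> Hg Hg1 Ha; elim: P => [|P IH] /=.
  rewrite Cmult_1_l; apply: (@Cvg_unique (dser g a)); last exact: Dir_cvg.
  apply: (@Cvg_ext (dser (rpart g 0) a)); last by apply: Dir_cvg => // n; exact: rpart_bound.
  move=> X; apply: eq_bigr => n _; rewrite /rpart.
  have -> // : rough 0 n.
  by apply/allP => r; rewrite mem_primes => /andP[/prime_gt0].
have CV Q : Cvg (dser (rpart g Q) a) (Dir (rpart g Q) a).
  by apply: Dir_cvg => // n; exact: rpart_bound.
case: ifP => Hp; last first.
  rewrite Cmult_1_l -IH; apply: (@Cvg_unique (dser (rpart g P) a)); last exact: CV.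
  apply: Cvg_ext (CV P.+1) => X; apply: eq_big_nat => n /andP[Hn _].
  by rewrite /rpart (rough_split P Hn) Hp orbF.
rewrite -Cmult_assoc -IH.
apply: (@Cvg_unique (dser (rpart g P.+1) a)); first exact: CV.
apply: (@Cvg_ext (fun X => dser (rpart g P) a X - g P.+1 * RtoC (npow a P.+1) * dser (rpart g P) a (X %/ P.+1))%C).
  by move=> X; rewrite -rpart_sieve.
have -> : ((1 - g P.+1 * RtoC (npow a P.+1)) * Dir (rpart g P) a =
  Dir (rpart g P) a - g P.+1 * RtoC (npow a P.+1) * Dir (rpart g P) a)%C by ring.
apply: CvgB; first exact: CV.
by apply: CvgZ; apply: Cvg_div => //; exact: CV.
Qed.

(** Every integer from 2 to [P] has a prime factor at most [P], so the sieved series cut at [P] is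
    exactly 1 and only its tail remains. *)
Lemma Dir_rpart_near1 g a P : completely_multiplicative g -> (forall n, Cmod (g n) <= 1) -> 0 < a ->
  (0 < P)%N -> Cmod (1 - eprod g a P * Dir g a) <= / a * Rpower (INR P) (- a).
Proof.
move=> Hg Hg1 Ha HP; rewrite -Dir_rpart //.
have := @Dir_tail (rpart g P) a P (fun n => rpart_bound P n Hg1) Ha HP.
have -> // : dser (rpart g P) a P = RtoC 1.
rewrite /dser big_ltn // npow1 /rpart /= (proj1 Hg) big1_seq ?Cplus_0_r ?Cmult_1_r // => n.
rewrite mem_index_iota => /andP[_ /andP[Hn HnP]].
case: ifP => [/allP /(_ (pdiv n))|_]; last by rewrite Cmult_0_l.
have Hn0 : (0 < n)%N by lia.
rewrite mem_primes pdiv_prime // Hn0 pdiv_dvd => /(_ isT).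
by have := pdiv_leq Hn0; lia.
Qed.

(** Carries inequalities between finite Euler products over to [Dir]; moduli are all that is
    compared. *)
Lemma euler_limit g a : completely_multiplicative g -> (forall n, Cmod (g n) <= 1) -> 0 < a ->
  is_lim_seq (fun P => Cmod (eprod g a P) * Cmod (Dir g a)) 1.
Proof.
move=> Hg Hg1 Ha; apply/is_lim_seq_spec => eps; have Hi := Rinv_0_lt_compat _ Ha.
have He := cond_pos eps.
have [N [H1 H2]] := @Rpower_INR_small a (a * eps) Ha ltac:(nra).
exists N => n Hn; rewrite -Cmod_mult.
have A := @Dir_rpart_near1 g a n Hg Hg1 Ha ltac:(lia).
have B := Rmult_lt_compat_l _ _ _ Hi (H2 n ltac:(lia)).
rewrite -Rmult_assoc Rinv_l in B; last lra.
have T1 := Cmod_triangle (1 - eprod g a n * Dir g a)%C (eprod g a n * Dir g a)%C.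
have T2 := Cmod_triangle (eprod g a n * Dir g a)%C (1 - eprod g a n * Dir g a)%C.
have T3 := Cmod_triangle 1%C (- (1 - eprod g a n * Dir g a))%C.
rewrite Cmod_opp in T3.
rewrite (_ : (1 - _ + _)%C = 1%C) ?Cmod_1 in T1; last ring.
rewrite (_ : (1 + - _)%C = (eprod g a n * Dir g a)%C) ?Cmod_1 in T3; last ring.
by apply/Rabs_lt_between'; lra.
Qed.

(** Expansion of [(1 - r) + r (1 - z)]. For [|z| <= 1] all its terms are nonnegative, so Euler
    factors can be compared through [1 - Re z] and [|1 - z|^2]. *)
Lemma Cmod_1sub2 (z : C) r : Cmod (1 - z * RtoC r) ^ 2 =
  (1 - r) ^ 2 + 2 * (1 - r) * r * (1 - Re z) + r ^ 2 * ((1 - Re z) ^ 2 + Im z ^ 2).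
Proof. by rewrite Cmod2_alt; case: z => x y /=; ring. Qed.

Lemma Cmod_le1_sq (z : C) : Cmod z <= 1 -> Re z ^ 2 + Im z ^ 2 <= 1.
Proof.
move=> H; rewrite -Cmod2_alt; have := Cmod_ge_0 z => H0.
by have := pow_incr _ _ 2 (conj H0 H); rewrite pow1.
Qed.

(** With [D = (1 - r)^2] and squared factors [D + p], [D + q], the squared factor of [z w] is at
    most [D + 2 p + 2 q]. This doubling is why squares stand on the right; equality at [z = w = 1]
    then forces the exponent 3. What remains is [D^3 (D + 2 p + 2 q) <= (D + p)^2 (D + q)^2]. *)
Lemma euler_factor_product (z w : C) r : Cmod z <= 1 -> Cmod w <= 1 -> 0 < r < 1 ->
  (1 - r) ^ 3 * Cmod (1 - z * w * RtoC r) <=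
  Cmod (1 - z * RtoC r) ^ 2 * Cmod (1 - w * RtoC r) ^ 2.
Proof.
move=> Hz Hw Hr.
have G := Cmod_ge_0 (1 - z * w * RtoC r)%C.
set D := (1 - r) ^ 2.
have HD : 0 < D by apply: pow_lt; lra.
set A := Cmod (1 - z * RtoC r) ^ 2; set B := Cmod (1 - w * RtoC r) ^ 2.
have EA : A = D + (2 * (1 - r) * r * (1 - Re z) + r ^ 2 * ((1 - Re z) ^ 2 + Im z ^ 2)).
  by rewrite /A Cmod_1sub2 /D; ring.
have EB : B = D + (2 * (1 - r) * r * (1 - Re w) + r ^ 2 * ((1 - Re w) ^ 2 + Im w ^ 2)).
  by rewrite /B Cmod_1sub2 /D; ring.
have EG := Cmod_1sub2 (z * w)%C r.
have {}Hz := Cmod_le1_sq Hz; have {}Hw := Cmod_le1_sq Hw.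
set p := (2 * (1 - r) * r * (1 - Re z) + r ^ 2 * ((1 - Re z) ^ 2 + Im z ^ 2)) in EA.
set q := (2 * (1 - r) * r * (1 - Re w) + r ^ 2 * ((1 - Re w) ^ 2 + Im w ^ 2)) in EB.
have Hrr : 0 <= 2 * (1 - r) * r by nra.
have Hr2 : 0 <= r ^ 2 by nra.
(* With [S = x + x'], the constraints on [z] and [w] bound the left side by [2 - S^2 / 2], and
   [4 - 2 S] exceeds that by [(2 - S)^2 / 2]. *)
have K1 : 1 - Re (z * w)%C <= 2 * (1 - Re z) + 2 * (1 - Re w).
  rewrite /p /q; case: z w Hz Hw {EG A B EA EB G p q} => x y [x' y'] /= Hz Hw.
  have := pow2_ge_0 (y - y'); have := pow2_ge_0 (2 - x - x'); lra.
have K2 : (1 - Re (z * w)%C) ^ 2 + Im (z * w)%C ^ 2 <=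
   2 * ((1 - Re z) ^ 2 + Im z ^ 2) + 2 * ((1 - Re w) ^ 2 + Im w ^ 2).
  case: z w Hz Hw {EG A B EA EB G p q K1} => x y [x' y'] /= Hz Hw.
  (* [1 - zw = (1 - z) + z (1 - w)] *)
  pose s1 := x * (1 - x') + y * y'; pose s2 := y * (1 - x') - x * y'.
  have S : s1 ^ 2 + s2 ^ 2 <= (1 - x') ^ 2 + y' ^ 2.
    rewrite (_ : s1 ^ 2 + s2 ^ 2 = (x ^ 2 + y ^ 2) * ((1 - x') ^ 2 + y' ^ 2)); last by rewrite /s1 /s2; ring.
    have : 0 <= (1 - x') ^ 2 + y' ^ 2 by have := pow2_ge_0 (1 - x'); have := pow2_ge_0 y'; lra.
    nra.
  have := pow2_ge_0 (1 - x - s1); have := pow2_ge_0 (- y - s2).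
  rewrite /s1 /s2 in S *; lra.
have Hx : Re z <= 1 by nra.
have Hx' : Re w <= 1 by nra.
have Hp : 0 <= p.
  apply: Rplus_le_le_0_compat; apply: Rmult_le_pos => //; first lra.
  by have := pow2_ge_0 (1 - Re z); have := pow2_ge_0 (Im z); lra.
have Hq : 0 <= q.
  apply: Rplus_le_le_0_compat; apply: Rmult_le_pos => //; first lra.
  by have := pow2_ge_0 (1 - Re w); have := pow2_ge_0 (Im w); lra.
have Gle : Cmod (1 - z * w * RtoC r) ^ 2 <= D + 2 * p + 2 * q.
  rewrite EG -/D /p /q.
  have M1 := Rmult_le_compat_l _ _ _ Hrr K1; have M2 := Rmult_le_compat_l _ _ _ Hr2 K2.
  lra.
rewrite EA EB.
have HA : 0 <= (D + p) * (D + q) by apply: Rmult_le_pos; lra.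
apply: Rsqr_incr_0; first last.
- exact: HA.
- by apply: Rmult_le_pos => //; apply: pow_le; lra.
rewrite /Rsqr (_ : _ * _ = D ^ 3 * Cmod (1 - z * w * RtoC r) ^ 2); last by rewrite /D; ring.
apply: Rle_trans (Rmult_le_compat_l (D ^ 3) _ _ _ Gle) _; first by apply: pow_le; lra.
have P1 : 0 <= p * q by apply: Rmult_le_pos.
have D1 : 0 <= D ^ 2 by apply: pow_le; lra.
have D3 : 0 <= D ^ 3 by apply: pow_le; lra.
have U1 : D ^ 2 + 2 * D * p <= (D + p) ^ 2 by have := pow2_ge_0 p; lra.
have U2 : D ^ 2 + 2 * D * q <= (D + q) ^ 2 by have := pow2_ge_0 q; lra.
have U3 : (D ^ 2 + 2 * D * p) * (D ^ 2 + 2 * D * q) <= (D + p) ^ 2 * (D + q) ^ 2.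
  by apply: Rmult_le_compat => //; nra.
have : 0 <= D ^ 2 * (p * q) by apply: Rmult_le_pos.
have -> : (D + p) * (D + q) * ((D + p) * (D + q)) = (D + p) ^ 2 * (D + q) ^ 2 by ring.
lra.
Qed.

(** Divided by [(1 - r)^2], the expansion in [Cmod_1sub2] becomes a polynomial in [r / (1 - r)] with
    nonnegative coefficients, hence nondecreasing in [r]. *)
Lemma euler_factor_mono (z : C) r r' : Cmod z <= 1 -> 0 < r' -> r' <= r -> r < 1 ->
  (1 - r) * Cmod (1 - z * RtoC r') <= (1 - r') * Cmod (1 - z * RtoC r).
Proof.
move=> Hz Hr' Hrr Hr.
have G := Cmod_ge_0 (1 - z * RtoC r)%C; have G' := Cmod_ge_0 (1 - z * RtoC r')%C.
have {}Hz := Cmod_le1_sq Hz.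
have Hx : Re z <= 1 by nra.
have Hu := pow2_ge_0 (1 - Re z); have Hv := pow2_ge_0 (Im z).
apply: Rsqr_incr_0; try by apply: Rmult_le_pos => //; lra.
rewrite /Rsqr.
rewrite (_ : _ * _ = (1 - r) ^ 2 * Cmod (1 - z * RtoC r') ^ 2); last ring.
rewrite (_ : (1 - r') * _ * _ = (1 - r') ^ 2 * Cmod (1 - z * RtoC r) ^ 2); last ring.
rewrite !Cmod_1sub2.
set U := 1 - Re z; set W := (1 - Re z) ^ 2 + Im z ^ 2.
have HU : 0 <= U by rewrite /U; lra.
have HW : 0 <= W by rewrite /W; lra.
have A : (1 - r) * r' <= (1 - r') * r by lra.
have B : ((1 - r) * r') ^ 2 <= ((1 - r') * r) ^ 2 by apply: pow_incr; split => //; nra.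
have C1 : U * ((1 - r) * (1 - r') * ((1 - r) * r')) <= U * ((1 - r) * (1 - r') * ((1 - r') * r)).
  by apply: Rmult_le_compat_l => //; apply: Rmult_le_compat_l => //; nra.
have C2 := Rmult_le_compat_l _ _ _ HW B.
lra.
Qed.

(** * From Euler factors to Dirichlet series *)

Lemma npow_lt1 a n : 0 < a -> (1 < n)%N -> npow a n < 1.
Proof.
move=> Ha Hn; rewrite -exp_0 /npow /Rpower; apply: exp_increasing.
have : 0 < ln (INR n).
  rewrite -ln_1; apply: ln_increasing; first lra.
  by rewrite -INR1; apply: lt_INR; lia.
nra.
Qed.

Lemma npow_mono a a' n : a <= a' -> (0 < n)%N -> npow a' n <= npow a n.
Proof. by move=> Ha Hn; apply: exp_mono; have := ln_INR_ge0 Hn; nra. Qed.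

Lemma Cmod_eprod g a P : Cmod (eprod g a P.+1) =
  (if prime P.+1 then Cmod (1 - g P.+1 * RtoC (npow a P.+1)) else 1) * Cmod (eprod g a P).
Proof. by rewrite [eprod _ _ _]/= Cmod_mult; case: ifP => _ //; rewrite Cmod_1. Qed.

Lemma Cmod_eprod_cst1 a P : 0 < a -> Cmod (eprod cst1 a P.+1) =
  (if prime P.+1 then 1 - npow a P.+1 else 1) * Cmod (eprod cst1 a P).
Proof.
move=> Ha; rewrite Cmod_eprod; case: ifP => // Hp; congr (_ * _).
rewrite /cst1 Cmult_1_l -RtoC_minus Cmod_R Rabs_pos_eq //.
by have := npow_lt1 Ha (prime_gt1 Hp); lra.
Qed.

Lemma eprod_product g1 g2 a P : (forall n, Cmod (g1 n) <= 1) -> (forall n, Cmod (g2 n) <= 1) -> 0 < a ->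
  Cmod (eprod cst1 a P) ^ 3 * Cmod (eprod (fun n => g1 n * g2 n)%C a P) <=
  Cmod (eprod g1 a P) ^ 2 * Cmod (eprod g2 a P) ^ 2.
Proof.
move=> H1 H2 Ha; elim: P => [|P IH]; first by rewrite /= !Cmod_1; lra.
rewrite Cmod_eprod_cst1 // !Cmod_eprod; case: ifP => Hp; last by rewrite !Rmult_1_l.
have F := euler_factor_product (H1 P.+1) (H2 P.+1) (conj (npow_gt0 a P.+1) (npow_lt1 Ha (prime_gt1 Hp))).
rewrite !Rpow_mult_distr.
have Q1 : 0 < 1 - npow a P.+1 by have := npow_lt1 Ha (prime_gt1 Hp); lra.
have := Rmult_le_compat _ _ _ _ _ _ F IH.
have P1 : 0 <= (1 - npow a P.+1) ^ 3 * Cmod (1 - g1 P.+1 * g2 P.+1 * RtoC (npow a P.+1)).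
  by apply: Rmult_le_pos; [apply: pow_le; lra|exact: Cmod_ge_0].
have P2 : 0 <= Cmod (eprod cst1 a P) ^ 3 * Cmod (eprod (fun n => g1 n * g2 n)%C a P).
  by apply: Rmult_le_pos; [apply: pow_le|]; exact: Cmod_ge_0.
move=> /(_ P1 P2); lra.
Qed.

Lemma eprod_mono g a a' P : (forall n, Cmod (g n) <= 1) -> 0 < a -> a <= a' ->
  Cmod (eprod cst1 a P) * Cmod (eprod g a' P) <= Cmod (eprod cst1 a' P) * Cmod (eprod g a P).
Proof.
move=> Hg Ha Haa; elim: P => [|P IH]; first by rewrite /= !Cmod_1; lra.
rewrite !Cmod_eprod_cst1 ?(Cmod_eprod g) //; try lra.
case: ifP => Hp; last by rewrite !Rmult_1_l.
have Ha' : 0 < a' by lra.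
have L1 := npow_lt1 Ha (prime_gt1 Hp); have L2 := npow_mono Haa (prime_gt0 Hp).
have F := @euler_factor_mono (g P.+1) (npow a P.+1) (npow a' P.+1) (Hg _) (npow_gt0 _ _) L2 L1.
have := Rmult_le_compat _ _ _ _ _ _ F IH.
have P1 : 0 <= (1 - npow a P.+1) * Cmod (1 - g P.+1 * RtoC (npow a' P.+1)).
  by apply: Rmult_le_pos; [lra|exact: Cmod_ge_0].
have P2 : 0 <= Cmod (eprod cst1 a P) * Cmod (eprod g a' P) by apply: Rmult_le_pos; exact: Cmod_ge_0.
move=> /(_ P1 P2); lra.
Qed.

Lemma cst1_cm : completely_multiplicative cst1.
Proof. by split => // m n _ _; rewrite /cst1 Cmult_1_l. Qed.

Lemma prod_cm (g1 g2 : nat -> C) : completely_multiplicative g1 -> completely_multiplicative g2 ->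
  completely_multiplicative (fun n => g1 n * g2 n)%C.
Proof.
move=> [H1 H1'] [H2 H2']; split; first by rewrite H1 H2 Cmult_1_l.
by move=> m n Hm Hn; rewrite H1' // H2' //; ring.
Qed.

Lemma prod_bound (g1 g2 : nat -> C) n : (forall n, Cmod (g1 n) <= 1) -> (forall n, Cmod (g2 n) <= 1) ->
  Cmod (g1 n * g2 n) <= 1.
Proof.
move=> H1 H2; rewrite Cmod_mult -(Rmult_1_l 1).
by apply: Rmult_le_compat => //; exact: Cmod_ge_0.
Qed.

Lemma Dir_product g1 g2 a :
  completely_multiplicative g1 -> completely_multiplicative g2 ->
  (forall n, Cmod (g1 n) <= 1) -> (forall n, Cmod (g2 n) <= 1) -> 0 < a ->
  Cmod (Dir g1 a) ^ 2 * Cmod (Dir g2 a) ^ 2 <=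
  Cmod (Dir cst1 a) ^ 3 * Cmod (Dir (fun n => g1 n * g2 n)%C a).
Proof.
move=> C1 C2 B1 B2 Ha.
have L1 := euler_limit C1 B1 Ha; have L2 := euler_limit C2 B2 Ha.
have Lz := euler_limit cst1_cm Cmod_cst1 Ha.
have L12 := euler_limit (prod_cm C1 C2) (fun n => prod_bound n B1 B2) Ha.
set d1 := Cmod (Dir g1 a) in L1 *; set d2 := Cmod (Dir g2 a) in L2 *.
set z := Cmod (Dir cst1 a) in Lz *; set d12 := Cmod (Dir _ a) in L12 *.
have M1 := is_lim_seq_mult' _ _ _ _ (is_lim_seq_mult' _ _ _ _ L1 L1) (is_lim_seq_mult' _ _ _ _ L2 L2).
have M2 := is_lim_seq_mult' _ _ _ _ (is_lim_seq_mult' _ _ _ _ Lz (is_lim_seq_mult' _ _ _ _ Lz Lz)) L12.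
(* The inequality of Euler products is multiplied by [d1^2 d2^2 z^3 d12], so that each product meets
   its own series and tends to 1. No division by a possibly vanishing value occurs. *)
have N1 := is_lim_seq_scal_l _ (z ^ 3 * d12) _ M1.
have N2 := is_lim_seq_scal_l _ (d1 ^ 2 * d2 ^ 2) _ M2.
have := is_lim_seq_le _ _ _ _ _ N2 N1.
rewrite /= => K; suff : d1 ^ 2 * d2 ^ 2 * (1 * (1 * 1) * 1) <= z ^ 3 * d12 * (1 * 1 * (1 * 1)) by lra.
apply: K => P; have E := eprod_product P B1 B2 Ha.
have W : 0 <= d1 ^ 2 * d2 ^ 2 * z ^ 3 * d12.
  by rewrite /d1 /d2 /z /d12; apply: Rmult_le_pos; [apply: Rmult_le_pos; [apply: Rmult_le_pos; apply: pow_le|apply: pow_le]|]; exact: Cmod_ge_0.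
have := Rmult_le_compat_l _ _ _ W E; lra.
Qed.

Lemma Dir_mono g a a' : completely_multiplicative g -> (forall n, Cmod (g n) <= 1) ->
  0 < a -> a <= a' ->
  Cmod (Dir g a) * Cmod (Dir cst1 a') <= Cmod (Dir g a') * Cmod (Dir cst1 a).
Proof.
move=> C1 B1 Ha Haa; have Ha' : 0 < a' by lra.
have L1 := euler_limit C1 B1 Ha; have L1' := euler_limit C1 B1 Ha'.
have Lz := euler_limit cst1_cm Cmod_cst1 Ha; have Lz' := euler_limit cst1_cm Cmod_cst1 Ha'.
set d := Cmod (Dir g a) in L1 *; set d' := Cmod (Dir g a') in L1' *.
set z := Cmod (Dir cst1 a) in Lz *; set z' := Cmod (Dir cst1 a') in Lz' *.
have N1 := is_lim_seq_scal_l _ (d' * z) _ (is_lim_seq_mult' _ _ _ _ Lz' L1).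
have N2 := is_lim_seq_scal_l _ (d * z') _ (is_lim_seq_mult' _ _ _ _ Lz L1').
have := is_lim_seq_le _ _ _ _ _ N2 N1.
rewrite /= => K; suff : d * z' * (1 * 1) <= d' * z * (1 * 1) by lra.
apply: K => P; have E := eprod_mono P B1 Ha Haa.
have W : 0 <= d * z' * d' * z.
  by rewrite /d /d' /z /z'; repeat apply: Rmult_le_pos; exact: Cmod_ge_0.
have := Rmult_le_compat_l _ _ _ W E; lra.
Qed.

(** * A Fejer kernel on a grid *)

Definition cis (x : R) : C := (cos x, sin x).

Lemma cisD x y : cis (x + y) = (cis x * cis y)%C.
Proof. by rewrite /cis /Cmult /= cos_plus sin_plus; congr pair; ring. Qed.

Lemma cis0 : cis 0 = RtoC 1.
Proof. by rewrite /cis cos_0 sin_0. Qed.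

Lemma Cmod_cis x : Cmod (cis x) = 1.
Proof.
rewrite /Cmod /cis /= (_ : _ + _ = 1) ?sqrt_1 //.
by have := sin2_cos2 x; rewrite /Rsqr; lra.
Qed.

Lemma conj_cis x : Cconj (cis x) = cis (- x).
Proof. by rewrite /cis /Cconj /= cos_neg sin_neg. Qed.

Lemma cis_2PI_INR n : cis (2 * PI * INR n) = RtoC 1.
Proof.
rewrite /cis (_ : 2 * PI * INR n = 0 + 2 * INR n * PI); last ring.
by rewrite cos_period sin_period cos_0 sin_0.
Qed.

Lemma cis_2PI_diff k l : cis (2 * PI * (INR k - INR l)) = RtoC 1.
Proof.
have -> : 2 * PI * (INR k - INR l) = 2 * PI * INR k + - (2 * PI * INR l) by ring.
by rewrite cisD -conj_cis !cis_2PI_INR Cmult_1_l /Cconj /= Ropp_0.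
Qed.

Lemma Cmod_1sub_cis y : Cmod (1 - cis y) = 2 * Rabs (sin (y / 2)).
Proof.
have -> : Cmod (1 - cis y) = sqrt ((2 * Rabs (sin (y / 2))) ^ 2).
  congr sqrt; rewrite /cis /=.
  have E : Rabs (sin (y / 2)) * Rabs (sin (y / 2)) = sin (y / 2) * sin (y / 2).
    by rewrite -Rabs_mult Rabs_pos_eq //; exact: Rle_0_sqr.
  have Ec : cos y = 1 - 2 * sin (y / 2) * sin (y / 2).
    by rewrite -cos_2a_sin; congr cos; field.
  have := sin2_cos2 y; rewrite /Rsqr => Hsc. nra.
by rewrite sqrt_pow2 //; have := Rabs_pos (sin (y / 2)); lra.
Qed.

Lemma geom_cis K y : ((\csum_(0 <= k < K) cis (INR k * y)) * (1 - cis y) = 1 - cis (INR K * y))%C.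
Proof.
elim: K => [|K IH]; first by rewrite big_geq // INR0 Rmult_0_l cis0; ring.
rewrite big_nat_recr //= Cmult_plus_distr_r IH S_INR Rmult_plus_distr_r Rmult_1_l cisD; ring.
Qed.

(** From [sin u >= u - u^3 / 6] and [1 - 2.2^2 / 6 > 0.19]. Half-arguments of the kernel reach
    [11 / 20 * PI], which is at most 2.2 by [PI <= 4]. *)
Lemma sin_lower u : 0 <= u -> u <= 2.2 -> 0.19 * u <= sin u.
Proof.
move=> H0 H1; have [H _] := pre_sin_bound u 0 H0 ltac:(lra).
apply: Rle_trans H; rewrite /sin_approx /sin_term /= /Rdiv.
rewrite INR1 (_ : INR 6 = 6); last by rewrite !S_INR INR0; ring.
have : u * u <= 2.2 * 2.2 by apply: Rmult_le_compat.
nra.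
Qed.

(* [K] times the Fejer kernel. *)
Definition ker (K : nat) (y : R) : R := Cmod (\csum_(0 <= k < K) cis (INR k * y)) ^ 2.

Lemma ker_ge0 K y : 0 <= ker K y.
Proof. exact: pow2_ge_0. Qed.

Lemma kerE K y : RtoC (ker K y) =
  \csum_(0 <= k < K) \csum_(0 <= l < K) cis ((INR k - INR l) * y).
Proof.
rewrite /ker Cmod2_conj conj_csum csum_mulr; apply: eq_bigr => k _.
rewrite csum_mull; apply: eq_bigr => l _.
by rewrite conj_cis -cisD; congr cis; ring.
Qed.

Lemma kerN K y : ker K (- y) = ker K y.
Proof.
rewrite /ker -(Cmod_conj (\csum_(0 <= k < K) cis (INR k * y))) conj_csum.
by congr (Cmod _ ^ 2); apply: eq_bigr => k _; rewrite conj_cis; congr cis; ring.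
Qed.

Lemma ker_le K y : ker K y <= INR K ^ 2.
Proof.
apply: pow_incr; split; first exact: Cmod_ge_0.
apply: Rle_trans (Cmod_csum _ _ _) _.
under eq_bigr => k _ do rewrite Cmod_cis.
by rewrite rsum_const subn0; lra.
Qed.

(** The geometric sum is at most [2 / |1 - cis y| <= 2 / (0.19 |y|)], and 111 exceeds
    [(2 / 0.19)^2]. *)
Lemma ker_decay K y : Rabs y <= 4.4 -> y ^ 2 * ker K y <= 111.
Proof.
move=> Hy; set S := \csum_(0 <= k < K) cis (INR k * y).
have A : Cmod S * Cmod (1 - cis y) <= 2.
  rewrite -Cmod_mult geom_cis; apply: Rle_trans (Cmod_triangle _ _) _.
  by rewrite Cmod_opp Cmod_1 Cmod_cis; lra.
have B : 0.19 * Rabs y <= Cmod (1 - cis y).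
  rewrite Cmod_1sub_cis.
  have -> : Rabs (sin (y / 2)) = Rabs (sin (Rabs y / 2)).
    case: (Rle_dec 0 y) => H; first by rewrite (Rabs_pos_eq y).
    rewrite (Rabs_left y); last lra.
    by rewrite (_ : - y / 2 = - (y / 2)) ?sin_neg ?Rabs_Ropp //; field.
  have := @sin_lower (Rabs y / 2) ltac:(have := Rabs_pos y; lra) ltac:(lra).
  by have := Rle_abs (sin (Rabs y / 2)); lra.
have HS := Cmod_ge_0 S; have HR := Rabs_pos y.
have Cc : Cmod S * (0.19 * Rabs y) <= 2 by apply: Rle_trans A; apply: Rmult_le_compat_l.
rewrite /ker -/S -(pow2_abs y).
have : (Cmod S * (0.19 * Rabs y)) ^ 2 <= 2 ^ 2 by apply: pow_incr; split => //; nra.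
nra.
Qed.

Lemma root_sum K k l : (k < K)%N -> (l < K)%N -> k <> l ->
  \csum_(0 <= j < K) cis (- ((INR k - INR l) * (2 * PI * INR j / INR K))) = RtoC 0.
Proof.
move=> Hk Hl Hkl; have HK : 0 < INR K by apply: INR_lt0; lia.
have Hpi := PI_RGT_0.
set y := - ((INR k - INR l) * (2 * PI / INR K)).
have -> : \csum_(0 <= j < K) cis (- ((INR k - INR l) * (2 * PI * INR j / INR K))) =
          \csum_(0 <= j < K) cis (INR j * y).
  by apply: eq_bigr => j _; congr cis; rewrite /y; field; lra.
have G := geom_cis K y.
rewrite (_ : INR K * y = 2 * PI * (INR l - INR k)) in G; last by rewrite /y; field; lra.
rewrite cis_2PI_diff (_ : (1 - 1)%C = RtoC 0) in G; last ring.
have N : Cmod (1 - cis y) <> 0.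
  rewrite Cmod_1sub_cis; suff : sin (y / 2) <> 0 by move=> /Rabs_no_R0; lra.
  have Hk' : INR k < INR K by apply: lt_INR; lia.
  have Hl' : INR l < INR K by apply: lt_INR; lia.
  have P1 := pos_INR k; have P2 := pos_INR l.
  have Hne : INR k <> INR l by move/INR_eq.
  have Q (d : R) : 0 < d -> d < INR K -> 0 < sin (d * PI / INR K).
    move=> Hd1 Hd2; apply: sin_gt_0.
      by apply: Rdiv_lt_0_compat => //; apply: Rmult_lt_0_compat.
    apply: (Rmult_lt_reg_r (INR K)) => //.
    by rewrite /Rdiv Rmult_assoc Rinv_l ?Rmult_1_r; [rewrite Rmult_comm; apply: Rmult_lt_compat_l|lra].
  case: (Rlt_dec (INR k) (INR l)) => H.
    rewrite (_ : y / 2 = (INR l - INR k) * PI / INR K); last by rewrite /y; field; lra.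
    by have := Q (INR l - INR k) ltac:(lra) ltac:(lra); lra.
  rewrite (_ : y / 2 = - ((INR k - INR l) * PI / INR K)); last by rewrite /y; field; lra.
  by rewrite sin_neg; have := Q (INR k - INR l) ltac:(lra) ltac:(lra); lra.
apply: Cmod_eq_0; apply: (Rmult_eq_reg_r (Cmod (1 - cis y))) => //.
by rewrite -Cmod_mult G Cmod_0; ring.
Qed.

(** Summing over shifts by [2 PI / K] kills every term of [kerE] with [k <> l]; the [K] diagonal
    ones give [K] each. On the grid the kernel is thus an exact partition of unity. *)
Lemma ker_grid K y : (0 < K)%N ->
  \rsum_(0 <= j < K) ker K (y - 2 * PI * INR j / INR K) = INR K ^ 2.
Proof.
move=> HK; apply: RtoC_inj; rewrite RtoC_rsum.
transitivity (\csum_(0 <= k < K) \csum_(0 <= l < K) (cis ((INR k - INR l) * y) *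
   \csum_(0 <= j < K) cis (- ((INR k - INR l) * (2 * PI * INR j / INR K))))).
  under eq_bigr => j _ do rewrite kerE.
  rewrite exchange_big_nat; apply: eq_bigr => k _.
  rewrite exchange_big_nat; apply: eq_bigr => l _.
  rewrite csum_mull; apply: eq_bigr => j _.
  by rewrite -cisD; congr cis; ring.
transitivity (\csum_(0 <= k < K) RtoC (INR K)).
  apply: eq_big_nat => k Hk.
  rewrite (@bigD1_seq _ _ _ _ _ k) ?iota_uniq ?mem_index_iota //=.
  rewrite [X in (_ + X)%C]big1_seq ?Cplus_0_r => [|l /andP[Hl1]]; last first.
    rewrite mem_index_iota => Hl2.
    by rewrite root_sum ?Cmult_0_r // => E; rewrite E eqxx in Hl1.
  rewrite Rminus_diag.
  under eq_bigr => j _ do rewrite Rmult_0_l Ropp_0 cis0.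
  by rewrite Rmult_0_l cis0 -RtoC_rsum rsum_const subn0 Cmult_1_l Rmult_1_r.
by rewrite -RtoC_rsum rsum_const subn0; congr RtoC; ring.
Qed.

(** Sampling at [(k - l) tau] for all pairs visits each multiple of [tau] with its Fejer
    multiplicity, so the average over [t] becomes a nonnegative kernel in the differences of
    frequencies. *)
Lemma bilinear_ker K tau (al be : nat -> C) (x v : nat -> R) a b c d :
  \csum_(0 <= k < K) \csum_(0 <= l < K)
    ((\csum_(a <= n < b) (al n * cis (- ((INR k - INR l) * tau * x n)))) *
     (\csum_(c <= j < d) (be j * cis ((INR k - INR l) * tau * v j)))) =
  \csum_(a <= n < b) \csum_(c <= j < d) (al n * be j * RtoC (ker K (tau * (x n - v j)))).
Proof.
transitivity (\csum_(0 <= k < K) \csum_(0 <= l < K) \csum_(a <= n < b) \csum_(c <= j < d)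
   (al n * be j * cis ((INR k - INR l) * - (tau * (x n - v j))))).
  apply: eq_bigr => k _; apply: eq_bigr => l _.
  rewrite csum_mulr; apply: eq_bigr => n _; rewrite csum_mull; apply: eq_bigr => j _.
  have -> : cis ((INR k - INR l) * - (tau * (x n - v j))) =
    (cis (- ((INR k - INR l) * tau * x n)) * cis ((INR k - INR l) * tau * v j))%C.
    by rewrite -cisD; congr cis; ring.
  by ring.
under eq_bigr => k _ do rewrite exchange_big_nat.
rewrite exchange_big_nat; apply: eq_bigr => n _.
under eq_bigr => k _ do rewrite exchange_big_nat.
rewrite exchange_big_nat; apply: eq_bigr => j _.
rewrite -kerN kerE csum_mull; apply: eq_bigr => k _.
by rewrite csum_mull.
Qed.

(** Positivity of [ker] allows the coefficients to be replaced by their moduli. *)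
Lemma mean_square_ker K tau (al : nat -> C) (x : nat -> R) a b :
  \rsum_(0 <= k < K) \rsum_(0 <= l < K)
    (Cmod (\csum_(a <= n < b) (al n * cis (- ((INR k - INR l) * tau * x n)))) ^ 2) <=
  \rsum_(a <= n < b) \rsum_(a <= m < b) (Cmod (al n) * Cmod (al m) * ker K (tau * (x n - x m))).
Proof.
have E := bilinear_ker K tau al (fun m => Cconj (al m)) x x a b a b.
have : RtoC (\rsum_(0 <= k < K) \rsum_(0 <= l < K)
    (Cmod (\csum_(a <= n < b) (al n * cis (- ((INR k - INR l) * tau * x n)))) ^ 2)) =
  \csum_(a <= n < b) \csum_(a <= j < b) (al n * Cconj (al j) * RtoC (ker K (tau * (x n - x j)))).
  rewrite -E RtoC_rsum; apply: eq_bigr => k _; rewrite RtoC_rsum; apply: eq_bigr => l _.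
  rewrite Cmod2_conj; congr Cmult; rewrite conj_csum; apply: eq_bigr => n _.
  by rewrite Cmult_conj conj_cis Ropp_involutive.
move=> /(f_equal Cmod); rewrite Cmod_R => H.
apply: Rle_trans (Rle_abs _) _; rewrite H.
apply: Rle_trans (Cmod_csum _ _ _) _; apply: rsum_le => n _ _.
apply: Rle_trans (Cmod_csum _ _ _) _; apply: rsum_le => m _ _.
by rewrite !Cmod_mult Cmod_conj Cmod_R Rabs_pos_eq; [lra|exact: ker_ge0].
Qed.

(** * Dyadic decomposition and short sums of Selberg's weight *)

(** For [d > 0] this is the minimum of 1 and [(d / x)^2], the shape of the majorant of the kernel in
    [ker_cap]. *)
Definition invsq_cap (d x : R) : R := if rleb (Rabs x) d then 1 else (d / x) ^ 2.

Lemma invsq_cap_ge0 d x : 0 <= invsq_cap d x.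
Proof. by rewrite /invsq_cap; case: ifP => _; [lra|exact: pow2_ge_0]. Qed.

Lemma pow2_gt0 r : 0 < 2 ^ r.
Proof. by apply: pow_lt; lra. Qed.

(** On the shell [2^(r-1) d < |x| <= 2^r d] the left side is at most [4 * (1 / 4)^r], one term of
    the right side. *)
Lemma invsq_cap_dyadic d x N : 0 < d -> Rabs x <= 2 ^ N * d ->
  invsq_cap d x <= \rsum_(0 <= r < N.+1) (if rleb (Rabs x) (2 ^ r * d) then 4 * (1 / 4) ^ r else 0).
Proof.
move=> Hd; elim: N => [|N IH] Hx.
  rewrite big_nat1 /= Rmult_1_l in Hx *; rewrite /invsq_cap.
  by case: (rlebP (Rabs x) d) => //; lra.
rewrite big_nat_recr //=.
have Q : 0 < (1 / 4) ^ N by apply: pow_lt; lra.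
have T : 0 <= (if rleb (Rabs x) (2 * 2 ^ N * d) then 4 * (1 / 4 * (1 / 4) ^ N) else 0).
  by case: ifP => _; lra.
case: (Rle_dec (Rabs x) (2 ^ N * d)) => H; first by have := IH H; lra.
have -> : rleb (Rabs x) (2 * 2 ^ N * d) by apply/rlebP.
have S0 : 0 <= \rsum_(0 <= r < N.+1) (if rleb (Rabs x) (2 ^ r * d) then 4 * (1 / 4) ^ r else 0).
  by apply: rsum_ge0 => r _; case: ifP => _; [apply: Rmult_le_pos; [lra|apply: pow_le; lra]|lra].
suff : invsq_cap d x <= (1 / 4) ^ N by lra.
have P := pow2_gt0 N.
have Hd2 : d <= 2 ^ N * d.
  rewrite -{1}(Rmult_1_l d); apply: Rmult_le_compat_r; first lra.
  by apply: pow_R1_Rle; lra.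
rewrite /invsq_cap; case: (rlebP (Rabs x) d) => Hxd; first lra.
have Hx0 : 0 < Rabs x by lra.
rewrite -pow2_abs /Rdiv Rabs_mult Rabs_inv (Rabs_pos_eq d); last lra.
have -> : (1 * / 4) ^ N = (/ 2 ^ N) ^ 2.
  by rewrite -pow_inv -pow_mult Nat.mul_comm pow_mult; congr (_ ^ _); field.
apply: pow_incr; split.
  by apply: Rmult_le_pos; [lra|left; exact: Rinv_0_lt_compat].
apply: (Rmult_le_reg_r (Rabs x * 2 ^ N)); first exact: Rmult_lt_0_compat.
rewrite (_ : d * / Rabs x * (Rabs x * 2 ^ N) = 2 ^ N * d); last by field; lra.
by rewrite (_ : / 2 ^ N * (Rabs x * 2 ^ N) = Rabs x); [lra|field; lra].
Qed.

Lemma geom_sum_le q N : 0 <= q < 1 -> \rsum_(0 <= r < N) q ^ r <= / (1 - q).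
Proof.
move=> Hq; suff -> : \rsum_(0 <= r < N) q ^ r = (1 - q ^ N) / (1 - q).
  have P : 0 <= q ^ N by apply: pow_le; lra.
  rewrite -[X in _ <= X]Rmult_1_l; apply: Rmult_le_compat_r; last lra.
  by left; apply: Rinv_0_lt_compat; lra.
elim: N => [|N IH]; first by rewrite big_geq //=; field; lra.
by rewrite big_nat_recr //= IH; field; lra.
Qed.

Lemma exists_pow2_ge y : exists N, y <= 2 ^ N.
Proof.
have [N HN] := Pow_x_infinity 2 ltac:(rewrite Rabs_pos_eq; lra) y.
exists N; have := HN N (le_n _); rewrite Rabs_pos_eq; first lra.
by apply: pow_le; lra.
Qed.

(** The weights [4 * (1 / 4)^r] against window bounds [al * 2^r + be] give [8 al] and [16 / 3 * be].
    [B] makes the number of shells finite and does not enter the bound. *)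
Lemma dyadic_sum m n (c x : nat -> R) d al be B : 0 < d -> 0 <= al -> 0 <= be ->
  (forall j, 0 <= c j) -> (forall j, (m <= j < n)%N -> Rabs (x j) <= B) ->
  (forall r, 0 < r -> \rsum_(m <= j < n | rleb (Rabs (x j)) (r * d)) c j <= al * r + be) ->
  \rsum_(m <= j < n) (c j * invsq_cap d (x j)) <= 8 * al + 6 * be.
Proof.
move=> Hd Hal Hbe Hc HB H.
have [N HN] := exists_pow2_ge (B / d).
apply: Rle_trans (_ : \rsum_(m <= j < n) \rsum_(0 <= r < N.+1)
   (4 * (1 / 4) ^ r * (if rleb (Rabs (x j)) (2 ^ r * d) then c j else 0)) <= _).
  apply: rsum_le => j Hj _.
  have Hx : Rabs (x j) <= 2 ^ N * d.
    apply: Rle_trans (HB j Hj) _.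
    by rewrite (_ : B = B / d * d); [apply: Rmult_le_compat_r; lra|field; lra].
  have := Rmult_le_compat_l _ _ _ (Hc j) (invsq_cap_dyadic Hd Hx).
  rewrite rsum_mull => HH; apply: Rle_trans HH _; right; apply: eq_bigr => r _.
  by case: ifP => _; ring.
rewrite exchange_big_nat.
apply: Rle_trans (_ : \rsum_(0 <= r < N.+1) (4 * al * (1 / 2) ^ r + 4 * be * (1 / 4) ^ r) <= _).
  apply: rsum_le => r _ _; rewrite -rsum_mull -big_mkcond.
  have P : 0 < (1 / 4) ^ r by apply: pow_lt; lra.
  have := Rmult_le_compat_l (4 * (1 / 4) ^ r) _ _ ltac:(lra) (H (2 ^ r) (pow2_gt0 r)).
  have -> : (1 / 2) ^ r = (1 / 4) ^ r * 2 ^ r by rewrite -Rpow_mult_distr; congr (_ ^ _); field.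
  by move=> HH; apply: Rle_trans HH _; right; ring.
rewrite rsumD -!rsum_mull.
have G2 := @geom_sum_le (1 / 2) N.+1 ltac:(lra); have G4 := @geom_sum_le (1 / 4) N.+1 ltac:(lra).
have := Rmult_le_compat_l (4 * al) _ _ ltac:(lra) G2.
have := Rmult_le_compat_l (4 * be) _ _ ltac:(lra) G4.
rewrite (_ : / (1 - 1 / 2) = 2); last by field.
rewrite (_ : / (1 - 1 / 4) = 4 / 3); last by field.
lra.
Qed.

(* A strict ceiling, shifted by one: [A + 1] is the least integer [>= y]. *)
Lemma exists_ceil y : 0 < y -> exists A, INR A < y <= INR A.+1.
Proof.
move=> Hy; have [H1 H2] := @nfloor_spec y ltac:(lra).
case: (Rle_lt_or_eq_dec _ _ H1) => H.
  by exists (nfloor y); rewrite S_INR; lra.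
case E: (nfloor y) H => [|A] H; first by rewrite INR0 in H; lra.
by exists A; have := S_INR A; lra.
Qed.

Lemma gt_of_ceil A y m : INR A < y -> y <= INR m -> (A < m)%N.
Proof. by move=> H1 H2; apply/ltP; apply: INR_lt; lra. Qed.

Lemma count_grid K z r : 0 <= r ->
  \rsum_(0 <= j < K | rleb (Rabs (z - INR j)) r) 1 <= 2 * r + 1.
Proof.
move=> Hr.
case: (Rlt_dec (z + r) 0) => Hzr.
  rewrite big1_seq; first lra.
  move=> j /andP[/rlebP H _]; have := pos_INR j; move: H => /Rabs_le_between; lra.
have [F1 F2] := @nfloor_spec (z + r) ltac:(lra).
have HB j : Rabs (z - INR j) <= r -> (j < (nfloor (z + r)).+1)%N.
  move=> /Rabs_le_between H; apply/ltP; apply: INR_lt; rewrite S_INR; lra.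
case: (Rle_dec (z - r) 0) => Hz.
  apply: Rle_trans (_ : \rsum_(0 <= j < (nfloor (z + r)).+1) 1 <= _).
    apply: rsum_subrange => [j|j _ /rlebP /HB]; [lra|lia].
  by rewrite rsum_const subn0 S_INR; lra.
have [A [A1 A2]] := @exists_ceil (z - r) ltac:(lra).
apply: Rle_trans (_ : \rsum_(A.+1 <= j < (nfloor (z + r)).+1) 1 <= _).
  apply: rsum_subrange => [j|j _ /rlebP HH]; first lra.
  have := HB j HH; have := @gt_of_ceil A (z - r) j A1.
  by move: HH => /Rabs_le_between HH /(_ ltac:(lra)); lia.
rewrite rsum_const; case: (leqP A (nfloor (z + r))) => H.
  rewrite subSS (_ : INR (_ - _) = INR (nfloor (z + r)) - INR A); last first.
    by rewrite minus_INR //; lia.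
  rewrite S_INR in A2; lra.
by rewrite (_ : (_ - _ = 0)%N) ?INR0; [lra|lia].
Qed.

(** * Selberg's weight against powers and in short windows *)

Lemma lnS_asymp n : 0 <= 2 * INR n * ln (INR n) - \rsum_(1 <= k < n.+1) (2 * ln (INR k)) <= 2 * INR n.
Proof.
have E : \rsum_(1 <= k < n.+1) (2 * (ln (INR n) - ln (INR k))) =
   2 * INR n * ln (INR n) - \rsum_(1 <= k < n.+1) (2 * ln (INR k)).
  rewrite -!rsum_mull rsumB rsum_const subn1 /=; ring.
rewrite -E -rsum_mull; split; last by have := sum_ln_quot_le n; lra.
apply: Rmult_le_pos; first lra.
rewrite big_nat_cond; apply: rsum_ge0 => k /andP[/andP[Hk Hkn] _].
have : ln (INR k) <= ln (INR n) by apply: ln_mono; [exact: INR_lt0|apply: INR_leq; lia].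
lra.
Qed.

(* Abel summation against [lam]; the defect [lamS n - sum 2 ln - K n] has constant sign. *)
Lemma lam_abel : exists K, 0 < K /\ forall (g : nat -> R) a b,
  (forall n, 0 <= g n) -> (forall n, (0 < n)%N -> g n.+1 <= g n) -> (a < b)%N ->
  \rsum_(a.+1 <= n < b.+1) (lam n * g n) <=
  \rsum_(a.+1 <= n < b.+1) ((2 * ln (INR n) + K) * g n) + 2 * K * INR a * g a.+1.
Proof.
have [K0 [HK0 HL]] := lamS_asymp; exists (K0 + 2); split; first lra.
move=> g a b Hg0 Hg; set K := K0 + 2.
pose D n := lamS n - \rsum_(1 <= k < n.+1) (2 * ln (INR k)) - K * INR n.
have HD n : - (2 * K * INR n) <= D n <= 0.
  case: n => [|n]; first by rewrite /D /lamS !big_geq // INR0; lra.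
  have H1 := proj1 (Rabs_le_between _ _) (HL n.+1 isT); have H2 := lnS_asymp n.+1.
  by have := pos_INR n.+1; rewrite /D /K; split; nra.
have DS n : D n.+1 - D n = lam n.+1 - 2 * ln (INR n.+1) - K.
  by rewrite /D /lamS !(big_nat_recr n.+1) //= S_INR; ring.
suff : forall p, \rsum_(a.+1 <= n < (a + p).+2) ((lam n - 2 * ln (INR n) - K) * g n) <=
    D (a + p).+1 * g (a + p).+1 - D a * g a.+1.
  move=> H Hab; have := H (b - a.+1)%N; rewrite -addSn subnKC // => {}H.
  have -> : \rsum_(a.+1 <= n < b.+1) (lam n * g n) =
     \rsum_(a.+1 <= n < b.+1) ((lam n - 2 * ln (INR n) - K) * g n) +
     \rsum_(a.+1 <= n < b.+1) ((2 * ln (INR n) + K) * g n).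
    by rewrite -rsumD; apply: eq_bigr => n _; ring.
  have := HD b; have := HD a; have := Hg0 b; have := Hg0 a.+1; nra.
elim=> [|p IH]; first by rewrite addn0 big_nat1 -DS; lra.
rewrite addnS big_nat_recr /=; last lia.
rewrite -DS; have := HD (a + p).+1; have := Hg (a + p).+1 isT; nra.
Qed.

Lemma ln_Rpower_le x b : 1 <= x -> 0 < b -> ln x * Rpower x (- b) <= / b.
Proof.
move=> Hx Hb; rewrite /Rpower.
have H := exp_ineq1_le (b * ln x).
have E : exp (b * ln x) * exp (- b * ln x) = 1.
  by rewrite -exp_plus (_ : _ + _ = 0) ?exp_0 //; ring.
have P := exp_pos (- b * ln x); have L := ln_ge0 Hx.
apply: (Rmult_le_reg_l b) => //; rewrite Rinv_r; last lra.
have : (b * ln x) * exp (- b * ln x) <= exp (b * ln x) * exp (- b * ln x).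
  by apply: Rmult_le_compat_r; lra.
lra.
Qed.

Lemma npow_total V X : 0 < V -> \rsum_(1 <= n < X.+1) npow (/ V) n <= 1 + V.
Proof.
move=> HV; case: X => [|X]; first by rewrite big_geq //; lra.
rewrite big_ltn // npow1; have := @npow_tail (/ V) 1 X.+1 (Rinv_0_lt_compat _ HV) isT.
rewrite Rinv_inv INR1 {1}/Rpower ln_1 Rmult_0_r exp_0.
have := exp_pos (- / V * ln (INR X.+1)); rewrite -/(Rpower _ _); nra.
Qed.

Lemma npow_split a b n : (0 < n)%N -> npow (a + b) n = Rpower (INR n) (- a) * npow b n.
Proof. by move=> Hn; rewrite /npow -Rpower_plus; congr Rpower; ring. Qed.

(** Half of the exponent [1 / V] absorbs the logarithm, [ln n * n^(- 1 / (2 V)) <= 2 V]; the other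
    half still makes the sum converge. *)
Lemma ln_npow_total V X : 0 < V -> \rsum_(1 <= n < X.+1) (ln (INR n) * npow (/ V) n) <= 2 * V * (1 + 2 * V).
Proof.
move=> HV; apply: Rle_trans (_ : \rsum_(1 <= n < X.+1) (2 * V * npow (/ (2 * V)) n) <= _).
  apply: rsum_le => n /andP[Hn _] _.
  rewrite (_ : / V = / (2 * V) + / (2 * V)); last by field; lra.
  rewrite npow_split // -Rmult_assoc; apply: Rmult_le_compat_r; first by left; exact: npow_gt0.
  have := @ln_Rpower_le (INR n) (/ (2 * V)) (INR_ge1 Hn).
  by rewrite Rinv_inv; apply; apply: Rinv_0_lt_compat; lra.
rewrite -rsum_mull; apply: Rmult_le_compat_l; first lra.
by apply: npow_total; lra.
Qed.

Lemma ln2_npow_total V X : 1 <= V -> \rsum_(1 <= n < X.+1) (ln (INR n) ^ 2 * npow (/ V) n) <= 48 * V ^ 3.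
Proof.
move=> HV; apply: Rle_trans (_ : \rsum_(1 <= n < X.+1) (16 * V ^ 2 * npow (/ (2 * V)) n) <= _).
  apply: rsum_le => n /andP[Hn _] _.
  rewrite (_ : / V = / (4 * V) + (/ (4 * V) + / (2 * V))); last by field; lra.
  rewrite !npow_split //.
  set u := Rpower _ _.
  have H : 0 <= ln (INR n) * u <= 4 * V.
    split; first by apply: Rmult_le_pos; [exact: ln_INR_ge0|left; exact: exp_pos].
    have := @ln_Rpower_le (INR n) (/ (4 * V)) (INR_ge1 Hn).
    by rewrite Rinv_inv; apply; apply: Rinv_0_lt_compat; lra.
  rewrite (_ : _ * (_ * _) = (ln (INR n) * u) ^ 2 * npow (/ (2 * V)) n); last ring.
  apply: Rmult_le_compat_r; first by left; exact: npow_gt0.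
  by rewrite (_ : 16 * V ^ 2 = (4 * V) ^ 2); [apply: pow_incr|ring].
rewrite -rsum_mull.
have := Rmult_le_compat_l (16 * V ^ 2) _ _ ltac:(nra) (@npow_total (2 * V) X ltac:(lra)); nra.
Qed.

Lemma npow_dec V n : 0 < V -> (0 < n)%N -> npow (/ V) n.+1 <= npow (/ V) n.
Proof.
move=> HV Hn; have Hi := Rinv_0_lt_compat _ HV.
have [H _] := ln_step Hn; apply: exp_mono.
have : 0 < / INR n.+1 by apply/Rinv_0_lt_compat/INR_lt0.
nra.
Qed.

Lemma lam_total : exists K, 0 < K /\ forall V X, 1 <= V ->
  \rsum_(1 <= n < X.+1) (lam n * npow (/ V) n) <= K * V ^ 2.
Proof.
have [K [HK H]] := lam_abel; exists (12 + 2 * K); split; first lra.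
move=> V X HV; have HV0 : 0 < V by lra.
case: X => [|X]; first by rewrite big_geq //; nra.
have := H (npow (/ V)) 0%N X.+1 (fun n => Rlt_le _ _ (npow_gt0 _ n)) (fun n => npow_dec HV0) isT.
rewrite INR0 => HH.
have E : \rsum_(1 <= n < X.+2) ((2 * ln (INR n) + K) * npow (/ V) n) =
  2 * \rsum_(1 <= n < X.+2) (ln (INR n) * npow (/ V) n) + K * \rsum_(1 <= n < X.+2) npow (/ V) n.
  by rewrite !rsum_mull -rsumD; apply: eq_bigr => n _; ring.
rewrite E in HH; have T1 := ln_npow_total X.+1 HV0.
have T2 := Rmult_le_compat_l K _ _ ltac:(lra) (npow_total X.+1 HV0).
have VV : V <= V ^ 2 by nra.
have : K * (1 + V) <= K * (V ^ 2 + V ^ 2) by apply: Rmult_le_compat_l; lra.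
lra.
Qed.

(** An estimate of Brun-Titchmarsh type. The density [2 ln n] against [npow] is at most [2 V / n],
    so a window of logarithmic length [2 r] carries [O(r V)]; the error [O(x)] of Selberg's formula
    adds only [O(1)]. *)
Lemma lam_window : exists K, 0 < K /\ forall V v r X, 1 <= V -> 0 <= r ->
  \rsum_(1 <= n < X.+1 | rleb (Rabs (v - ln (INR n))) r) (lam n * npow (/ V) n) <= K * (r * V + 1).
Proof.
have [K [HK H]] := lam_abel; exists (4 + 3 * K); split; first lra.
move=> V v r X HV Hr; have HV0 : 0 < V by lra.
have HR : 0 <= r * V by nra.
have [A [A1 A2]] := exists_ceil (exp_pos (v - r)).
have [B1 B2] := @nfloor_spec (exp (v + r)) (Rlt_le _ _ (exp_pos _)); set B := nfloor _ in B1 B2.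
have g0 n : 0 <= npow (/ V) n by left; exact: npow_gt0.
apply: Rle_trans (_ : \rsum_(A.+1 <= n < B.+1) (lam n * npow (/ V) n) <= _).
  apply: rsum_subrange => [n|n /andP[Hn _] /rlebP /Rabs_le_between Hv].
    by apply: Rmult_le_pos => //; exact: lam_ge0.
  have Hn' := INR_lt0 Hn.
  have L1 : exp (v - r) <= INR n by rewrite -(exp_ln (INR n)) //; apply: exp_mono; lra.
  have L2 : INR n <= exp (v + r) by rewrite -(exp_ln (INR n)) //; apply: exp_mono; lra.
  rewrite (gt_of_ceil A1 L1) /=; apply/ltP; apply: INR_lt; rewrite S_INR; lra.
case: (leqP B A) => HAB; first by rewrite big_geq //; nra.
apply: Rle_trans (H (npow (/ V)) A B g0 (fun n => npow_dec HV0) HAB) _.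
have HA1 := @INR_ge1 A.+1 isT.
have npow_le n : (0 < n)%N -> npow (/ V) n <= / INR n.
  move=> Hn; rewrite npowE // -[X in _ <= X]Rmult_1_l; apply: Rmult_le_compat_r.
    by left; apply/Rinv_0_lt_compat/INR_lt0.
  rewrite -exp_0; apply: exp_mono; have := ln_INR_ge0 Hn; have := Rinv_0_lt_compat _ HV0; nra.
have Hfirst : INR A * npow (/ V) A.+1 <= 1.
  apply: Rle_trans (Rmult_le_compat_l _ _ _ (pos_INR A) (npow_le A.+1 isT)) _.
  apply: (Rmult_le_reg_r (INR A.+1)); first lra.
  by rewrite Rmult_assoc Rinv_l ?Rmult_1_l ?Rmult_1_r; [apply: INR_leq|lra].
(* The first integer is treated apart, because [harmonic_block] compares only the later ones with a
   logarithm. *)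
rewrite big_ltn //.
have T1 : (2 * ln (INR A.+1) + K) * npow (/ V) A.+1 <= 2 + K.
  have L := ln_ge0 HA1; have L2 := ln_le_sub1 (ltac:(lra) : 0 < INR A.+1).
  apply: Rle_trans (_ : (2 * ln (INR A.+1) + K) * / INR A.+1 <= _).
    by apply: Rmult_le_compat_l; [lra|exact: npow_le].
  apply: (Rmult_le_reg_r (INR A.+1)); first lra.
  rewrite Rmult_assoc Rinv_l; last lra.
  nra.
have T2 : \rsum_(A.+2 <= n < B.+1) ((2 * ln (INR n) + K) * npow (/ V) n) <= (2 * V + K) * (2 * r).
  apply: Rle_trans (_ : \rsum_(A.+2 <= n < B.+1) ((2 * V + K) * / INR n) <= _).
    apply: rsum_le => n /andP[Hn _] _; have Hn0 : (0 < n)%N by lia.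
    rewrite npowE // -Rmult_assoc; apply: Rmult_le_compat_r.
      by left; apply/Rinv_0_lt_compat/INR_lt0.
    have := @ln_Rpower_le (INR n) (/ V) (INR_ge1 Hn0) (Rinv_0_lt_compat _ HV0).
    rewrite Rinv_inv => P1.
    have P2 : Rpower (INR n) (- / V) <= 1.
      rewrite -exp_0; apply: exp_mono; have := ln_INR_ge0 Hn0; have := Rinv_0_lt_compat _ HV0; nra.
    nra.
  rewrite -rsum_mull; apply: Rmult_le_compat_l; first lra.
  apply: Rle_trans (_ : ln (INR B) - ln (INR A.+1) <= _).
    by apply: harmonic_block; lia.
  have HB0 : 0 < INR B by apply: INR_lt0; lia.
  have : ln (INR B) <= v + r by rewrite -(ln_exp (v + r)); apply: ln_mono.
  have : v - r <= ln (INR A.+1) by rewrite -(ln_exp (v - r)); apply: ln_mono => //; exact: exp_pos.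
  lra.
have : K * r <= K * (r * V) by apply: Rmult_le_compat_l; [lra|nra].
have : 2 * K * (INR A * npow (/ V) A.+1) <= 2 * K * 1 by apply: Rmult_le_compat_l; lra.
have : 0 <= K * (r * V) by apply: Rmult_le_pos; lra.
lra.
Qed.

(** * The test function *)

Lemma inv_sq_block A B : (0 < A <= B)%N ->
  \rsum_(A.+1 <= m < B.+1) / INR m ^ 2 <= / INR A - / INR B.
Proof.
move=> /andP[HA]; elim: B => [|B IH] HAB; first lia.
case: (ltnP B A) => H.
  by rewrite (_ : A = B.+1) ?big_geq //; [lra|lia].
rewrite rsum_recr; last lia.
have {}IH := IH H; have HB : 0 < INR B by apply: INR_lt0; lia.
have HS := S_INR B.
suff : / INR B.+1 ^ 2 <= / INR B - / INR B.+1 by lra.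
have -> : / INR B - / INR B.+1 = / (INR B * INR B.+1) by rewrite HS; field; lra.
by apply: Rinv_le_contravar; nra.
Qed.

Lemma inv_sq_from A B : \rsum_(A.+1 <= m < B.+1) / INR m ^ 2 <= 2 / INR A.+1.
Proof.
have HA := @INR_ge1 A.+1 isT; have Hi : 0 < / INR A.+1 by apply: Rinv_0_lt_compat; lra.
case: (leqP B A) => H; first by rewrite big_geq //; lra.
rewrite big_ltn //; have := @inv_sq_block A.+1 B H.
have HB : 0 < / INR B by apply/Rinv_0_lt_compat/INR_lt0; lia.
have : / INR A.+1 ^ 2 <= / INR A.+1 by apply: Rinv_le_contravar; nra.
lra.
Qed.

Lemma inv_sq_ge0 m : 0 <= / INR m ^ 2.
Proof. by rewrite -pow_inv; exact: pow2_ge_0. Qed.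

Lemma inv_sq_tail a b y : 0 < y ->
  \rsum_(a.+1 <= m < b.+1 | rleb y (INR m)) / INR m ^ 2 <= 2 / y.
Proof.
move=> Hy; have [A [A1 A2]] := exists_ceil Hy.
apply: Rle_trans (_ : \rsum_(A.+1 <= m < b.+1) / INR m ^ 2 <= _).
  apply: rsum_subrange => [m|m Hm /rlebP H]; first exact: inv_sq_ge0.
  by have := gt_of_ceil A1 H; lia.
apply: Rle_trans (inv_sq_from A b) _.
by apply: Rmult_le_compat_l; [lra|exact: Rinv_le_contravar].
Qed.

(** The first integer in the window costs at most [/ (y * INR a.+1)] and the others telescope. That
    first cost is the jump that keeps [phi] from being Lipschitz. *)
Lemma inv_sq_window a b y y' : 0 < y <= y' ->
  \rsum_(a.+1 <= m < b.+1 | rleb y (INR m) && ~~ rleb y' (INR m)) / INR m ^ 2 <=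
  / (y * INR a.+1) + (/ y - / y').
Proof.
move=> Hy; have [A [A1 A2]] := @exists_ceil y ltac:(lra).
have [B [B1 B2]] := @exists_ceil y' ltac:(lra).
have Ha := @INR_ge1 a.+1 isT.
have Hyy : / y' <= / y by apply: Rinv_le_contravar; lra.
have Hp : 0 < / (y * INR a.+1) by apply: Rinv_0_lt_compat; nra.
apply: Rle_trans (_ : \rsum_((maxn A a).+1 <= m < B.+1) / INR m ^ 2 <= _).
  apply: rsum_subrange => [m|m Hm /andP[/rlebP H /rlebP H']]; first exact: inv_sq_ge0.
  have := gt_of_ceil A1 H => HA.
  have : (m < B.+1)%N by apply/ltP; apply: INR_lt; lra.
  lia.
case: (leqP B (maxn A a)) => H; first by rewrite big_geq //; lra.
rewrite big_ltn //; have := @inv_sq_block (maxn A a).+1 B H.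
have HA : y <= INR (maxn A a).+1 by apply: Rle_trans A2 _; apply: INR_leq; lia.
have Haa : INR a.+1 <= INR (maxn A a).+1 by apply: INR_leq; lia.
have : / INR (maxn A a).+1 ^ 2 <= / (y * INR a.+1).
  apply: Rinv_le_contravar; first nra.
  by rewrite /= Rmult_1_r; apply: Rmult_le_compat; lra.
have : / INR (maxn A a).+1 <= / y by apply: Rinv_le_contravar; lra.
have HB0 : 0 < INR B by apply: INR_lt0; lia.
have : / y' <= / INR B by apply: Rinv_le_contravar; lra.
lra.
Qed.

(* Chosen so that [sum f n / n * phi (ln n) = sum th m * csum f m / m ^ 2], while [phi]
   is bounded and Lipschitz up to the jump size [O(1 / a)]. *)
Definition phi (th : nat -> C) (a b : nat) (v : R) : C :=
  if rleb 0 v then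
    (RtoC (exp v) * \csum_(a.+1 <= m < b.+1 | rleb (exp v) (INR m)) (th m * RtoC (/ INR m ^ 2)))%C
  else RtoC 0.

Lemma phi_term_le (th : nat -> C) a b (Q : pred nat) : (forall m, Cmod (th m) <= 1) ->
  Cmod (\csum_(a <= m < b | Q m) (th m * RtoC (/ INR m ^ 2))) <=
  \rsum_(a <= m < b | Q m) / INR m ^ 2.
Proof.
move=> Hth; apply: Rle_trans (Cmod_csum _ _ _) _; apply: rsum_le => m _ _.
rewrite Cmod_mult Cmod_R Rabs_pos_eq; last exact: inv_sq_ge0.
by rewrite -[X in _ <= X]Rmult_1_l; apply: Rmult_le_compat_r; [exact: inv_sq_ge0|].
Qed.

Lemma phi_bound th a b v : (forall m, Cmod (th m) <= 1) -> Cmod (phi th a b v) <= 2.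
Proof.
move=> Hth; rewrite /phi; case: ifP => _; last by rewrite Cmod_0; lra.
have P := exp_pos v; rewrite Cmod_mult Cmod_R Rabs_pos_eq; last lra.
have := Rle_trans _ _ _ (phi_term_le _ _ (fun m => rleb (exp v) (INR m)) Hth) (@inv_sq_tail a b (exp v) P).
move=> /(Rmult_le_compat_l (exp v) _ _ (Rlt_le _ _ P)) H; apply: Rle_trans H _.
by right; field; lra.
Qed.

Lemma phi_support th a b v : ln (INR b) < v -> phi th a b v = RtoC 0.
Proof.
move=> H; rewrite /phi; case: ifP => // _; rewrite big1_seq ?Cmult_0_r // => m.
rewrite mem_index_iota => /andP[/rlebP H1 /andP[Hm Hmb]].
have Hm0 : 0 < INR m by apply: INR_lt0; lia.
have : v <= ln (INR m) by rewrite -(ln_exp v); apply: ln_mono => //; exact: exp_pos.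
have : ln (INR m) <= ln (INR b) by apply: ln_mono => //; apply: INR_leq; lia.
lra.
Qed.

(** In [3 r], a share 2 comes from the growth of [exp] and 1 from the part of the tail that is lost.
    When [v < 0 <= v'], the value at [v'] is at most [exp 1] times the full tail [2 / INR a.+1],
    hence the 6. *)
Lemma phi_lip_ordered th a b v v' r : (forall m, Cmod (th m) <= 1) -> 0 <= v' - v <= r -> r <= 1 ->
  Cmod (phi th a b v' - phi th a b v) <= 3 * r + 6 / INR a.+1.
Proof.
move=> Hth Hv Hr; have Ha := @INR_ge1 a.+1 isT.
have Hi : 0 < / INR a.+1 by apply: Rinv_0_lt_compat; lra.
rewrite /phi; case: (rlebP 0 v') => Hv'; last first.
  case: (rlebP 0 v) => Hv0; first lra.
  by rewrite (_ : (RtoC 0 - RtoC 0)%C = RtoC 0) ?Cmod_0; [lra|ring].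
have P' := exp_pos v'; have P := exp_pos v.
case: (rlebP 0 v) => Hv0; last first.
  rewrite (_ : (_ - RtoC 0)%C = (RtoC (exp v') * \csum_(a.+1 <= m < b.+1 | rleb (exp v') (INR m)) (th m * RtoC (/ INR m ^ 2)))%C); last ring.
  rewrite Cmod_mult Cmod_R Rabs_pos_eq; last lra.
  have E3 : exp v' <= 3 by apply: Rle_trans (_ : exp 1 <= _); [apply: exp_mono; lra|exact: exp_le_3].
  have H : Cmod (\csum_(a.+1 <= m < b.+1 | rleb (exp v') (INR m)) (th m * RtoC (/ INR m ^ 2))) <= 2 / INR a.+1.
    apply: Rle_trans (phi_term_le _ _ _ Hth) _; apply: Rle_trans (inv_sq_from a b).
    by apply: rsum_subrange => // m; exact: inv_sq_ge0.
  have := Rmult_le_compat _ _ _ _ (Rlt_le _ _ P') (Cmod_ge_0 _) E3 H; rewrite /Rdiv; lra.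
set S' := \csum_(a.+1 <= m < b.+1 | rleb (exp v') (INR m)) (th m * RtoC (/ INR m ^ 2)).
set W := \csum_(a.+1 <= m < b.+1 | rleb (exp v) (INR m) && ~~ rleb (exp v') (INR m)) (th m * RtoC (/ INR m ^ 2)).
have -> : \csum_(a.+1 <= m < b.+1 | rleb (exp v) (INR m)) (th m * RtoC (/ INR m ^ 2)) = (S' + W)%C.
  rewrite (bigID (fun m => rleb (exp v') (INR m))) /=; congr Cplus.
  apply: eq_bigl => m; case: (rlebP (exp v') (INR m)) => H; last by rewrite andbF.
  by rewrite andbT; apply/rlebP; apply: Rle_trans H; apply: exp_mono; lra.
have -> : (RtoC (exp v') * S' - RtoC (exp v) * (S' + W) = RtoC (exp v' - exp v) * S' - RtoC (exp v) * W)%C.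
  by rewrite RtoC_minus; ring.
have HS : Cmod S' <= 2 / exp v' by apply: Rle_trans (phi_term_le _ _ _ Hth) _; exact: inv_sq_tail.
have HW : Cmod W <= / (exp v * INR a.+1) + (/ exp v - / exp v').
  apply: Rle_trans (phi_term_le _ _ _ Hth) _; apply: inv_sq_window.
  by split; [lra|apply: exp_mono; lra].
apply: Rle_trans (Cmod_triangle _ _) _; rewrite Cmod_opp !Cmod_mult !Cmod_R.
have Hle : exp v <= exp v' by apply: exp_mono; lra.
rewrite (Rabs_pos_eq (exp v)) ?(Rabs_pos_eq (exp v' - _)); try lra.
have Eq : exp v = exp v' * exp (v - v') by rewrite -exp_plus; congr exp; ring.
have Hq := exp_ineq1_le (v - v').
have T1 := Rmult_le_compat_l (exp v' - exp v) _ _ ltac:(lra) HS.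
have T2 := Rmult_le_compat_l (exp v) _ _ ltac:(lra) HW.
have E1 : (exp v' - exp v) * (2 / exp v') = 2 * (1 - exp (v - v')) by rewrite Eq; field; lra.
have E2 : exp v * (/ (exp v * INR a.+1) + (/ exp v - / exp v')) = / INR a.+1 + (1 - exp (v - v')).
  rewrite (_ : exp (v - v') = exp v / exp v'); first by field; lra.
  by rewrite Eq; field; lra.
rewrite E1 in T1; rewrite E2 in T2; rewrite /Rdiv; lra.
Qed.

Lemma phi_lip th a b v v' r : (forall m, Cmod (th m) <= 1) -> Rabs (v - v') <= r -> r <= 1 ->
  Cmod (phi th a b v' - phi th a b v) <= 3 * r + 6 / INR a.+1.
Proof.
move=> Hth /Rabs_le_between H Hr; case: (Rle_dec v v') => Hv.
  by apply: phi_lip_ordered => //; lra.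
rewrite -Cmod_opp (_ : (- _)%C = (phi th a b v - phi th a b v')%C); last ring.
by apply: phi_lip_ordered => //; lra.
Qed.

(* [K] points of spacing [d], centred at 0; [grid_freq] is the dual frequency, so that the
   kernel has period [K d]. *)
Definition grid_freq (K : nat) (d : R) : R := 2 * PI / (INR K * d).
Definition grid_pt (K : nat) (d : R) (j : nat) : R := INR j * d - INR K * d / 2.

(** The range is half a period for the grid points plus [1 / 20] of a period for the logarithms
    compared with them. *)
Lemma ker_cap K d x : (0 < K)%N -> 0 < d -> Rabs x <= 11 / 20 * (INR K * d) ->
  ker K (grid_freq K d * x) <= 4 * INR K ^ 2 * invsq_cap d x.
Proof.
move=> HK Hd Hx; have HKr := INR_lt0 HK; have Hpi := PI_4; have Hpi3 := PI2_3_2; have Hpi0 := PI_RGT_0.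
have HP : 0 < INR K * d by apply: Rmult_lt_0_compat.
rewrite /invsq_cap; case: (rlebP (Rabs x) d) => H.
  by have := ker_le K (grid_freq K d * x); have := pow2_ge_0 (INR K); lra.
have Hx0 : x <> 0 by move=> E; rewrite E Rabs_R0 in H; lra.
have Ht : 0 < grid_freq K d by apply: Rdiv_lt_0_compat; lra.
have := @ker_decay K (grid_freq K d * x); rewrite Rabs_mult (Rabs_pos_eq (grid_freq K d)); last lra.
have Hc : grid_freq K d * Rabs x <= 4.4.
  apply: Rle_trans (Rmult_le_compat_l _ _ _ (Rlt_le _ _ Ht) Hx) _.
  rewrite (_ : grid_freq K d * _ = 11 / 10 * PI); first lra.
  by rewrite /grid_freq; field; lra.
move=> /(_ Hc) HD.
(* It exceeds the 111 of [ker_decay] because [PI > 3]. *)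
have E : (grid_freq K d * x) ^ 2 * (4 * INR K ^ 2 * (d / x) ^ 2) = 16 * PI ^ 2.
  by rewrite /grid_freq; field; repeat split; lra.
have Hsq : 0 < (grid_freq K d * x) ^ 2.
  by apply: pow2_gt_0; apply: Rmult_integral_contrapositive; split; lra.
apply: (Rmult_le_reg_l ((grid_freq K d * x) ^ 2)) => //; rewrite E.
nra.
Qed.

Lemma grid_sum K d x : (0 < K)%N -> 0 < d ->
  \rsum_(0 <= j < K) ker K (grid_freq K d * (x - grid_pt K d j)) = INR K ^ 2.
Proof.
move=> HK Hd; have HKr := INR_lt0 HK; rewrite -(ker_grid (grid_freq K d * x + PI) HK).
apply: eq_bigr => j _; congr ker; rewrite /grid_freq /grid_pt; field; lra.
Qed.

(** Kernel averages over the grid reproduce [phi] at [x]. Grid points within [r] are handled by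
    [phi_lip] and the total mass [INR K ^ 2]; the others by [|phi| <= 2] and the inverse square
    decay of the kernel, summed dyadically. The constant is [352 = 16 * (16 + 6)]. *)
Lemma phi_smoothing th a b K d x r : (forall m, Cmod (th m) <= 1) -> (0 < K)%N -> 0 < d <= r -> r <= 1 ->
  Rabs x <= 1 / 20 * (INR K * d) ->
  \rsum_(0 <= j < K) (Cmod (phi th a b (grid_pt K d j) - phi th a b x) * ker K (grid_freq K d * (x - grid_pt K d j))) <=
  INR K ^ 2 * (3 * r + 6 / INR a.+1 + 352 * (d / r)).
Proof.
move=> Hth HK Hd Hr Hx; have HKr := INR_lt0 HK; have Ha := @INR_ge1 a.+1 isT.
have HP : 0 < INR K * d by apply: Rmult_lt_0_compat; lra.
have Hx' j : (0 <= j < K)%N -> Rabs (x - grid_pt K d j) <= 11 / 20 * (INR K * d).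
  move=> /andP[_ Hj]; have : INR j <= INR K by apply: INR_leq; lia.
  move=> Hj'; have := Rmult_le_compat_r d _ _ ltac:(lra) Hj'.
  have := Rmult_le_pos _ _ (pos_INR j) (ltac:(lra) : 0 <= d).
  move: Hx => /Rabs_le_between Hx; rewrite /grid_pt => *; apply: Rabs_le; lra.
set e := 3 * r + 6 / INR a.+1.
have He : 0 <= e by rewrite /e /Rdiv; have : 0 < / INR a.+1 by [apply: Rinv_0_lt_compat; lra]; lra.
set q := 16 * INR K ^ 2 * (d / r) ^ 2.
have Hq : 0 <= q by apply: Rmult_le_pos; [have := pow2_ge_0 (INR K); lra|exact: pow2_ge_0].
apply: Rle_trans (_ : \rsum_(0 <= j < K) (e * ker K (grid_freq K d * (x - grid_pt K d j)) +
    q * (1 * invsq_cap r (x - grid_pt K d j))) <= _).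
  apply: rsum_le => j Hj _.
  have K0 := ker_ge0 K (grid_freq K d * (x - grid_pt K d j)).
  have I0 := invsq_cap_ge0 r (x - grid_pt K d j).
  case: (Rle_dec (Rabs (x - grid_pt K d j)) r) => Hn.
    have := Rmult_le_compat_r _ _ _ K0 (phi_lip a b Hth Hn Hr).
    have := Rmult_le_pos _ _ Hq I0; rewrite -/e; lra.
  have B1 := ker_cap HK (proj1 Hd) (Hx' j Hj).
  have B2 : Cmod (phi th a b (grid_pt K d j) - phi th a b x) <= 4.
    apply: Rle_trans (Cmod_triangle _ _) _; rewrite Cmod_opp.
    by have := phi_bound a b (grid_pt K d j) Hth; have := phi_bound a b x Hth; lra.
  have B3 : 4 * (4 * INR K ^ 2 * invsq_cap d (x - grid_pt K d j)) = q * (1 * invsq_cap r (x - grid_pt K d j)).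
    rewrite /invsq_cap; case: (rlebP _ d) => H1; first lra.
    case: (rlebP _ r) => H2 //.
    have Hx0 : x - grid_pt K d j <> 0 by move=> E; rewrite E Rabs_R0 in H1; lra.
    by rewrite /q; field; lra.
  have := Rmult_le_compat _ _ _ _ (Cmod_ge_0 _) K0 B2 B1.
  have := Rmult_le_pos _ _ He K0; lra.
rewrite rsumD -!rsum_mull grid_sum //; last lra.
have Hdr : 0 < d / r <= 1.
  split; first by apply: Rdiv_lt_0_compat; lra.
  by apply: (Rmult_le_reg_r r); [lra|rewrite /Rdiv Rmult_assoc Rinv_l; lra].
have D := @dyadic_sum 0 K (fun _ => 1) (fun j => x - grid_pt K d j) r (2 * r / d) 1 (11 / 20 * (INR K * d))
   ltac:(lra) ltac:(left; apply: Rdiv_lt_0_compat; lra) ltac:(lra) ltac:(move=> *; lra) Hx'.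
have {}D : \rsum_(0 <= j < K) (1 * invsq_cap r (x - grid_pt K d j)) <= 8 * (2 * r / d) + 6 * 1.
  apply: D => s Hs.
  have := @count_grid K (x / d + INR K / 2) (s * r / d).
  have Hsr : 0 <= s * r / d by left; apply: Rdiv_lt_0_compat; [apply: Rmult_lt_0_compat|]; lra.
  move=> /(_ Hsr) Cg; rewrite (_ : 2 * r / d * s + 1 = 2 * (s * r / d) + 1); last by field; lra.
  apply: Rle_trans Cg; right; apply: eq_bigl => j; apply/rlebP/rlebP => H.
    have -> : x / d + INR K / 2 - INR j = (x - grid_pt K d j) / d by rewrite /grid_pt; field; lra.
    rewrite Rabs_div; last lra.
    rewrite (Rabs_pos_eq d); last lra.
    by apply: Rmult_le_compat_r; [left; apply: Rinv_0_lt_compat; lra|].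
  have -> : x - grid_pt K d j = (x / d + INR K / 2 - INR j) * d by rewrite /grid_pt; field; lra.
  rewrite Rabs_mult (Rabs_pos_eq d); last lra.
  by rewrite (_ : s * r = s * r / d * d); [apply: Rmult_le_compat_r; lra|field; lra].
rewrite -rsum_mull in D; have := Rmult_le_compat_l _ _ _ Hq D.
have -> : q * (8 * (2 * r / d) + 6 * 1) = 16 * INR K ^ 2 * (16 * (d / r) + 6 * (d / r) ^ 2).
  by rewrite /q; field; lra.
have KK := pow2_ge_0 (INR K).
have : (d / r) ^ 2 <= d / r by nra.
move=> HH; have := Rmult_le_compat_l (INR K ^ 2) _ _ KK HH; rewrite -/e; lra.
Qed.

(** * Large values of the Dirichlet series *)

Definition twist (f : nat -> C) (t : R) (n : nat) : C := (f n * cis (- (t * ln (INR n))))%C.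

Lemma twist_cm f t : completely_multiplicative f -> completely_multiplicative (twist f t).
Proof.
move=> Hf; split; first by rewrite /twist (proj1 Hf) INR1 ln_1 Rmult_0_r Ropp_0 cis0 Cmult_1_l.
move=> m n /leP Hm /leP Hn; rewrite /twist cmM // ln_INRM //.
rewrite (_ : - _ = - (t * ln (INR m)) + - (t * ln (INR n))) ?cisD; [ring|ring].
Qed.

Lemma twist_bound f t n : (forall n, Cmod (f n) <= 1) -> Cmod (twist f t n) <= 1.
Proof. by move=> H; rewrite /twist Cmod_mult Cmod_cis Rmult_1_r. Qed.

Definition lam_poly f V X t : C :=
  \csum_(1 <= n < X.+1) (RtoC (lam n * npow (/ V) n) * f n * cis (- (t * ln (INR n)))).

Definition log2_poly f V X t : C :=
  \csum_(1 <= n < X.+1) (RtoC (ln (INR n) ^ 2 * npow (/ V) n) * f n * cis (- (t * ln (INR n)))).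

Lemma lam_poly_mean_square : exists K0, 0 < K0 /\ forall f V X K d,
  (forall n, Cmod (f n) <= 1) -> 1 <= V -> (0 < K)%N -> 0 < d -> 1 <= d * V ->
  ln (INR X) <= 11 / 20 * (INR K * d) ->
  \rsum_(0 <= k < K) \rsum_(0 <= l < K)
    (Cmod (lam_poly f V X ((INR k - INR l) * grid_freq K d)) ^ 2) <= K0 * INR K ^ 2 * d * V ^ 3.
Proof.
have [K1 [HK1 H1]] := lam_total; have [K2 [HK2 H2]] := lam_window.
exists (56 * K1 * K2); split; first nra.
move=> f V X K d Hf HV HK Hd HdV HX.
apply: Rle_trans (@mean_square_ker K (grid_freq K d) (fun n => RtoC (lam n * npow (/ V) n) * f n)%C (fun n => ln (INR n)) 1 X.+1) _.
set w := fun n => lam n * npow (/ V) n.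
have w0 n : 0 <= w n by apply: Rmult_le_pos; [exact: lam_ge0|left; exact: npow_gt0].
have Hw n : Cmod (RtoC (lam n * npow (/ V) n) * f n) <= w n.
  rewrite Cmod_mult Cmod_R Rabs_pos_eq; last exact: w0.
  by have := Rmult_le_compat_l _ _ _ (w0 n) (Hf n); rewrite Rmult_1_r.
apply: Rle_trans (_ : \rsum_(1 <= n < X.+1) (w n * (4 * INR K ^ 2 * (14 * K2 * d * V))) <= _); last first.
  rewrite -rsum_mulr; have := H1 V X HV; rewrite -/w => HT.
  have P : 0 <= 4 * INR K ^ 2 * (14 * K2 * d * V).
    by apply: Rmult_le_pos; [have := pow2_ge_0 (INR K); lra|repeat apply: Rmult_le_pos; lra].
  by have HH := Rmult_le_compat_r _ _ _ P HT; apply: Rle_trans HH _; right; ring.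
apply: rsum_le => n /andP[Hn HnX] _.
have Hd' m : (1 <= m < X.+1)%N -> Rabs (ln (INR n) - ln (INR m)) <= 11 / 20 * (INR K * d).
  move=> /andP[Hm HmX].
  have L k : (0 < k)%N -> (k < X.+1)%N -> 0 <= ln (INR k) <= ln (INR X).
    move=> Hk HkX; split; first exact: ln_INR_ge0.
    by apply: ln_mono; [exact: INR_lt0|apply: INR_leq; lia].
  by have := L n Hn HnX; have := L m Hm HmX => *; apply: Rabs_le; lra.
apply: Rle_trans (_ : \rsum_(1 <= m < X.+1) (w n * (4 * INR K ^ 2 * (w m * invsq_cap d (ln (INR n) - ln (INR m))))) <= _).
  apply: rsum_le => m Hm _.
  have C1 := ker_cap HK Hd (Hd' m Hm).
  have C2 := Rmult_le_compat _ _ _ _ (Cmod_ge_0 _) (Cmod_ge_0 _) (Hw n) (Hw m).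
  have C3 := Rmult_le_compat _ _ _ _ (Rmult_le_pos _ _ (Cmod_ge_0 _) (Cmod_ge_0 _)) (ker_ge0 _ _) C2 C1.
  by apply: Rle_trans C3 _; right; ring.
rewrite -!rsum_mull; apply: Rmult_le_compat_l; first exact: w0.
apply: Rmult_le_compat_l; first by have := pow2_ge_0 (INR K); lra.
apply: Rle_trans (@dyadic_sum 1 X.+1 w (fun m => ln (INR n) - ln (INR m)) d (K2 * (d * V)) K2 _ Hd _ _ w0 Hd' _) _.
- by apply: Rmult_le_pos; lra.
- lra.
- by move=> r Hr; apply: Rle_trans (H2 V (ln (INR n)) (r * d) X HV ltac:(nra)) _; right; ring.
have : K2 * 1 <= K2 * (d * V) by apply: Rmult_le_compat_l; lra.
lra.
Qed.

(** Schur's test: [2 x y <= x^2 + y^2], and all row and column sums of the kernel matrix equal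
    [INR K ^ 2]. *)
Lemma grid_mean_square (be : nat -> C) K d : (0 < K)%N -> 0 < d ->
  \rsum_(0 <= k < K) \rsum_(0 <= l < K)
    (Cmod (\csum_(0 <= j < K) (be j * cis ((INR k - INR l) * grid_freq K d * grid_pt K d j))) ^ 2) <=
  INR K ^ 2 * \rsum_(0 <= j < K) (Cmod (be j) ^ 2).
Proof.
move=> HK Hd.
have := @mean_square_ker K (grid_freq K d) be (fun j => - grid_pt K d j) 0 K.
have -> : \rsum_(0 <= k < K) \rsum_(0 <= l < K)
    (Cmod (\csum_(0 <= j < K) (be j * cis (- ((INR k - INR l) * grid_freq K d * - grid_pt K d j)))) ^ 2) =
  \rsum_(0 <= k < K) \rsum_(0 <= l < K)
    (Cmod (\csum_(0 <= j < K) (be j * cis ((INR k - INR l) * grid_freq K d * grid_pt K d j))) ^ 2).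
  apply: eq_bigr => k _; apply: eq_bigr => l _; congr (Cmod _ ^ 2); apply: eq_bigr => j _.
  by congr (_ * cis _)%C; ring.
move=> H; apply: Rle_trans H _.
pose s := fun j => Cmod (be j) ^ 2.
pose k := fun n m => ker K (grid_freq K d * (- grid_pt K d n - - grid_pt K d m)).
have Sm n : \rsum_(0 <= m < K) k n m = INR K ^ 2.
  rewrite -(@grid_sum K d (grid_pt K d n) HK Hd); apply: eq_bigr => m _.
  by rewrite /k -kerN; congr ker; ring.
have Sn m : \rsum_(0 <= n < K) k n m = INR K ^ 2.
  by rewrite -(@grid_sum K d (grid_pt K d m) HK Hd); apply: eq_bigr => n _; congr ker; ring.
apply: Rle_trans (_ : \rsum_(0 <= n < K) \rsum_(0 <= m < K) (/ 2 * (s n * k n m) + / 2 * (s m * k n m)) <= _).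
  apply: rsum_le => n _ _; apply: rsum_le => m _ _.
  have K0 : 0 <= k n m by exact: ker_ge0.
  rewrite -/(k n m) (_ : / 2 * _ + _ = / 2 * (s n + s m) * k n m); last ring.
  apply: Rmult_le_compat_r => //; rewrite /s.
  by have := pow2_ge_0 (Cmod (be n) - Cmod (be m)); lra.
right; rewrite (eq_bigr (fun n => / 2 * (s n * INR K ^ 2) + / 2 * \rsum_(0 <= m < K) (s m * k n m))); last first.
  by move=> n _; rewrite rsumD -!rsum_mull Sm.
rewrite rsumD -!rsum_mull exchange_big_nat.
have -> : \rsum_(0 <= j < K) \rsum_(0 <= i < K) (s j * k i j) = \rsum_(0 <= j < K) (s j * INR K ^ 2).
  by apply: eq_bigr => j _; rewrite -rsum_mull Sn.
by rewrite -rsum_mulr [RHS]Rmult_comm; rewrite /s; field.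
Qed.

(** [phi] vanishes outside [0 <= v <= V], where there are at most [V / d + 1] grid points, and is at
    most 2. *)
Lemma phi_grid_sq th a b K d V : (forall m, Cmod (th m) <= 1) -> 0 < d -> 0 < V -> ln (INR b) <= V ->
  \rsum_(0 <= j < K) (Cmod (phi th a b (grid_pt K d j)) ^ 2) <= 4 * (V / d + 1).
Proof.
move=> Hth Hd HV Hb.
pose z := INR K / 2 + V / (2 * d); pose r := V / (2 * d).
have Hr : 0 <= r by left; apply: Rdiv_lt_0_compat; lra.
apply: Rle_trans (_ : \rsum_(0 <= j < K) (4 * (if rleb (Rabs (z - INR j)) r then 1 else 0)) <= _).
  apply: rsum_le => j _ _; case: (rlebP _ r) => H.
    have := phi_bound a b (grid_pt K d j) Hth; have := Cmod_ge_0 (phi th a b (grid_pt K d j)); nra.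
  suff -> : phi th a b (grid_pt K d j) = RtoC 0 by rewrite Cmod_0; lra.
  case: (Rlt_dec (ln (INR b)) (grid_pt K d j)) => H2; first exact: phi_support.
  rewrite /phi; case: rlebP => // H3; exfalso; apply: H.
  have -> : z - INR j = (V / 2 - grid_pt K d j) * / d by rewrite /z /grid_pt; field; lra.
  rewrite Rabs_mult (Rabs_pos_eq (/ d)); last by left; apply: Rinv_0_lt_compat.
  rewrite (_ : r = V / 2 * / d); last by rewrite /r; field; lra.
  apply: Rmult_le_compat_r; first by left; apply: Rinv_0_lt_compat.
  by apply: Rabs_le; lra.
rewrite -rsum_mull -big_mkcond.
have := @count_grid K z r Hr.
rewrite (_ : 2 * r + 1 = V / d + 1) => [H|]; last by rewrite /r; field; lra.
by apply: Rmult_le_compat_l; [lra|exact: H].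
Qed.

Lemma log2_weight_lip V u v : 0 < V -> 0 <= u <= v -> v <= V ->
  Rabs (v ^ 2 * exp (- / V * v) - u ^ 2 * exp (- / V * u)) <= 2 * V * (v - u).
Proof.
move=> HV Hu Hv; have Hi := Rinv_0_lt_compat _ HV.
have E1 : exp (- / V * v) = exp (- / V * u) * exp (- (/ V * (v - u))).
  by rewrite -exp_plus; congr exp; ring.
set p := exp (- / V * u) in E1 *; set q := exp (- (/ V * (v - u))) in E1.
have Hp : 0 < p <= 1.
  split; first exact: exp_pos.
  by rewrite -exp_0; apply: exp_mono; nra.
have Hq0 : 0 < q by exact: exp_pos.
have Hd : 0 <= / V * (v - u) by apply: Rmult_le_pos; lra.
have Hq1 : q <= 1 by rewrite -exp_0; apply: exp_mono; lra.
have Hq : 1 - / V * (v - u) <= q by have := exp_ineq1_le (- (/ V * (v - u))); rewrite -/q; lra.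
rewrite E1; have Huv : 0 <= v ^ 2 - u ^ 2 <= 2 * V * (v - u) by nra.
have U : v ^ 2 * (p * q) - u ^ 2 * p <= (v ^ 2 - u ^ 2) * p.
  have : 0 <= v ^ 2 * p * (1 - q) by apply: Rmult_le_pos; [apply: Rmult_le_pos; [exact: pow2_ge_0|lra]|lra].
  lra.
have U2 : (v ^ 2 - u ^ 2) * p <= 2 * V * (v - u) * 1 by apply: Rmult_le_compat; lra.
have L : - (v * (v * / V) * (v - u)) <= v ^ 2 * (p * q) - u ^ 2 * p.
  have : v ^ 2 * p * (1 - / V * (v - u)) <= v ^ 2 * p * q.
    by apply: Rmult_le_compat_l => //; apply: Rmult_le_pos; [exact: pow2_ge_0|lra].
  have : 0 <= (v ^ 2 - u ^ 2) * p by apply: Rmult_le_pos; lra.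
  have : v ^ 2 * (/ V * (v - u)) * p <= v ^ 2 * (/ V * (v - u)) * 1.
    by apply: Rmult_le_compat_l; [apply: Rmult_le_pos; [exact: pow2_ge_0|]|]; lra.
  lra.
have L2 : v * (v * / V) * (v - u) <= V * 1 * (v - u).
  apply: Rmult_le_compat_r; first lra.
  apply: Rmult_le_compat; try lra.
    by apply: Rmult_le_pos; lra.
  by rewrite -(Rinv_r V); [apply: Rmult_le_compat_r; lra|lra].
have : 0 <= V * (v - u) by apply: Rmult_le_pos; lra.
move=> H; apply: Rabs_le; lra.
Qed.

Definition phase (z : C) : C :=
  if Req_EM_T (Cmod z) 0 then RtoC 1 else (Cconj z / RtoC (Cmod z))%C.

Lemma phase_spec z : Cmod (phase z) <= 1 /\ (phase z * z)%C = RtoC (Cmod z).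
Proof.
rewrite /phase; case: Req_EM_T => H /=.
  split; first by rewrite Cmod_1; lra.
  by rewrite H (Cmod_eq_0 _ H); ring.
have Hz : RtoC (Cmod z) <> 0 by move=> E; apply: H; apply: RtoC_inj.
split.
  rewrite Cmod_div // Cmod_conj Cmod_R Rabs_pos_eq; last exact: Cmod_ge_0.
  by rewrite Rdiv_diag //; lra.
rewrite /Cdiv (_ : (_ * z)%C = (z * Cconj z * / RtoC (Cmod z))%C); last ring.
by rewrite -Cmod2_conj /= Rmult_1_r RtoC_mult; field.
Qed.

(** [th] is the conjugate phase of the partial sums. After exchanging the sums, the inner sum of
    [W n * f n] is replaced by [W m] times the partial sum of [f], which costs [2 V m] per [m] and
    [4 V^2] in all. Then [W m >= (V / 2)^2 * exp (- 1) >= V^2 / 12]. *)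
Lemma main_term f V a b X : (forall n, Cmod (f n) <= 1) -> 1 <= V -> (b <= X)%N ->
  (forall m, (a < m <= b)%N -> V / 2 <= ln (INR m) <= V) -> 
  exists th : nat -> C, (forall m, Cmod (th m) <= 1) /\
  V ^ 2 / 12 * mean_mass f a b - 4 * V ^ 2 <=
  Cmod (\csum_(1 <= n < X.+1) (RtoC (ln (INR n) ^ 2 * npow (/ V) n) * f n * phi th a b (ln (INR n)))).
Proof.
move=> Hf HV HbX Hab; have HV0 : 0 < V by lra.
pose th m := phase (csum f m).
have Hth m : Cmod (th m) <= 1 /\ (th m * csum f m)%C = RtoC (Cmod (csum f m)) by exact: phase_spec.
exists th; split; first by move=> m; case: (Hth m).
pose W n := ln (INR n) ^ 2 * exp (- / V * ln (INR n)).
have EW n : (0 < n)%N -> ln (INR n) ^ 2 * npow (/ V) n * INR n = W n.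
  move=> Hn; rewrite npowE // /W -/(Rpower _ _); field.
  by have := INR_lt0 Hn; lra.
have -> : \csum_(1 <= n < X.+1) (RtoC (ln (INR n) ^ 2 * npow (/ V) n) * f n * phi th a b (ln (INR n))) =
  \csum_(a.+1 <= m < b.+1) (th m * RtoC (/ INR m ^ 2) * \csum_(1 <= n < m.+1) (RtoC (W n) * f n)).
  transitivity (\csum_(1 <= n < X.+1) \csum_(a.+1 <= m < b.+1 | (n <= m)%N)
     (RtoC (W n) * f n * (th m * RtoC (/ INR m ^ 2)))).
    apply: eq_big_nat => n /andP[Hn HnX]; have Hn' := INR_lt0 Hn.
    rewrite -csum_mull -EW // !RtoC_mult /phi.
    have -> : rleb 0 (ln (INR n)) by apply/rlebP; exact: ln_INR_ge0.
    rewrite exp_ln // (eq_bigl (fun m => (n <= m)%N)); first by ring.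
    by move=> m; apply/rlebP/idP => [/leq_of_INR|/INR_leq].
  rewrite (@exchange_big_dep_nat _ _ _ _ _ _ _ xpredT (fun n m => n <= m)%N xpredT) //=.
  apply: eq_big_nat => m /andP[Hm Hmb]; rewrite csum_mull.
  rewrite [RHS](@big_nat_widen _ _ _ _ m.+1 X.+1); last lia.
  by apply: eq_big => [n|n _]; [rewrite ltnS|ring].
have HT m : (a < m <= b)%N ->
  Cmod (\csum_(1 <= n < m.+1) (RtoC (W n) * f n) - RtoC (W m) * csum f m) <= 2 * V * INR m.
  move=> Hm; have [Hm1 Hm2] := Hab m Hm.
  rewrite csumE csum_mull -csumB; apply: Rle_trans (Cmod_csum _ _ _) _.
  apply: Rle_trans (_ : \rsum_(1 <= n < m.+1) (2 * V * (ln (INR m) - ln (INR n))) <= _); last first.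
    rewrite -rsum_mull; apply: Rmult_le_compat_l; first lra.
    exact: sum_ln_quot_le.
  apply: rsum_le => n /andP[Hn Hnm] _.
  rewrite (_ : (_ - _)%C = (RtoC (W n - W m) * f n)%C); last by rewrite RtoC_minus; ring.
  rewrite Cmod_mult Cmod_R Rabs_minus_sym.
  have Hl : ln (INR n) <= ln (INR m) by apply: ln_mono; [exact: INR_lt0|apply: INR_leq; lia].
  have := @log2_weight_lip V (ln (INR n)) (ln (INR m)) HV0 (conj (ln_INR_ge0 Hn) Hl) Hm2.
  rewrite -/(W n) -/(W m) => HL.
  have := Rmult_le_compat _ _ _ _ (Rabs_pos _) (Cmod_ge_0 _) HL (Hf n); lra.
set U := \csum_(a.+1 <= m < b.+1) (th m * RtoC (/ INR m ^ 2) * (RtoC (W m) * csum f m)).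
set D := \csum_(a.+1 <= m < b.+1) (th m * RtoC (/ INR m ^ 2) * (\csum_(1 <= n < m.+1) (RtoC (W n) * f n) - RtoC (W m) * csum f m)).
have -> : \csum_(a.+1 <= m < b.+1) (th m * RtoC (/ INR m ^ 2) * \csum_(1 <= n < m.+1) (RtoC (W n) * f n)) = (U + D)%C.
  by rewrite -csumD; apply: eq_bigr => m _; ring.
have HD : Cmod D <= 4 * V ^ 2.
  apply: Rle_trans (Cmod_csum _ _ _) _.
  apply: Rle_trans (_ : \rsum_(a.+1 <= m < b.+1) (2 * V * / INR m) <= _).
    apply: rsum_le => m Hm _; have Hm0 : 0 < INR m by apply: INR_lt0; lia.
    rewrite !Cmod_mult Cmod_R Rabs_pos_eq; last exact: inv_sq_ge0.
    have [T1 _] := Hth m; have I := inv_sq_ge0 m.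
    have A : Cmod (th m) * / INR m ^ 2 <= 1 * / INR m ^ 2 by apply: Rmult_le_compat_r.
    have := Rmult_le_compat _ _ _ _ (Rmult_le_pos _ _ (Cmod_ge_0 _) I) (Cmod_ge_0 _) A (HT m ltac:(lia)).
    rewrite (_ : 1 * / INR m ^ 2 * (2 * V * INR m) = 2 * V * / INR m) //; field; lra.
  rewrite -rsum_mull.
  have : \rsum_(a.+1 <= m < b.+1) / INR m <= 1 + V.
    case: (leqP b a) => Hba; first by rewrite big_geq //; lra.
    apply: Rle_trans (_ : \rsum_(1 <= m < b.+1) / INR m <= _).
      apply: rsum_subrange => [m|m Hm _]; last lia.
      by case: m => [|m]; [rewrite INR0 Rinv_0; lra|left; apply: Rinv_0_lt_compat; exact: INR_lt0].
    have := harmonic_le (ltac:(lia) : (0 < b)%N); have := Hab b ltac:(lia); lra.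
  nra.
have HU : V ^ 2 / 12 * mean_mass f a b <= Cmod U.
  have -> : U = RtoC (\rsum_(a.+1 <= m < b.+1) (W m * (Cmod (csum f m) * / INR m ^ 2))).
    rewrite RtoC_rsum; apply: eq_bigr => m _; rewrite !RtoC_mult -(proj2 (Hth m)); ring.
  rewrite Cmod_R; apply: Rle_trans (Rle_abs _); rewrite /mean_mass rsum_mull.
  apply: rsum_le => m Hm _; apply: Rmult_le_compat_r.
    by apply: Rmult_le_pos; [exact: Cmod_ge_0|exact: inv_sq_ge0].
  have [H1 H2] := Hab m ltac:(lia).
  have E : / 3 <= exp (- / V * ln (INR m)).
    apply: Rle_trans (_ : exp (- (1)) <= _).
      by rewrite exp_Ropp; apply: Rinv_le_contravar; [exact: exp_pos|exact: exp_le_3].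
    apply: exp_mono; have : / V * ln (INR m) <= / V * V.
      by apply: Rmult_le_compat_l; [left; exact: Rinv_0_lt_compat|].
    rewrite Rinv_l; lra.
  have : (V / 2) ^ 2 <= ln (INR m) ^ 2 by apply: pow_incr; lra.
  move=> Q; have := Rmult_le_compat _ _ _ _ (pow2_ge_0 (V / 2)) (ltac:(lra) : 0 <= / 3) Q E.
  rewrite /W; lra.
have := Cmod_triangle (U + D)%C (- D)%C; rewrite Cmod_opp (_ : (_ + - _)%C = U); last ring.
lra.
Qed.

(** Truncated form of [F'' = F G]. The inner sum at [d] stops at [X %/ d]; its tail
    [V (X / d)^(- 1 / V)] meets the factor [d^(- 1 / V)] of [npow], so the dependence on [d] is only
    [lam d / d]. The floor costs a factor 2. *)
Lemma log2_poly_factor : exists K0, 0 < K0 /\ forall f V X t,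
  completely_multiplicative f -> (forall n, Cmod (f n) <= 1) -> 1 <= V -> (0 < X)%N ->
  Cmod (log2_poly f V X t - Dir (twist f t) (/ V) * lam_poly f V X t) <=
  2 * V * Rpower (INR X) (- / V) * ((2 * ln (INR X) + K0) * (1 + ln (INR X))).
Proof.
have [K0 [HK0 H]] := lam_abel; exists K0; split => // f V X t Hf Hf1 HV HX.
have HV0 : 0 < V by lra.
have Hi := Rinv_0_lt_compat _ HV0.
have Hi1 : / V <= 1 by rewrite -Rinv_1; apply: Rinv_le_contravar; lra.
have Ht := twist_cm t Hf; have Ht1 n := twist_bound t n Hf1.
pose g n := (twist f t n * RtoC (npow (/ V) n))%C.
have Hg : completely_multiplicative g.
  split; first by rewrite /g (proj1 Ht) npow1 Cmult_1_l.
  by move=> m n /leP Hm /leP Hn; rewrite /g cmM // npowM // RtoC_mult; ring.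
have Eg M : csum g M = dser (twist f t) (/ V) M by rewrite csumE.
have -> : log2_poly f V X t = \csum_(1 <= n < X.+1) (RtoC (ln (INR n) ^ 2) * g n).
  by apply: eq_bigr => n _; rewrite RtoC_mult /g /twist; ring.
rewrite log2_convolution // csum_mull -csumB.
apply: Rle_trans (Cmod_csum _ _ _) _.
set R0X := Rpower (INR X) (- / V).
have HXr := INR_ge1 HX; have HLX := ln_ge0 HXr.
have HR0 : 0 < R0X by exact: exp_pos.
apply: Rle_trans (_ : \rsum_(1 <= d < X.+1) (2 * V * R0X * (lam d * / INR d)) <= _).
  apply: rsum_le => d /andP[Hd HdX] _; have Hdr := INR_lt0 Hd.
  have HM : (0 < X %/ d)%N by rewrite divn_gt0.
  rewrite Eg (_ : (_ - _)%C = (RtoC (lam d) * g d * (dser (twist f t) (/ V) (X %/ d) - Dir (twist f t) (/ V)))%C); last first.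
    by rewrite /g /twist RtoC_mult; ring.
  rewrite Cmod_mult.
  have T := @Dir_tail (twist f t) (/ V) (X %/ d) Ht1 Hi HM.
  rewrite Rinv_inv in T.
  have T1 : Cmod (RtoC (lam d) * g d) <= lam d * npow (/ V) d.
    rewrite Cmod_mult Cmod_R Rabs_pos_eq; last exact: lam_ge0.
    apply: Rmult_le_compat_l; first exact: lam_ge0.
    have P := npow_gt0 (/ V) d; rewrite /g Cmod_mult Cmod_R (Rabs_pos_eq (npow _ _)); last lra.
    by have := Rmult_le_compat_r _ _ _ (Rlt_le _ _ P) (Ht1 d); rewrite Rmult_1_l.
  have T2 : npow (/ V) d * Rpower (INR (X %/ d)) (- / V) <= 2 * R0X * / INR d.
    rewrite npowE // /R0X /Rpower.
    rewrite (_ : _ * / INR d * _ = exp (- / V * ln (INR d)) * exp (- / V * ln (INR (X %/ d))) * / INR d); last ring.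
    apply: Rmult_le_compat_r; first by left; exact: Rinv_0_lt_compat.
    rewrite -exp_plus -{1}(exp_ln 2); last lra.
    rewrite -exp_plus; apply: exp_mono.
    have HX2 : (X <= 2 * (X %/ d * d))%N by have := ltn_ceil X Hd; nia.
    have L : ln (INR X) <= ln 2 + (ln (INR (X %/ d)) + ln (INR d)).
      rewrite -ln_INRM // -lnM; [|lra|by apply: INR_lt0; rewrite muln_gt0 HM].
      apply: ln_mono; first lra.
      by have := INR_leq HX2; rewrite INRM.
    have L2 : 0 <= ln 2 by apply: ln_ge0; lra.
    have := Rmult_le_compat_l (/ V) _ _ ltac:(lra) L.
    have : / V * ln 2 <= 1 * ln 2 by apply: Rmult_le_compat_r.
    lra.
  have L0 := lam_ge0 d.
  apply: Rle_trans (Rmult_le_compat _ _ _ _ (Cmod_ge_0 _) (Cmod_ge_0 _) T1 T) _.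
  rewrite (_ : _ * _ * (V * _) = lam d * V * (npow (/ V) d * Rpower (INR (X %/ d)) (- / V))); last ring.
  rewrite (_ : 2 * V * R0X * _ = lam d * V * (2 * R0X * / INR d)); last ring.
  by apply: Rmult_le_compat_l => //; apply: Rmult_le_pos; lra.
rewrite -rsum_mull; apply: Rmult_le_compat_l.
  by apply: Rmult_le_pos; lra.
have := H (fun n => / INR n) 0%N X.
rewrite INR0 => {}H; apply: Rle_trans (H _ _ HX) _.
- by case=> [|n]; [rewrite INR0 Rinv_0; lra|left; apply: Rinv_0_lt_compat; exact: INR_lt0].
- by move=> n Hn; apply: Rinv_le_contravar; [exact: INR_lt0|apply: INR_leq].
rewrite Rmult_0_r Rmult_0_l Rplus_0_r.
apply: Rle_trans (_ : \rsum_(1 <= n < X.+1) ((2 * ln (INR X) + K0) * / INR n) <= _).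
  apply: rsum_le => n /andP[Hn HnX] _; apply: Rmult_le_compat_r.
    by left; apply/Rinv_0_lt_compat/INR_lt0.
  have : ln (INR n) <= ln (INR X) by apply: ln_mono; [exact: INR_lt0|apply: INR_leq; lia].
  lra.
rewrite -rsum_mull; apply: Rmult_le_compat_l; first lra.
exact: harmonic_le.
Qed.

Lemma cube_exp_small Y : 1 <= Y -> Y ^ 3 * exp (- Y) <= 256 / Y.
Proof.
move=> HY; have H := exp_ineq1_le (Y / 4).
have E : exp (- Y) = / (exp (Y / 4)) ^ 4.
  rewrite exp_Ropp; congr Rinv.
  by rewrite [in LHS](_ : Y = Y / 4 + Y / 4 + Y / 4 + Y / 4) ?exp_plus; [ring|field].
have P : (Y / 4) ^ 4 <= exp (Y / 4) ^ 4 by apply: pow_incr; lra.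
have P0 : 0 < (Y / 4) ^ 4 by apply: pow_lt; lra.
rewrite E; apply: Rle_trans (_ : Y ^ 3 * / (Y / 4) ^ 4 <= _).
  by apply: Rmult_le_compat_l; [apply: pow_le; lra|exact: Rinv_le_contravar].
by right; field; lra.
Qed.

(* The truncation error [X^(-1/V) (ln X)^2] must beat the number [K], of order [ln X / d],
   of grid points. *)
Lemma choose_cutoff V d C0 b : 1 <= V -> 0 < d -> 0 < C0 -> INR b <= exp V ->
  exists X K, (b <= X)%N /\ (0 < X)%N /\ (0 < K)%N /\ ln (INR X) <= 1 / 20 * (INR K * d) /\
  2 * V * Rpower (INR X) (- / V) * ((2 * ln (INR X) + C0) * (1 + ln (INR X))) * (2 * INR K) <= 1.
Proof.
move=> HV Hd HC0 Hb; pose q := 20 * V / d + 1.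
have Hq : 1 <= q by have : 0 < 20 * V / d by [apply: Rdiv_lt_0_compat; lra]; rewrite /q; lra.
(* With [Y = L / V] the quantity to bound is at most [Q Y^3 exp (- Y) <= 256 Q / Y]; [W] is chosen
   so that [Y >= 256 Q + 1]. *)
pose Q := 2 * V * (2 * V + C0) * (1 + V) * 2 * q.
have HQ : 0 < Q by rewrite /Q; repeat apply: Rmult_lt_0_compat; lra.
pose W := V * (256 * Q + 1).
have HWV : V <= W by rewrite /W; nra.
have [F1 F2] := @nfloor_spec (exp W) (Rlt_le _ _ (exp_pos _)).
pose X := (nfloor (exp W)).+1.
have HX : exp W <= INR X by rewrite S_INR; lra.
have HXp : (0 < X)%N by [].
have HL : W <= ln (INR X) by rewrite -(ln_exp W); apply: ln_mono => //; exact: exp_pos.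
set L := ln (INR X) in HL.
pose K := (nfloor (20 * L / d)).+1.
have HL20 : 0 <= 20 * L / d by apply: Rmult_le_pos; [lra|left; exact: Rinv_0_lt_compat].
have [K1 K2] := @nfloor_spec (20 * L / d) HL20.
have HK : 20 * L / d <= INR K <= 20 * L / d + 1 by rewrite S_INR; lra.
exists X, K; split.
  apply: leq_of_INR; apply: Rle_trans Hb _; apply: Rle_trans HX; exact: exp_mono.
do 2 (split => //); split.
  rewrite -/L; have := Rmult_le_compat_r d _ _ ltac:(lra) (proj1 HK).
  by rewrite (_ : 20 * L / d * d = 20 * L); [lra|field; lra].
pose Y := L / V.
have EL : L = V * Y by rewrite /Y; field; lra.
have HY : 256 * Q + 1 <= Y.
  by apply: (Rmult_le_reg_l V); [lra|rewrite -EL].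
have ER : Rpower (INR X) (- / V) = exp (- Y) by rewrite /Rpower -/L EL; congr exp; field; lra.
rewrite ER -/L EL.
have B1 : 2 * (V * Y) + C0 <= (2 * V + C0) * Y by nra.
have B2 : 1 + V * Y <= (1 + V) * Y by nra.
have B3 : 2 * INR K <= 2 * q * Y.
  have : 20 * L / d = 20 * V / d * Y by rewrite EL; field; lra.
  by move=> E; rewrite E in HK; rewrite /q; lra.
have P := exp_pos (- Y).
have N1 : 0 <= 2 * (V * Y) + C0 by nra.
have N2 : 0 <= 1 + V * Y by nra.
have B12 := Rmult_le_compat _ _ _ _ N1 N2 B1 B2.
have Pa : 0 <= 2 * V * exp (- Y) by nra.
have B123 := Rmult_le_compat_l _ _ _ Pa B12.
have Pb : 0 <= 2 * V * exp (- Y) * ((2 * (V * Y) + C0) * (1 + V * Y)).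
  by apply: Rmult_le_pos => //; apply: Rmult_le_pos.
have N3 : 0 <= 2 * INR K by have := pos_INR K; lra.
have B := Rmult_le_compat _ _ _ _ Pb N3 B123 B3.
apply: Rle_trans B _.
have C3 := Rmult_le_compat_l Q _ _ (Rlt_le _ _ HQ) (@cube_exp_small Y ltac:(lra)).
rewrite (_ : _ * _ = Q * (Y ^ 3 * exp (- Y))); last by rewrite /Q; ring.
apply: Rle_trans C3 _; apply: (Rmult_le_reg_r Y); first lra.
rewrite (_ : Q * (256 / Y) * Y = 256 * Q); last by field; lra.
lra.
Qed.

(** The sum [T] of [F'' B] over all sampled [t] has modulus about [K^2] times the correlation in
    [main_term], whereas [F'' = F G] and Cauchy-Schwarz bound it by the largest sampled [|F|] times
    root mean squares. The samples satisfy [|t| <= 2 PI / d], with [d] of order [h^2]. *)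
Lemma large_dirichlet : exists c0 C0, 0 < c0 /\ 0 < C0 /\ forall f V h,
  completely_multiplicative f -> (forall n, Cmod (f n) <= 1) -> 1 <= V -> 0 < h <= 2 -> C0 <= V * h ^ 2 ->
  h * V <= mean_mass f (nfloor (exp (V / 2))) (nfloor (exp V)) ->
  exists t, Rabs t <= C0 / h ^ 2 /\ c0 * h * V <= Cmod (Dir (twist f t) (/ V)).
Proof.
have [K0 [HK0 HG]] := lam_poly_mean_square; have [K1 [HK1 HE]] := log2_poly_factor.
(* [c0] makes the upper bound for [T] equal to [K^2 (h V^3 / 128 + 1)]; [C0] is such that
   [d = 8 h^2 / C0], whence [2 PI / d <= C0 / h^2]. *)
pose c0 := / (64 * (K0 + 8)); pose C0 := 8 * 20736 * 2433024.
have Hc0 : 0 < c0 by apply: Rinv_0_lt_compat; lra.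
have HC0 : 0 < C0 by rewrite /C0; lra.
exists c0, C0; split => //; split => // f V h Hf Hf1 HV Hh HVh HM.
have HV0 : 0 < V by lra.
(* With [6912 = 3 * 2304], the constants [20736 = 3 * 6912] and [2433024 = 352 * 6912] make two of
   the three smoothing errors equal to [h / 6912]. *)
pose r := h / 20736; pose d := r * h / 2433024.
have Hr : 0 < r <= 1 by rewrite /r; lra.
have Hdr : d / r = h / 2433024 by rewrite /d; field; lra.
have Hd : 0 < d <= r by rewrite /d; split; [apply: Rdiv_lt_0_compat; nra|nra].
have Ed : d = 8 * h ^ 2 / C0 by rewrite /d /r /C0; field.
have HdV : 1 <= d * V.
  rewrite Ed (_ : _ * V = 8 * ((V * h ^ 2) / C0)); last by field; lra.
  have : 1 <= V * h ^ 2 / C0.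
    by apply: (Rmult_le_reg_r C0) => //; rewrite /Rdiv Rmult_assoc Rinv_l; lra.
  lra.
(* [82944 = 12 * 6912] is what the third smoothing error [6 / INR a.+1 <= h / 6912] requires, given
   [INR a.+1 >= V / 2]. *)
have HhV : 82944 <= h * V by rewrite /C0 in HVh; nra.
set a := nfloor (exp (V / 2)) in HM *; set b := nfloor (exp V) in HM *.
have [A1 A2] := @nfloor_spec (exp (V / 2)) (Rlt_le _ _ (exp_pos _)); rewrite -/a in A1 A2.
have [B1 B2] := @nfloor_spec (exp V) (Rlt_le _ _ (exp_pos _)); rewrite -/b in B1 B2.
have Hab m : (a < m <= b)%N -> V / 2 <= ln (INR m) <= V.
  move=> /andP[Ham Hmb]; have Hm0 : 0 < INR m by apply: INR_lt0; lia.
  have Ham' : INR a.+1 <= INR m by apply: INR_leq.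
  have Hmb' := INR_leq Hmb; rewrite S_INR in Ham'.
  split; [rewrite -(ln_exp (V / 2))|rewrite -(ln_exp V)]; apply: ln_mono => //; try exact: exp_pos; lra.
have Hlnb : ln (INR b) <= V by apply: ln_nfloor_exp; lra.
have [X [K [HbX [HX [HK [HXK HEK]]]]]] := @choose_cutoff V d K1 b HV (proj1 Hd) HK1 B1.
have HKr := INR_lt0 HK; have HK1r := INR_ge1 HK.
have HP : 0 < INR K * d by apply: Rmult_lt_0_compat; lra.
have [th [Hth HMain]] := main_term Hf1 HV HbX Hab.
set E := 2 * V * Rpower (INR X) (- / V) * ((2 * ln (INR X) + K1) * (1 + ln (INR X))) in HEK.
have HE0 : 0 <= E.
  have := ln_INR_ge0 HX => HL; rewrite /E; apply: Rmult_le_pos; last by apply: Rmult_le_pos; lra.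
  by apply: Rmult_le_pos; [lra|left; exact: exp_pos].
apply: NNPP => Hno.
have Hsmall t : Rabs t <= C0 / h ^ 2 -> Cmod (Dir (twist f t) (/ V)) <= c0 * h * V.
  by move=> Ht; left; apply: Rnot_le_lt => Hle; apply: Hno; exists t.
pose tt k l := (INR k - INR l) * grid_freq K d.
have Htt k l : (k < K)%N -> (l < K)%N -> Rabs (tt k l) <= C0 / h ^ 2.
  move=> Hk Hl; have Hpi := PI_RGT_0; have Hpi4 := PI_4.
  have Hk' : INR k <= INR K by apply: INR_leq; lia.
  have Hl' : INR l <= INR K by apply: INR_leq; lia.
  have P1 := pos_INR k; have P2 := pos_INR l.
  rewrite Rabs_mult; have Hg : 0 < grid_freq K d by apply: Rdiv_lt_0_compat; lra.
  rewrite (Rabs_pos_eq (grid_freq K d)); last lra.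
  apply: Rle_trans (_ : INR K * grid_freq K d <= _).
    by apply: Rmult_le_compat_r; [lra|apply: Rabs_le; lra].
  rewrite (_ : INR K * grid_freq K d = 2 * PI / d); last by rewrite /grid_freq; field; lra.
  rewrite (_ : C0 / h ^ 2 = 8 / d); last by rewrite Ed; field; lra.
  by apply: Rmult_le_compat_r; [left; apply: Rinv_0_lt_compat|]; lra.
pose ph := phi th a b.
pose B k l := \csum_(0 <= j < K) (ph (grid_pt K d j) * cis (tt k l * grid_pt K d j)).
pose G k l := lam_poly f V X (tt k l).
have SG : \rsum_(0 <= k < K) \rsum_(0 <= l < K) (Cmod (G k l) ^ 2) <= K0 * INR K ^ 2 * d * V ^ 3.
  by apply: HG => //; lra.
have SB : \rsum_(0 <= k < K) \rsum_(0 <= l < K) (Cmod (B k l) ^ 2) <= INR K ^ 2 * (4 * (V / d + 1)).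
  apply: Rle_trans (grid_mean_square _ HK (proj1 Hd)) _.
  apply: Rmult_le_compat_l; first exact: pow2_ge_0.
  by apply: phi_grid_sq => //; lra.
have BB k l : Cmod (B k l) <= 2 * INR K.
  apply: Rle_trans (Cmod_csum _ _ _) _.
  apply: Rle_trans (_ : \rsum_(0 <= j < K) 2 <= _).
    by apply: rsum_le => j _ _; rewrite Cmod_mult Cmod_cis Rmult_1_r; exact: phi_bound.
  by rewrite rsum_const subn0; lra.
pose T := \csum_(0 <= k < K) \csum_(0 <= l < K) (log2_poly f V X (tt k l) * B k l).
have KK : 0 < INR K ^ 2 by apply: pow_lt.
have Upper : Cmod T <= c0 * h * V * (INR K ^ 2 * V ^ 2 * ((K0 + 8) / 2)) + INR K ^ 2.
  (* Cauchy-Schwarz is applied termwise as a weighted mean inequality; this weight makes the mean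
     squares of [G] (order [d V^3]) and [B] (order [V / d]) contribute [V^2] each. *)
  pose kap := / (d * V).
  have Hkap : 0 < kap by apply: Rinv_0_lt_compat; lra.
  have M0 : 0 <= c0 * h * V by apply: Rmult_le_pos; [apply: Rmult_le_pos|]; lra.
  apply: Rle_trans (_ : \rsum_(0 <= k < K) \rsum_(0 <= l < K)
     (c0 * h * V * (kap / 2 * Cmod (G k l) ^ 2) + c0 * h * V * (/ (2 * kap) * Cmod (B k l) ^ 2) + 1) <= _).
    apply: Rle_trans (Cmod_csum _ _ _) _; apply: rsum_le => k Hk _.
    apply: Rle_trans (Cmod_csum _ _ _) _; apply: rsum_le => l Hl _.
    have D := HE f V X (tt k l) Hf Hf1 HV HX; rewrite -/E in D.
    have S1 := Hsmall _ (Htt k l ltac:(lia) ltac:(lia)).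
    have T1 := Cmod_triangle (log2_poly f V X (tt k l) - Dir (twist f (tt k l)) (/ V) * lam_poly f V X (tt k l))%C
       (Dir (twist f (tt k l)) (/ V) * lam_poly f V X (tt k l))%C.
    rewrite (_ : (_ - _ + _)%C = log2_poly f V X (tt k l)) in T1; last ring.
    rewrite Cmod_mult -/(G k l) in T1 D.
    have S2 := Rmult_le_compat_r _ _ _ (Cmod_ge_0 (G k l)) S1.
    rewrite Cmod_mult.
    have T2 : Cmod (log2_poly f V X (tt k l)) <= E + c0 * h * V * Cmod (G k l) by lra.
    apply: Rle_trans (Rmult_le_compat_r _ _ _ (Cmod_ge_0 (B k l)) T2) _.
    have E1 : E * Cmod (B k l) <= 1.
      by apply: Rle_trans (Rmult_le_compat_l _ _ _ HE0 (BB k l)) _.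
    have AG : Cmod (G k l) * Cmod (B k l) <= kap / 2 * Cmod (G k l) ^ 2 + / (2 * kap) * Cmod (B k l) ^ 2.
      have := pow2_ge_0 (kap * Cmod (G k l) - Cmod (B k l)) => SQ.
      apply: (Rmult_le_reg_l (2 * kap)); first lra.
      rewrite (_ : 2 * kap * (kap / 2 * _ + _) = kap ^ 2 * Cmod (G k l) ^ 2 + Cmod (B k l) ^ 2); last by field; lra.
      lra.
    have := Rmult_le_compat_l _ _ _ M0 AG; lra.
  have -> : \rsum_(0 <= k < K) \rsum_(0 <= l < K)
     (c0 * h * V * (kap / 2 * Cmod (G k l) ^ 2) + c0 * h * V * (/ (2 * kap) * Cmod (B k l) ^ 2) + 1) =
     c0 * h * V * (kap / 2 * \rsum_(0 <= k < K) \rsum_(0 <= l < K) (Cmod (G k l) ^ 2)) +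
     c0 * h * V * (/ (2 * kap) * \rsum_(0 <= k < K) \rsum_(0 <= l < K) (Cmod (B k l) ^ 2)) + INR K ^ 2.
    transitivity (\rsum_(0 <= k < K) (c0 * h * V * (kap / 2 * \rsum_(0 <= l < K) (Cmod (G k l) ^ 2)) +
       c0 * h * V * (/ (2 * kap) * \rsum_(0 <= l < K) (Cmod (B k l) ^ 2)) + INR K)).
      by apply: eq_bigr => k _; rewrite !rsumD -!rsum_mull rsum_const subn0 Rmult_1_r.
    by rewrite !rsumD -!rsum_mull rsum_const subn0 /= Rmult_1_r.
  have G1 := Rmult_le_compat_l (kap / 2) _ _ ltac:(lra) SG.
  have G2 := Rmult_le_compat_l (/ (2 * kap)) _ _ ltac:(left; apply: Rinv_0_lt_compat; lra) SB.
  have F1 : kap / 2 * (K0 * INR K ^ 2 * d * V ^ 3) = INR K ^ 2 * (K0 * V ^ 2 / 2) by rewrite /kap; field; lra.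
  have F2 : / (2 * kap) * (INR K ^ 2 * (4 * (V / d + 1))) = INR K ^ 2 * (2 * V ^ 2 + 2 * (d * V)) by rewrite /kap; field; lra.
  rewrite F1 in G1; rewrite F2 in G2.
  have F3 : INR K ^ 2 * (2 * V ^ 2 + 2 * (d * V)) <= INR K ^ 2 * (4 * V ^ 2).
    by apply: Rmult_le_compat_l; [lra|nra].
  have := Rmult_le_compat_l _ _ _ M0 (Rplus_le_compat _ _ _ _ G1 (Rle_trans _ _ _ G2 F3)).
  lra.
pose al n := (RtoC (ln (INR n) ^ 2 * npow (/ V) n) * f n)%C.
have Hal n : Cmod (al n) <= ln (INR n) ^ 2 * npow (/ V) n.
  have P0 : 0 <= ln (INR n) ^ 2 * npow (/ V) n by apply: Rmult_le_pos; [exact: pow2_ge_0|left; exact: npow_gt0].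
  rewrite Cmod_mult Cmod_R Rabs_pos_eq //.
  by have := Rmult_le_compat_l _ _ _ P0 (Hf1 n); rewrite Rmult_1_r.
set e := 3 * r + 6 / INR a.+1 + 352 * (d / r).
have He : e <= h / 2304.
  have Ha : V / 2 <= INR a.+1 by rewrite S_INR; have := exp_ineq1_le (V / 2); lra.
  have : 6 / INR a.+1 <= h / 6912.
    apply: (Rmult_le_reg_r (INR a.+1)); first lra.
    rewrite (_ : 6 / INR a.+1 * INR a.+1 = 6); last by field; lra.
    have := Rmult_le_compat_l (h / 6912) _ _ ltac:(lra) Ha; lra.
  by rewrite /e Hdr /r; lra.
have Lower : INR K ^ 2 * (V ^ 2 / 12 * (h * V) - 4 * V ^ 2 - h / 2304 * (48 * V ^ 3)) <= Cmod T.
  (* By [grid_sum] the kernel has total mass [K^2] around every [ln n], so [phi] on the grid may be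
     exchanged for [phi (ln n)] up to the error [Er]. *)
  have ET : T = (RtoC (INR K ^ 2) * \csum_(1 <= n < X.+1) (al n * ph (ln (INR n))) +
     \csum_(1 <= n < X.+1) \csum_(0 <= j < K) (al n * (ph (grid_pt K d j) - ph (ln (INR n))) *
        RtoC (ker K (grid_freq K d * (ln (INR n) - grid_pt K d j)))))%C.
    rewrite /T /B /tt /log2_poly (bilinear_ker K (grid_freq K d) al (fun j => ph (grid_pt K d j)) (fun n => ln (INR n)) (grid_pt K d)).
    rewrite csum_mull -csumD; apply: eq_bigr => n _.
    rewrite -(@grid_sum K d (ln (INR n)) HK (proj1 Hd)) RtoC_rsum csum_mulr -csumD.
    by apply: eq_bigr => j _; ring.
  set Er := \csum_(1 <= n < X.+1) \csum_(0 <= j < K) (al n * (ph (grid_pt K d j) - ph (ln (INR n))) *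
        RtoC (ker K (grid_freq K d * (ln (INR n) - grid_pt K d j)))) in ET.
  have HEr : Cmod Er <= INR K ^ 2 * (h / 2304 * (48 * V ^ 3)).
    apply: Rle_trans (Cmod_csum _ _ _) _.
    apply: Rle_trans (_ : \rsum_(1 <= n < X.+1) (INR K ^ 2 * (h / 2304) * (ln (INR n) ^ 2 * npow (/ V) n)) <= _); last first.
      rewrite -rsum_mull Rmult_assoc; apply: Rmult_le_compat_l; first lra.
      by apply: Rmult_le_compat_l; [lra|exact: ln2_npow_total].
    apply: rsum_le => n /andP[Hn HnX] _; apply: Rle_trans (Cmod_csum _ _ _) _.
    have Hx : Rabs (ln (INR n)) <= 1 / 20 * (INR K * d).
      rewrite Rabs_pos_eq; last exact: ln_INR_ge0.
      by apply: Rle_trans HXK; apply: ln_mono; [exact: INR_lt0|apply: INR_leq; lia].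
    have S := @phi_smoothing th a b K d (ln (INR n)) r Hth HK Hd (proj2 Hr) Hx.
    rewrite -/e in S.
    have S2 : INR K ^ 2 * e <= INR K ^ 2 * (h / 2304) by apply: Rmult_le_compat_l; lra.
    have := Rmult_le_compat _ _ _ _ (Cmod_ge_0 (al n)) _ (Hal n) (Rle_trans _ _ _ S S2).
    move=> H; rewrite Rmult_comm; apply: Rle_trans (H _).
      rewrite rsum_mull; apply: rsum_le => j _ _; rewrite (Cmod_mult _ (RtoC _)) (Cmod_mult (al n)) (Cmod_R (ker _ _)) Rabs_pos_eq; last exact: ker_ge0.
      by rewrite Rmult_assoc; exact: Rle_refl.
    by apply: rsum_ge0 => j _; apply: Rmult_le_pos; [exact: Cmod_ge_0|exact: ker_ge0].
  have HA : INR K ^ 2 * (V ^ 2 / 12 * (h * V) - 4 * V ^ 2) <=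
     Cmod (RtoC (INR K ^ 2) * \csum_(1 <= n < X.+1) (al n * ph (ln (INR n)))).
    rewrite Cmod_mult Cmod_R Rabs_pos_eq; last lra.
    apply: Rmult_le_compat_l; first lra.
    apply: Rle_trans HMain; apply: Rplus_le_compat_r.
    by apply: Rmult_le_compat_l => //; have := pow2_ge_0 V; lra.
  have := Cmod_triangle T (- Er)%C; rewrite Cmod_opp {1}ET (_ : (_ + _ + - Er)%C =
    (RtoC (INR K ^ 2) * \csum_(1 <= n < X.+1) (al n * ph (ln (INR n))))%C); last ring.
  lra.
have Fin := Rle_trans _ _ _ Lower Upper.
have Ec : c0 * h * V * (INR K ^ 2 * V ^ 2 * ((K0 + 8) / 2)) = INR K ^ 2 * (h * V ^ 3 / 128).
  by rewrite /c0; field; lra.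
rewrite Ec in Fin.
have Fin2 : V ^ 2 / 12 * (h * V) - 4 * V ^ 2 - h / 2304 * (48 * V ^ 3) <= h * V ^ 3 / 128 + 1.
  by apply: (Rmult_le_reg_l (INR K ^ 2)) => //; lra.
have V2 : 1 <= V ^ 2 by nra.
have := Rmult_le_compat_r (V ^ 2) _ _ ltac:(lra) HhV.
lra.
Qed.

(** Applies [large_dirichlet] with [h = eta / 64 * sqrt (L / V)]. Then [V h^2 = eta^2 L / 4096] does
    not depend on [V], and [V <= L] gives [h^2 >= eta^2 / 4096], which bounds [t] by [eta] alone. *)
Lemma mean_value_twist : exists c1 C1 K, 0 < c1 /\ 0 < C1 /\ 0 < K /\ forall f N eta,
  completely_multiplicative f -> (forall n, Cmod (f n) <= 1) -> (0 < N)%N -> 0 < eta <= 1 ->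
  eta * INR N <= Cmod (csum f N) -> K <= eta ^ 2 * ln (INR N) ->
  exists V t, 1 <= V <= ln (INR N) /\ Rabs t <= C1 / eta ^ 2 /\
    c1 * eta ^ 2 * ln (INR N) * V <= Cmod (Dir (twist f t) (/ V)) ^ 2.
Proof.
have [K1 [HK1 H1]] := mean_lower; have [c0 [C0 [Hc0 [HC0 H2]]]] := large_dirichlet.
(* In the threshold, [K1] serves [mean_lower], 64 gives [32 < eta L] and [V >= 1], and [4096 C0]
   gives [C0 <= V h^2]. *)
exists (c0 ^ 2 / 4096), (4096 * C0), (K1 + 64 + 4096 * C0).
split; first by apply: Rdiv_lt_0_compat; [apply: pow_lt|lra].
do 2 (split; first lra).
move=> f N eta Hf Hf1 HN He HS; set L := ln (INR N) => HK.
have HL0 : 0 <= L by exact: ln_INR_ge0.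
have HeL : eta ^ 2 * L <= eta * L by apply: Rmult_le_compat_r; nra.
have HeL1 : eta * L <= L by nra.
have M := H1 f N eta Hf Hf1 HN (proj2 He) HS ltac:(rewrite -/L; lra).
have EN : N = nfloor (exp L).
  by rewrite /L exp_ln; [rewrite (@nfloor_unique N) //; lra|exact: INR_lt0].
rewrite -/L [in X in _ <= X]EN in M.
have [V [HV HB]] := @dyadic_block f L eta Hf1 He ltac:(lra) M.
have HV1 : 1 <= V by lra.
set s := sqrt (L * V) in HB.
have Es : s * s = L * V by apply: sqrt_sqrt; nra.
have Hs : 0 < s by apply: sqrt_lt_R0; nra.
pose h := eta / 64 * s / V.
have EhV : h * V = eta / 64 * s by rewrite /h; field; lra.
have EVh : V * h ^ 2 = eta ^ 2 * L / 4096.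
  rewrite (_ : V * h ^ 2 = (h * V) * (h * V) / V); last by field; lra.
  have -> : h * V * (h * V) = eta ^ 2 / 4096 * (s * s) by rewrite EhV; field.
  by rewrite Es; field; lra.
have Hh0 : 0 < h by rewrite /h; apply: Rdiv_lt_0_compat; [apply: Rmult_lt_0_compat; lra|lra].
have Hh2 : h <= 2.
  apply: (Rmult_le_reg_r V); first lra.
  rewrite EhV; apply: Rle_trans HB _.
  apply: Rle_trans (_ : mean_mass f 0 (nfloor (exp V)) <= _); last by have := @mean_mass_exp_le f V Hf1; lra.
  have Hab : (nfloor (exp (V / 2)) <= nfloor (exp V))%N.
    by apply: nfloor_mono; [left; exact: exp_pos|apply: exp_mono; lra].
  rewrite (mean_mass_cat f Hab).
  suff : 0 <= mean_mass f 0 (nfloor (exp (V / 2))) by lra.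
  by apply: rsum_ge0 => m _; apply: Rmult_le_pos; [exact: Cmod_ge_0|exact: inv_sq_ge0].
have [t [Ht HD]] := H2 f V h Hf Hf1 HV1 (conj Hh0 Hh2) ltac:(rewrite EVh; lra) ltac:(rewrite EhV; exact: HB).
exists V, t; split; first lra.
have E2 : 0 < eta ^ 2 by apply: pow_lt; lra.
split.
  apply: Rle_trans Ht _; rewrite /Rdiv (_ : 4096 * C0 * / eta ^ 2 = C0 * (4096 * / eta ^ 2)); last ring.
  apply: Rmult_le_compat_l; first lra.
  have Hh2p : 0 < h ^ 2 by apply: pow_lt.
  rewrite (_ : 4096 * / eta ^ 2 = / (eta ^ 2 / 4096)); last by field; lra.
  apply: Rinv_le_contravar; first lra.
  apply: (Rmult_le_reg_l V); first lra.
  rewrite EVh; have : eta ^ 2 / 4096 * V <= eta ^ 2 / 4096 * L by apply: Rmult_le_compat_l; lra.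
  lra.
have -> : c0 ^ 2 / 4096 * eta ^ 2 * L * V = (c0 * h * V) ^ 2.
  rewrite (_ : (c0 * h * V) ^ 2 = c0 ^ 2 * V * (V * h ^ 2)); last ring.
  by rewrite EVh; field.
apply: pow_incr; split => //.
by apply: Rmult_le_pos; [apply: Rmult_le_pos|]; lra.
Qed.

(** * Conclusion *)

Lemma Rabs_sin_le x : Rabs (sin x) <= Rabs x.
Proof.
have P y : 0 < y -> Rabs (sin y) <= y.
  move=> Hy; have H1 := sin_lt_x y Hy; apply: Rabs_le; split; last lra.
  case: (Rle_dec 1 y) => H; first by have := SIN_bound y; lra.
  have : 0 <= sin y by apply: sin_ge_0; have := PI2_3_2; lra.
  lra.
case: (Rtotal_order x 0) => [H|[->|H]].
- rewrite (Rabs_left x) // -(Ropp_involutive x) sin_neg Rabs_Ropp Ropp_involutive.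
  by apply: P; lra.
- by rewrite sin_0; lra.
- by rewrite (Rabs_pos_eq x); [exact: P|lra].
Qed.

Lemma cis_lip x y : Cmod (cis x - cis y) <= Rabs (x - y).
Proof.
have -> : (cis x - cis y = - cis x * (- (1)) * (1 - cis (y - x)))%C.
  have -> : cis y = (cis x * cis (y - x))%C by rewrite -cisD; congr cis; ring.
  by ring.
rewrite !Cmod_mult !Cmod_opp Cmod_1 Cmod_cis Cmod_1sub_cis.
have := Rabs_sin_le ((y - x) / 2).
rewrite Rabs_div; last lra.
rewrite (Rabs_minus_sym y x) (Rabs_pos_eq 2); lra.
Qed.

Lemma npow_diff a n : 0 < a -> (0 < n)%N ->
  0 <= npow a n - npow a n.+1 <= (1 + a) * npow a n * / INR n.
Proof.
move=> Ha Hn; have [L1 L2] := ln_step Hn.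
have P := npow_gt0 a n.
have E : npow a n.+1 = npow a n * exp (- ((1 + a) * (ln (INR n.+1) - ln (INR n)))).
  by rewrite /npow /Rpower -exp_plus; congr exp; ring.
have D0 : 0 <= ln (INR n.+1) - ln (INR n).
  by have : 0 < / INR n.+1 by [apply/Rinv_0_lt_compat/INR_lt0]; lra.
have X := exp_ineq1_le (- ((1 + a) * (ln (INR n.+1) - ln (INR n)))).
have X2 : exp (- ((1 + a) * (ln (INR n.+1) - ln (INR n)))) <= 1.
  apply: Rle_trans (_ : exp 0 <= _); last by rewrite exp_0; lra.
  by apply: exp_mono; have := Rmult_le_pos (1 + a) _ ltac:(lra) D0; lra.
have X3 : (1 + a) * (ln (INR n.+1) - ln (INR n)) <= (1 + a) * / INR n by apply: Rmult_le_compat_l; lra.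
rewrite E; split; first by nra.
have := Rmult_le_compat_l (npow a n) _ _ (Rlt_le _ _ P) (Rle_trans _ _ _ (Rplus_le_compat_l 1 _ _ (Ropp_le_contravar _ _ X3)) X).
lra.
Qed.

Lemma csum_abel (f q : nat -> C) X :
  \csum_(1 <= n < X.+2) (f n * q n) =
  (csum f X.+1 * q X.+1 + \csum_(1 <= n < X.+1) (csum f n * (q n - q n.+1)))%C.
Proof.
elim: X => [|X IH].
  by rewrite big_nat1 big_geq //= Cplus_0_l Cplus_0_r.
rewrite big_nat_recr // IH [in RHS]big_nat_recr //=; ring.
Qed.

(** Partial summation: the weights change by at most [(2 + |t|) npow n / n]. Up to [Y] the partial
    sums are bounded trivially, giving [1 + ln Y]; beyond [Y] the hypothesis gives [xi (1 + V)]. *)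
Lemma Dir_upper_twist f t V Y xi : (forall n, Cmod (f n) <= 1) -> 1 <= V -> 1 <= Y -> 0 <= xi ->
  (forall n, (0 < n)%N -> Y <= INR n -> Cmod (csum f n) <= xi * INR n) ->
  Cmod (Dir (twist f t) (/ V)) <= (2 + Rabs t) * (1 + ln Y + xi * (1 + V)).
Proof.
move=> Hf HV HY Hxi HS; have HV0 : 0 < V by lra.
have Hi := Rinv_0_lt_compat _ HV0.
have Hi1 : / V <= 1 by rewrite -Rinv_1; apply: Rinv_le_contravar; lra.
set a := / V in Hi Hi1 *.
have Ht := Rabs_pos t.
apply: Rnot_lt_le => Hlt.
set B := (2 + Rabs t) * _ in Hlt.
(* The boundary term of the partial summation is at most [N^(- a)] and the tail of the series at
   most [V N^(- a)], hence the divisor [1 + V]. *)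
have [N [HN1 HN]] := @Rpower_INR_small a ((Cmod (Dir (twist f t) a) - B) / (1 + V)) Hi
  ltac:(apply: Rdiv_lt_0_compat; lra).
pose q n := (cis (- (t * ln (INR n))) * RtoC (npow a n))%C.
have Hq n : (0 < n)%N -> Cmod (q n - q n.+1) <= (2 + Rabs t) * npow a n * / INR n.
  move=> Hn; have [D1 D2] := npow_diff Hi Hn; have P := npow_gt0 a n; have [L1 L2] := ln_step Hn.
  have -> : (q n - q n.+1 = cis (- (t * ln (INR n.+1))) * RtoC (npow a n - npow a n.+1) +
     (cis (- (t * ln (INR n))) - cis (- (t * ln (INR n.+1)))) * RtoC (npow a n))%C.
    by rewrite /q RtoC_minus; ring.
  apply: Rle_trans (Cmod_triangle _ _) _; rewrite !Cmod_mult Cmod_cis !Cmod_R Rmult_1_l.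
  rewrite (Rabs_pos_eq (npow a n - _)) // (Rabs_pos_eq (npow a n)); last lra.
  have Cl := cis_lip (- (t * ln (INR n))) (- (t * ln (INR n.+1))).
  rewrite (_ : - _ - - _ = t * (ln (INR n.+1) - ln (INR n))) in Cl; last ring.
  rewrite Rabs_mult (Rabs_pos_eq (ln (INR n.+1) - _)) in Cl; last first.
    by have : 0 < / INR n.+1 by [apply/Rinv_0_lt_compat/INR_lt0]; lra.
  have C2 := Rmult_le_compat_l _ _ _ Ht L2.
  have C3 := Rmult_le_compat_r _ _ _ (Rlt_le _ _ P) (Rle_trans _ _ _ Cl C2).
  have HIn : 0 < / INR n by apply/Rinv_0_lt_compat/INR_lt0.
  have : (1 + a) * npow a n * / INR n <= 2 * npow a n * / INR n.
    by apply: Rmult_le_compat_r; [lra|apply: Rmult_le_compat_r; lra].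
  lra.
have [X EX] : exists X, N = X.+1 by exists N.-1; lia.
have T := @Dir_tail (twist f t) a N (fun n => twist_bound t n Hf) Hi HN1.
have ED : dser (twist f t) a N = (csum f N * q N + \csum_(1 <= n < N) (csum f n * (q n - q n.+1)))%C.
  rewrite EX -csum_abel; apply: eq_bigr => n _; rewrite /q /twist; ring.
have HNr := INR_ge1 HN1.
have Hb : Cmod (csum f N * q N) <= Rpower (INR N) (- a).
  rewrite !Cmod_mult Cmod_cis Rmult_1_l Cmod_R Rabs_pos_eq; last by left; exact: npow_gt0.
  apply: Rle_trans (_ : INR N * npow a N <= _).
    by apply: Rmult_le_compat_r; [left; exact: npow_gt0|exact: csum_bound].
  by rewrite npowE //; right; field; lra.
have Hsum : Cmod (\csum_(1 <= n < N) (csum f n * (q n - q n.+1))) <= B.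
  apply: Rle_trans (Cmod_csum _ _ _) _.
  apply: Rle_trans (_ : \rsum_(1 <= n < N) ((2 + Rabs t) * ((if rleb (INR n) Y then / INR n else 0) + xi * npow a n)) <= _).
    apply: rsum_le => n /andP[Hn HnN] _; have Hn' := INR_ge1 Hn; have P := npow_gt0 a n.
    have HIn : 0 < / INR n by apply/Rinv_0_lt_compat/INR_lt0.
    rewrite Cmod_mult.
    have E1 : Cmod (csum f n) * Cmod (q n - q n.+1) <= (2 + Rabs t) * (Cmod (csum f n) * (npow a n * / INR n)).
      apply: Rle_trans (Rmult_le_compat_l _ _ _ (Cmod_ge_0 _) (Hq n Hn)) _.
      by right; ring.
    apply: Rle_trans E1 _; apply: Rmult_le_compat_l; first lra.
    have Hw : npow a n * / INR n * INR n = npow a n by field; lra.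
    have W0 : 0 <= npow a n * / INR n by apply: Rmult_le_pos; lra.
    have xin : 0 <= xi * npow a n by apply: Rmult_le_pos; lra.
    case: (rlebP (INR n) Y) => HnY.
      have := Rmult_le_compat_r _ _ _ W0 (csum_bound n Hf).
      have : npow a n <= / INR n.
        rewrite npowE // -[in X in _ <= X](Rmult_1_l (/ INR n)); apply: Rmult_le_compat_r; first lra.
        by rewrite -exp_0; apply: exp_mono; have := ln_ge0 Hn'; nra.
      lra.
    have := Rmult_le_compat_r _ _ _ W0 (HS n Hn ltac:(lra)).
    have -> : xi * INR n * (npow a n * / INR n) = xi * (npow a n * / INR n * INR n) by ring.
    rewrite Hw; lra.
  rewrite -rsum_mull rsumD -rsum_mull -big_mkcond; apply: Rmult_le_compat_l; first lra.
  apply: Rplus_le_compat.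
    have [F1 F2] := @nfloor_spec Y ltac:(lra).
    have HFY : (0 < nfloor Y)%N by case: (nfloor Y) F2 => //; rewrite INR0; lra.
    apply: Rle_trans (_ : \rsum_(1 <= n < (nfloor Y).+1) / INR n <= _).
      apply: rsum_subrange => [n|n /andP[Hn _] /rlebP H].
        by case: n => [|n]; [rewrite INR0 Rinv_0; lra|left; apply: Rinv_0_lt_compat; exact: INR_lt0].
      by rewrite Hn /=; apply/ltP; apply: INR_lt; rewrite S_INR; lra.
    apply: Rle_trans (harmonic_le HFY) _.
    by have : ln (INR (nfloor Y)) <= ln Y by [apply: ln_mono => //; exact: INR_lt0]; lra.
  apply: Rmult_le_compat_l => //.
  by rewrite EX; exact: npow_total.
have := Cmod_triangle (dser (twist f t) a N) (- (dser (twist f t) a N - Dir (twist f t) a))%C.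
rewrite Cmod_opp (_ : (_ + - _)%C = Dir (twist f t) a); last ring.
have := Cmod_triangle (csum f N * q N)%C (\csum_(1 <= n < N) (csum f n * (q n - q n.+1)))%C.
rewrite -ED => T2 T1.
have HNN := HN N (leqnn N).
have := Rmult_lt_compat_l (1 + V) _ _ ltac:(lra) HNN.
rewrite (_ : (1 + V) * (_ / _) = Cmod (Dir (twist f t) a) - B); last by field; lra.
rewrite /a Rinv_inv -/a in T; lra.
Qed.

Lemma Dir_ext g g' a : (forall n, g n = g' n) -> Dir g a = Dir g' a.
Proof.
move=> E; have ED X : dser g a X = dser g' a X by apply: eq_bigr => n _; rewrite E.
by rewrite /Dir; congr pair; congr real; apply: Lim_seq_ext => X; rewrite ED.
Qed.

Lemma twist_mul f1 f2 t1 t2 n :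
  (twist f1 t1 n * twist f2 t2 n = twist (fun n => f1 n * f2 n) (t1 + t2) n)%C.
Proof.
rewrite /twist (_ : - ((t1 + t2) * ln (INR n)) = - (t1 * ln (INR n)) + - (t2 * ln (INR n))); last ring.
by rewrite cisD; ring.
Qed.

(* The ratio |F(1 + 1/V + it)| / zeta(1 + 1/V) does not decrease when V does. *)
Lemma twist_transfer f t c eta L V V' : completely_multiplicative f -> (forall n, Cmod (f n) <= 1) ->
  1 <= V -> V <= V' -> 0 <= c * eta ^ 2 * L ->
  c * eta ^ 2 * L * V' <= Cmod (Dir (twist f t) (/ V')) ^ 2 ->
  c * eta ^ 2 / 4 * (L / V') * Cmod (Dir cst1 (/ V)) ^ 2 <= Cmod (Dir (twist f t) (/ V)) ^ 2.
Proof.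
move=> Hf Hf1 HV HVV Hc HD.
have Hi : 0 < / V' by apply: Rinv_0_lt_compat; lra.
have Hle : / V' <= / V by apply: Rinv_le_contravar; lra.
have M := Dir_mono (twist_cm t Hf) (fun n => twist_bound t n Hf1) Hi Hle.
have U := Dir_upper Cmod_cst1 Hi; rewrite Rinv_inv in U.
set D' := Cmod (Dir _ (/ V')) in M HD; set D := Cmod (Dir (twist f t) (/ V)) in M *.
set z := Cmod (Dir cst1 (/ V)) in M *; set z' := Cmod (Dir cst1 (/ V')) in M U.
have P1 : 0 <= D' by exact: Cmod_ge_0.
have P2 : 0 <= D by exact: Cmod_ge_0.
have P3 : 0 <= z by exact: Cmod_ge_0.
have M2 : D' * z <= D * (2 * V').
  by apply: Rle_trans M _; apply: Rmult_le_compat_l; lra.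
have M3 : (D' * z) ^ 2 <= (D * (2 * V')) ^ 2.
  by apply: pow_incr; split => //; apply: Rmult_le_pos.
have M4 := Rmult_le_compat_r (z ^ 2) _ _ (pow2_ge_0 z) HD.
apply: (Rmult_le_reg_r (4 * V' ^ 2)); first by have : 0 < V' ^ 2 by [apply: pow_lt; lra]; lra.
rewrite (_ : c * eta ^ 2 / 4 * (L / V') * z ^ 2 * (4 * V' ^ 2) = c * eta ^ 2 * L * V' * z ^ 2); last by field; lra.
lra.
Qed.

Theorem theorem6p2 :
  exists c : R, 0 < c /\
  forall (f1 f2 : nat -> C) (eta x1 x2 : R),
    completely_multiplicative f1 ->
    completely_multiplicative f2 ->
    (forall n : nat, Cmod (f1 n) <= 1) ->
    (forall n : nat, Cmod (f2 n) <= 1) ->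
    0 < eta ->
    1 <= x1 -> 1 <= x2 ->
    Cmod (psum f1 x1) >= eta * x1 ->
    Cmod (psum f2 x2) >= eta * x2 ->
    exists x : R,
      x >= Rpower (Rmin x1 x2) (c * eta ^ 6) /\
      Cmod (psum (fun n => Cmult (f1 n) (f2 n)) x) >= (c * eta ^ 6) * x.
Proof.
have [c1 [C1 [K [Hc1 [HC1 [HK HT]]]]]] := mean_value_twist.
(* [/ 4] gives [xi <= / 2] and [L >= 2], so that taking integer parts leaves at least [L / 2];
   [/ (4 * K)] secures the threshold of [mean_value_twist]; the third bound yields the final
   contradiction, [c1^2 / 40] against [c1^2 / 32]. *)
pose c := Rmin (/ 4) (Rmin (/ (4 * K)) (c1 ^ 2 / (400 * (1 + C1)))).
have Hc12 : 0 < c1 ^ 2 by exact: pow_lt.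
have Hc : 0 < c.
  apply: Rmin_pos; first lra; apply: Rmin_pos; first by apply: Rinv_0_lt_compat; lra.
  by apply: Rdiv_lt_0_compat; lra.
have c_quarter : c <= / 4 by exact: Rmin_l.
have c_K : c <= / (4 * K) by apply: Rle_trans (Rmin_r _ _) (Rmin_l _ _).
have c_C : c <= c1 ^ 2 / (400 * (1 + C1)) by apply: Rle_trans (Rmin_r _ _) (Rmin_r _ _).
clearbody c; exists c; split => // f1 f2 eta x1 x2 Cf1 Cf2 B1 B2 He Hx1 Hx2 /Rge_le S1 /Rge_le S2.
have floor_ge x : 1 <= x -> (0 < nfloor x)%N /\ INR (nfloor x) <= x /\ ln x - 1 <= ln (INR (nfloor x)).
  move=> Hx; have [F1 F2] := @nfloor_spec x ltac:(lra).
  have HN : (0 < nfloor x)%N by case: (nfloor x) F2 => //; rewrite INR0; lra.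
  do 2 (split => //); have HNr := INR_ge1 HN.
  have : ln (x / INR (nfloor x)) <= x / INR (nfloor x) - 1.
    by apply: ln_le_sub1; apply: Rdiv_lt_0_compat; lra.
  rewrite lnV; try lra.
  have : x / INR (nfloor x) <= 2.
    apply: (Rmult_le_reg_r (INR (nfloor x))); first lra.
    by rewrite /Rdiv Rmult_assoc Rinv_l; lra.
  lra.
have [N1 [N1x L1x]] := floor_ge x1 Hx1; have [N2 [N2x L2x]] := floor_ge x2 Hx2.
have He1 : eta <= 1.
  apply: (Rmult_le_reg_r x1); first lra.
  by have := csum_bound (nfloor x1) B1; rewrite /psum in S1; lra.
set y := Rmin x1 x2; have Hy : 1 <= y by apply: Rmin_glb.
set xi := c * eta ^ 6.
have He6 : 0 < eta ^ 6 <= 1.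
  by split; [apply: pow_lt|have := @pow_incr eta 1 6 ltac:(lra); rewrite pow1].
have Hxi : 0 < xi <= / 2 by rewrite /xi; nra.
set L := ln y; have HL : 0 <= L by exact: ln_ge0.
have EY : Rpower y xi = exp (xi * L) by [].
have EY1 : 1 <= Rpower y xi by rewrite EY; apply: exp_ge1; nra.
(* If [y^xi < 2], then [x = y^xi] works at once: the sum is its first term 1, and [xi x < 1].
   Otherwise [xi L >= / 2], which later absorbs additive constants. *)
case: (Rlt_dec (xi * L) (ln 2)) => Hcase.
  exists (Rpower y xi); split; first lra.
  have HY2 : Rpower y xi < 2 by rewrite EY -[X in _ < X](exp_ln 2); [exact: exp_increasing|lra].
  rewrite /psum (@nfloor_unique 1 (Rpower y xi)); last by rewrite INR1; lra.
  rewrite /= (proj1 Cf1) (proj1 Cf2) Cmult_1_l Cplus_0_l Cmod_1; nra.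
have Hln2 : / 2 <= ln 2 by have := @ln_ge_1sub 2 ltac:(lra); lra.
have HxiL : / 2 <= xi * L by lra.
have LL : 1 <= c * L * 2.
  have : xi * L <= c * L by apply: Rmult_le_compat_r => //; rewrite /xi; nra.
  lra.
have L_ge2 : 2 <= L by have := Rmult_le_compat_r _ _ _ HL c_quarter; lra.
have Lx1 : L <= ln x1 by apply: ln_mono; [lra|exact: Rmin_l].
have Lx2 : L <= ln x2 by apply: ln_mono; [lra|exact: Rmin_r].
have He2 : 0 < eta ^ 2 by exact: pow_lt.
have KL : K <= eta ^ 2 * (L / 2).
  have E4 : eta ^ 4 <= 1 by have := @pow_incr eta 1 4 ltac:(lra); rewrite pow1.
  have Q : / 2 <= c * (eta ^ 2 * L).
    apply: Rle_trans HxiL _; rewrite /xi (_ : c * eta ^ 6 * L = c * (eta ^ 2 * L) * eta ^ 4); last ring.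
    rewrite -[X in _ <= X]Rmult_1_r; apply: Rmult_le_compat_l => //.
    by apply: Rmult_le_pos; [lra|apply: Rmult_le_pos; lra].
  have Q2 : c * (eta ^ 2 * L) <= / (4 * K) * (eta ^ 2 * L).
    by apply: Rmult_le_compat_r => //; apply: Rmult_le_pos; lra.
  have := Rmult_le_compat_l (4 * K) _ _ ltac:(lra) (Rle_trans _ _ _ Q Q2).
  rewrite -Rmult_assoc Rinv_r; lra.
have Kj x : L <= ln x -> ln x - 1 <= ln (INR (nfloor x)) -> K <= eta ^ 2 * ln (INR (nfloor x)).
  move=> H1 H2; apply: Rle_trans KL _; apply: Rmult_le_compat_l; lra.
have Sj f x : INR (nfloor x) <= x -> eta * x <= Cmod (psum f x) -> eta * INR (nfloor x) <= Cmod (csum f (nfloor x)).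
  by move=> H1 H2; apply: Rle_trans H2; apply: Rmult_le_compat_l; lra.
have [V1 [t1 [HV1 [Ht1 D1]]]] := HT f1 (nfloor x1) eta Cf1 B1 N1 (conj He He1) (Sj _ _ N1x S1) (Kj _ Lx1 L1x).
have [V2 [t2 [HV2 [Ht2 D2]]]] := HT f2 (nfloor x2) eta Cf2 B2 N2 (conj He He1) (Sj _ _ N2x S2) (Kj _ Lx2 L2x).
set L1 := ln (INR (nfloor x1)) in HV1 D1 L1x; set L2 := ln (INR (nfloor x2)) in HV2 D2 L2x.
set V := Rmin (Rmin V1 V2) L.
have HVV1 : V <= V1 by apply: Rle_trans (Rmin_l _ _) (Rmin_l _ _).
have HVV2 : V <= V2 by apply: Rle_trans (Rmin_l _ _) (Rmin_r _ _).
have HVL : V <= L by exact: Rmin_r.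
have HV : 1 <= V by apply: Rmin_glb; [apply: Rmin_glb|]; lra.
have Hce : 0 < c1 * eta ^ 2 by apply: Rmult_lt_0_compat.
have HL1 : 0 <= L1 by lra.
have T1 := twist_transfer Cf1 B1 HV HVV1 (Rmult_le_pos _ _ (Rlt_le _ _ Hce) HL1) D1.
have HL2 : 0 <= L2 by lra.
have T2 := twist_transfer Cf2 B2 HV HVV2 (Rmult_le_pos _ _ (Rlt_le _ _ Hce) HL2) D2.
have Hi : 0 < / V by apply: Rinv_0_lt_compat; lra.
have P := Dir_product (twist_cm t1 Cf1) (twist_cm t2 Cf2) (fun n => twist_bound t1 n B1) (fun n => twist_bound t2 n B2) Hi.
rewrite (Dir_ext _ (twist_mul f1 f2 t1 t2)) in P.
have Z := zeta_lower Hi; rewrite Rinv_inv in Z.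
set z := Cmod (Dir cst1 (/ V)) in T1 T2 P Z.
set f12 := fun n => (f1 n * f2 n)%C in P *.
set D := Cmod (Dir (twist f12 (t1 + t2)) (/ V)) in P.
have R1 : 1 <= L1 / V1.
  by apply: (Rmult_le_reg_r V1); [lra|rewrite /Rdiv Rmult_assoc Rinv_l; lra].
have R2 : 1 <= L2 / V2.
  by apply: (Rmult_le_reg_r V2); [lra|rewrite /Rdiv Rmult_assoc Rinv_l; lra].
(* [V] is one of [V1], [V2], [L]. In the first two cases it cancels one denominator and leaves [L1]
   or [L2], both at least [L / 2]; every remaining ratio is at least 1. *)
have RV : L / 2 <= V * (L1 / V1 * (L2 / V2)).
  have A : V = V1 \/ V = V2 \/ V = L.
    by rewrite /V /Rmin; case: Rle_dec => _; [case: Rle_dec => _; [left|right; left]|right; right].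
  case: A => [E|[E|E]].
  - have : V * (L1 / V1 * 1) <= V * (L1 / V1 * (L2 / V2)) by repeat apply: Rmult_le_compat_l; lra.
    rewrite {1}E (_ : V1 * (L1 / V1 * 1) = L1); [lra|field; lra].
  - have : V * (1 * (L2 / V2)) <= V * (L1 / V1 * (L2 / V2)).
      by apply: Rmult_le_compat_l; [lra|apply: Rmult_le_compat_r; lra].
    rewrite {1}E (_ : V2 * (1 * (L2 / V2)) = L2); [lra|field; lra].
  - have : V * (1 * 1) <= V * (L1 / V1 * (L2 / V2)).
      by apply: Rmult_le_compat_l; [lra|apply: Rmult_le_compat; lra].
    lra.
have Lower : c1 ^ 2 * eta ^ 4 / 32 * L <= D.
  have z0 : 0 < z by lra.
  have z3 : 0 < z ^ 3 by exact: pow_lt.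
  have N0 x : 1 <= x -> 0 <= c1 * eta ^ 2 / 4 * x * z ^ 2.
    move=> Hx; apply: Rmult_le_pos; last exact: pow2_ge_0.
    by apply: Rmult_le_pos; lra.
  have Q := Rle_trans _ _ _ (Rmult_le_compat _ _ _ _ (N0 _ R1) (N0 _ R2) T1 T2) P.
  have Q2 : c1 ^ 2 * eta ^ 4 / 16 * (z * (L1 / V1 * (L2 / V2))) <= D.
    apply: (Rmult_le_reg_l (z ^ 3)) => //.
    suff <- : c1 * eta ^ 2 / 4 * (L1 / V1) * z ^ 2 * (c1 * eta ^ 2 / 4 * (L2 / V2) * z ^ 2) =
      z ^ 3 * (c1 ^ 2 * eta ^ 4 / 16 * (z * (L1 / V1 * (L2 / V2)))) by exact: Q.
    by field; lra.
  apply: Rle_trans Q2.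
  have W : L / 2 <= z * (L1 / V1 * (L2 / V2)).
    apply: Rle_trans RV _; apply: Rmult_le_compat_r => //; nra.
  have cc : 0 <= c1 ^ 2 * eta ^ 4 / 16.
    by apply: Rmult_le_pos; [apply: Rmult_le_pos; [lra|apply: pow_le; lra]|lra].
  have := Rmult_le_compat_l _ _ _ cc W; lra.
apply: NNPP => Hno.
have Hsmall n : (0 < n)%N -> Rpower y xi <= INR n -> Cmod (csum f12 n) <= xi * INR n.
  move=> Hn Hyn; left; apply: Rnot_le_lt => Hge; apply: Hno; exists (INR n); split; first lra.
  by rewrite /psum (@nfloor_unique n); [lra|lra].
have U := @Dir_upper_twist f12 (t1 + t2) V (Rpower y xi) xi (fun n => prod_bound n B1 B2) HV EY1 ltac:(lra) Hsmall.
rewrite -/D EY ln_exp in U.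
have Ht : 2 + Rabs (t1 + t2) <= (2 + 2 * C1) / eta ^ 2.
  have E2 : eta ^ 2 <= 1 by have := @pow_incr eta 1 2 ltac:(lra); rewrite pow1.
  have : 1 <= / eta ^ 2 by rewrite -Rinv_1; apply: Rinv_le_contravar.
  have := Rabs_triang t1 t2; rewrite /Rdiv in Ht1 Ht2 *; nra.
(* The 5 is [2 + 1 + 2], from [1 <= 2 xi L] and [1 + V <= 2 L]. *)
have Hb : 1 + xi * L + xi * (1 + V) <= 5 * (xi * L).
  have : xi * (1 + V) <= xi * (2 * L) by apply: Rmult_le_compat_l; lra.
  lra.
have U2 : D <= (2 + 2 * C1) / eta ^ 2 * (5 * (xi * L)).
  apply: Rle_trans U _; apply: Rmult_le_compat => //.
    by have := Rabs_pos (t1 + t2); lra.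
  by have : 0 <= xi * (1 + V) by [apply: Rmult_le_pos; lra]; lra.
rewrite (_ : _ * (5 * (xi * L)) = 10 * (1 + C1) * c * (eta ^ 4 * L)) in U2; last first.
  by rewrite /xi; field; lra.
have X : 0 < eta ^ 4 * L by apply: Rmult_lt_0_compat; [exact: pow_lt|lra].
have Y := Rle_trans _ _ _ Lower U2.
have Y2 : c1 ^ 2 / 32 <= 10 * (1 + C1) * c.
  by apply: (Rmult_le_reg_r (eta ^ 4 * L)) => //; lra.
have := Rmult_le_compat_l (10 * (1 + C1)) _ _ ltac:(lra) c_C.
rewrite (_ : 10 * (1 + C1) * (c1 ^ 2 / _) = c1 ^ 2 / 40); last by field; lra.
lra.
Qed.
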